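(* Let $m\ge 2$, $n\ge 1$, let $I\subset\mathbb{R}$ be an interval, let $\gamma\colon I\to\mathbb{R}^{m+n}$ be a smooth regular embedded curve, and let $\mathscr{D}$ be a smooth distribution of rank $m$ along $\gamma$ such that $\dot\gamma(t)\in\mathscr{D}_t$ for all $t\in I$. Assume that the function $\pi^{\perp}(\overline{D}_t\dot\gamma)$ is never zero. Then the geometric Cauchy problem for rank-one submanifolds of $\mathbb{R}^{m+n}$ with data $(\gamma,\mathscr{D})$, namely, to find an $m$-dimensional rank-one submanifold $M$ of $\mathbb{R}^{m+n}$ containing $\gamma(I)$ and satisfying $T_{\gamma(t)}M=\mathscr{D}_t$ for all $t\in I$, has a solution if and only if the linear map $\rho_t\colon\mathscr{D}_t^{\perp}\to\mathscr{D}_t$, $\nu\mapsto\pi^{\top}(\overline{D}_t\nu)$, has rank one for every $t\in I$. Moreover: (i) The solution is unique in the following sense: if $M_1$ and $M_2$ are two solutions of the Cauchy problem, then they coincide on an open set containing $\gamma(I)$. (ii) In such a neighborhood, the unique solution $M$ satisfies $M=\gamma+\mathscr{D}\cap(\operatorname{Im}\rho)^{\perp}$, i.e. $M$ is there the union over $t\in I$ of the affine subspaces $\gamma(t)+\bigl(\mathscr{D}_t\cap(\operatorname{Im}\rho_t)^{\perp}\bigr)$. (iii) When $I$ is closed, $M$ can be parametrized as follows (with $\gamma$ taken to be unit-speed). Let $(E_1,\dots,E_m)$ be a smooth orthonormal frame for $\mathscr{D}$ satisfying $E_1=\dot\gamma$. Choose a smooth section $N$ of $\mathscr{D}^{\perp}$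 such that $\pi^{\top}(\overline{D}_tN)$ is nonvanishing. For any $j=1,\dots,m-1$, let $$X_j=\bigl(\overline{D}_tE_{j+1}\cdot N\bigr)E_1-\bigl(\overline{D}_tE_1\cdot N\bigr)E_{j+1}.$$ For sufficiently small $\varepsilon>0$, let $\sigma\colon I\times(-\varepsilon,\varepsilon)^{m-1}\to\mathbb{R}^{m+n}$ be defined by $$\sigma(t,u^1,\dots,u^{m-1})=\gamma(t)+u^1X_1(t)+\dots+u^{m-1}X_{m-1}(t).$$ Then $M=\operatorname{Im}\sigma$.
   Context: A distribution of rank $m$ along $\gamma\colon I\to\mathbb{R}^{m+n}$ is a smooth rank-$m$ subbundle of $T\mathbb{R}^{m+n}|_\gamma=\bigsqcup_{t\in I}T_{\gamma(t)}\mathbb{R}^{m+n}$. $\mathscr{D}^{\perp}_t$ is the orthogonal complement of $\mathscr{D}_t$ in $T_{\gamma(t)}\mathbb{R}^{m+n}$ for the Euclidean metric (denoted by a dot), and $\mathscr{D}^{\perp}=\bigcup_t\mathscr{D}_t^{\perp}$. $\pi^{\top}$ and $\pi^{\perp}$ are the orthogonal projections onto $\mathscr{D}$ and $\mathscr{D}^{\perp}$. $\overline{D}_t$ is the Euclidean covariant derivative along $\gamma$ (componentwise $t$-derivative). In the definition of $\rho_t(\nu)$, the vector $\nu\in\mathscr{D}_t^{\perp}$ is extended arbitrarily to a smooth local section of $\mathscr{D}^{\perp}$; the result does not depend on the extension. $(\operatorname{Im}\rho_t)^{\perp}$ is the orthogonal complement in the ambient tangent space $T_{\gamma(t)}\mathbb{R}^{m+n}$.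 An $m$-dimensional embedded submanifold $M$ of $\mathbb{R}^{m+n}$ with second fundamental form $\alpha$ is rank-one if at every $p\in M$ the nullity space $\Delta=\{x\in T_pM\mid\alpha(x,\cdot)=0\}$ has dimension $m-1$. Equivalently, $M$ has no point where $\alpha$ vanishes, is foliated by open subsets of $(m-1)$-dimensional affine subspaces (rulings), and its tangent space is constant along each ruling. The solution is considered locally, near $\gamma(I)$.
   Formalization: If I has an endpoint, M is undetermined past it, so in (i)-(iii) the open set contains γ(interior of I); the strip or Im σ over all of I still lies in M. In (ii) the affine subspaces are cut to discs of continuous radius r(t)>0. In (iii) ''closed'' means compact. *)

(* Defs.v *)
From HB Require Import structures.
From mathcomp Require Import all_boot all_order all_algebra.
From mathcomp Require Import all_classical all_reals all_analysis.

Set Implicit Arguments.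
Unset Strict Implicit.
Unset Printing Implicit Defensive.

Import Order.TTheory GRing.Theory Num.Theory.
Import numFieldNormedType.Exports.

Local Open Scope classical_set_scope.
Local Open Scope ring_scope.

Section Smooth.
Variables (R : realType) (V W : normedModType R).

Definition iter_derive (vs : seq V) (f : V -> W) : V -> W :=
  foldr (fun v g x => 'D_v g x) f vs.

(* [S] need not be open: [f] is then C^oo on an open set containing [S].  For a
   nondegenerate interval [S] the restrictions to [S] of such [f] are the maps
   smooth up to the endpoints, and the derivatives of [f] at the points of [S]
   depend only on the restriction of [f] to [S]. *)
Definition smooth_on (S : set V) (f : V -> W) : Prop :=
  exists O : set V, [/\ open O, S `<=` O &
    forall (vs : seq V) (x : V), O x ->
      (forall v, derivable (iter_derive vs f) x v) /\
      {for x, continuous (iter_derive vs f)}].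

Definition smooth_embedding (S : set V) (f : V -> W) : Prop :=
  [/\ smooth_on S f,
      (forall x v, S x -> 'D_v f x = 0 -> v = 0) &
      exists g : W -> V,
        (forall x, S x -> g (f x) = x) /\ {within f @` S, continuous g}].

End Smooth.

Section Euclidean.
Variables (R : realType) (N : nat).
Local Notation E := 'rV[R]_N.

Definition dot (u v : E) : R := \sum_(i < N) u 0 i * v 0 i.

Definition orth (S : set E) : set E :=
  [set v | forall w, S w -> dot v w = 0].

(* Meaningful when [S] is a linear subspace. *)
Definition proj (S : set E) (v : E) : E :=
  xget 0 [set w | S w /\ orth S (v - w)].

Definition perp_proj (S : set E) (v : E) : E := v - proj S v.

Definition has_dim (S : set E) (k : nat) : Prop :=
  exists U : {vspace E}, \dim U = k /\ S = [set` U].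

End Euclidean.

Section Submanifold.
Variables (R : realType) (N : nat).
Local Notation E := 'rV[R]_N.

Definition embedded_submanifold (m : nat) (M : set E) : Prop :=
  forall p, M p ->
    exists (U : set E) (V : set 'rV[R]_m) (phi : 'rV[R]_m -> E),
      [/\ open U, U p, open V, smooth_embedding V phi & phi @` V = M `&` U].

Definition tangent_space (M : set E) (p : E) : set E :=
  [set v | exists c : R -> E,
    [/\ smooth_on [set 0] c, c 0 = p, (\forall s \near 0, M (c s)) &
        derive1 c 0 = v]].

(* alpha(x, y) is the normal component of the Euclidean derivative in the
   direction x of a local extension of y tangent to M along M; it does not
   depend on the extension. *)
Definition second_fundamental_form (M : set E) (p x y : E) : E :=
  xget 0 [set a | exists Y : E -> E,
    [/\ smooth_on [set p] Y,
        (\forall q \near p, M q -> tangent_space M q (Y q)),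
        Y p = y &
        a = perp_proj (tangent_space M p) ('D_x Y p)]].

Definition nullity (M : set E) (p : E) : set E :=
  [set x | tangent_space M p x /\
    forall y, tangent_space M p y -> second_fundamental_form M p x y = 0].

Definition rank_one (m : nat) (M : set E) : Prop :=
  forall p, M p -> has_dim (nullity M p) m.-1.

End Submanifold.

Section CauchyProblem.
Variables (R : realType) (N : nat).
Local Notation E := 'rV[R]_N.
Implicit Types (I : set R) (gamma : R -> E) (D : R -> {vspace E}).

(* Curves, distributions and sections along an interval [I] are given by total
   functions on [R], of which only the restriction to [I] is relevant. *)

Definition smooth_distribution (m : nat) I D : Prop :=
  (forall t, I t -> \dim (D t) = m) /\
  (forall t0, I t0 -> exists e : nat -> R -> E,
    (forall i, (i < m)%N -> smooth_on [set t0] (e i)) /\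
    (\forall t \near t0, I t -> D t = <<mkseq (fun i => e i t) m>>%VS)).

(* The value does not depend on the local extension [s] of [nu] to a section of
   the orthogonal bundle. *)
Definition rho I D (t : R) (nu : E) : E :=
  xget 0 [set w | exists s : R -> E,
    [/\ smooth_on [set t] s,
        (\forall u \near t, I u -> orth [set` D u] (s u)),
        s t = nu &
        w = proj [set` D t] (derive1 s t)]].

Definition im_rho I D (t : R) : set E := rho I D t @` orth [set` D t].

(* [M] has no boundary, so it extends past an endpoint of [I] that belongs to
   [I], and there it is not determined by the data: coincidence on an open set
   can only be claimed around the image of the interior of [I] (which is [I]
   itself when [I] is open). *)
Definition is_solution (m : nat) I gamma D (M : set E) : Prop :=
  [/\ embedded_submanifold m M,
      rank_one m M,
      gamma @` I `<=` M &
      forall t, I t -> tangent_space M (gamma t) = [set` D t]].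

(* The union over [t] in [J] of the discs of radius [r t] centred at [gamma t]
   in the affine subspaces gamma(t) + (D_t `&` (Im rho_t)^perp). *)
Definition ruled_strip I gamma D (J : set R) (r : R -> R) : set E :=
  [set p | exists t v, [/\ J t, v \in D t, orth (im_rho I D t) v,
    Num.sqrt (dot v v) < r t & p = gamma t + v]].

(* The frame (E_1, ..., E_m) is [e 0], ..., [e m.-1]. *)
Definition adapted_frame (m : nat) I gamma D (e : nat -> R -> E) : Prop :=
  [/\ (forall i, (i < m)%N -> smooth_on I (e i)),
      (forall t, I t -> D t = <<mkseq (fun i => e i t) m>>%VS),
      (forall t i j, I t -> (i < m)%N -> (j < m)%N ->
         dot (e i t) (e j t) = (i == j)%:R) &
      (forall t, I t -> e 0%N t = derive1 gamma t)].

Definition transversal_section I D (nu : R -> E) : Prop :=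
  [/\ smooth_on I nu,
      (forall t, I t -> orth [set` D t] (nu t)) &
      (forall t, I t -> proj [set` D t] (derive1 nu t) != 0)].

(* [ruling_field e nu j] is X_{j+1}. *)
Definition ruling_field (e : nat -> R -> E) (nu : R -> E) (j : nat) (t : R) : E :=
  dot (derive1 (e j.+1) t) (nu t) *: e 0%N t
  - dot (derive1 (e 0%N) t) (nu t) *: e j.+1 t.

Definition sigma (m : nat) gamma (e : nat -> R -> E) (nu : R -> E)
    (p : R * 'rV[R]_m.-1) : E :=
  gamma p.1 + \sum_(j < m.-1) p.2 0 j *: ruling_field e nu j p.1.

End CauchyProblem.

Definition cube (R : realType) (k : nat) (eps : R) : set 'rV[R]_k :=
  [set u | forall j, `|u 0 j| < eps].

(* Main.v *)
Require Import Defs.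
From HB Require Import structures.
From mathcomp Require Import all_boot all_order all_algebra.
From mathcomp Require Import all_classical all_reals all_analysis.
From mathcomp Require Import ring lra.

Set Implicit Arguments.
Unset Strict Implicit.
Unset Printing Implicit Defensive.

Import Order.TTheory GRing.Theory Num.Theory.
Import numFieldNormedType.Exports.

Local Open Scope classical_set_scope.
Local Open Scope ring_scope.

(* Over its tangent space at a point, M is the graph of some F, and the null
   directions of D^2 F are those orthogonal to a single linear form. Along a
   straight segment in a null direction the form satisfies a linear ODE, so the
   direction stays null and the tangent space is constant: M contains the
   affine ruling. At gamma(t), where the normal part of gamma'' pairs
   nontrivially with the form, the ruling is D_t cap (Im rho_t)^perp, and a
   point of M near gamma lies on the ruling of a nearby gamma(s). Hence
   rho has rank one, and (i), (ii).
   Conversely, let the rows of A(t) span D_t, normalized as a graph matrix. The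
   rank condition says A' = a beta with a column a and a row beta, which can be
   integrated past the endpoints of I. In the graph coordinates x of D_t, let
   tau(x) be the parameter with (x - x(tau)) a(tau) = 0, where x(t) is the
   coordinate of gamma(t). The graph of
   F(x) = gamma(tau) + (x - x(tau)) A(tau) solves the problem, because its
   derivative A(tau(x)) depends on tau alone.
   In (iii) the X_j form a basis of the rulings, uniformly transverse to gamma
   on the compact I, which makes sigma injective with continuous inverse on a
   thin cube. The global orthonormal frame is glued from local ones. *)

(** * Smooth maps between normed spaces *)

(** Three obstacles shape the proof. Straightness of the rulings is obtained without a flow or
    Frobenius: a scalar component f of the graph with f_dd nonzero has a Hessian of rank one, so
    f_dd f_vv = (f_dv)^2; differentiating f_vv = (f_dv)^2 / f_dd along d, and using the symmetry of
    third derivatives, makes f_dv satisfy a homogeneous linear equation along the segment in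
    direction v, hence stay zero once it is zero. An endpoint of [I] that belongs to [I] must become
    an inner point of a curve on M, so existence needs data on an open interval; outside [I] the
    frame at hand has no reason to keep a rank-one derivative, and frame and curve are therefore
    integrated anew from a rank-one factor. Finally, every construction is local in t whereas M and
    its strips are global: local radii are replaced by a single 1/2-Lipschitz radius function, so
    that neighbouring parameters have comparable radii, and the embeddedness of [gamma] keeps pieces
    with distant parameters apart. *)

Section Ck_def.
Variables (R : realType) (V W : normedModType R).

(** The recursion runs through directional derivatives, so no space of multilinear maps is needed.
    Fréchet differentiability is demanded at each order, which [smooth_on] does not do, because the
    chain rule depends on it. *)
Fixpoint Ck (n : nat) (O : set V) (f : V -> W) : Prop :=
  match n with
  | 0 => forall x, O x -> {for x, continuous f}
  | n.+1 => (forall x, O x -> differentiable f x) /\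
            forall v, Ck n O ('D_v f)
  end.

Definition smooth (O : set V) (f : V -> W) := forall n, Ck n O f.

Lemma CkSE n (O : set V) (f : V -> W) : Ck n.+1 O f ->
  (forall x, O x -> differentiable f x) /\ forall v, Ck n O ('D_v f).
Proof. by []. Qed.

End Ck_def.

Section Ck.
Variables (R : realType).

Lemma smooth_diff (V W : normedModType R) (O : set V) (f : V -> W) x :
  smooth O f -> O x -> differentiable f x.
Proof. by move=> /(_ 1%N)[+ _]; exact. Qed.

Lemma smooth_derive (V W : normedModType R) (O : set V) (f : V -> W) v :
  smooth O f -> smooth O ('D_v f).
Proof. by move=> sf n; have [_] := sf n.+1; exact. Qed.

Lemma smooth_cont (V W : normedModType R) (O : set V) (f : V -> W) x :
  smooth O f -> O x -> {for x, continuous f}.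
Proof. by move=> /(_ 0%N); exact. Qed.

Lemma CkS (V W : normedModType R) (O : set V) n : forall f : V -> W,
  Ck n.+1 O f -> Ck n O f.
Proof.
elim: n => [f [df _] x Ox|n IH f /CkSE[df Df]]; first exact/differentiable_continuous/df.
by split=> // v; apply: IH; exact: Df.
Qed.

Lemma Ck_sub (V W : normedModType R) (O O' : set V) n : O' `<=` O ->
  forall f : V -> W, Ck n O f -> Ck n O' f.
Proof.
move=> O'O; elim: n => [f cf x Ox|n IH f /CkSE[df Df]]; first exact/cf/O'O.
by split=> [x Ox|v]; [exact/df/O'O|apply: IH; exact: Df].
Qed.

Lemma smooth_sub (V W : normedModType R) (O O' : set V) (f : V -> W) :
  O' `<=` O -> smooth O f -> smooth O' f.
Proof. by move=> sO sf n; apply: Ck_sub (sf n). Qed.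

Lemma near_open (V : topologicalType) (O : set V) x (P : V -> Prop) :
  open O -> O x -> (forall y, O y -> P y) -> \forall y \near x, P y.
Proof.
move=> oO Ox HP; have : nbhs x O by apply: open_nbhs_nbhs; split.
by apply: filterS.
Qed.

Lemma near_eq_continuous (V W : topologicalType) (f g : V -> W) x :
  (\near x, f x = g x) -> {for x, continuous f} -> {for x, continuous g}.
Proof.
move=> fg cf; change (g @ x --> g x); rewrite -(nbhs_singleton fg).
apply: cvg_trans cf; apply: near_eq_cvg.
by apply: filterS fg => y ->.
Qed.

Lemma near_eq_differentiable (V W : normedModType R) (f g : V -> W) x :
  (\near x, f x = g x) -> differentiable f x -> differentiable g x.
Proof.
move=> fg df; have [cd fE] := (diff_locallyP _ _).1 df.
suff gE : g \o shift x = cst (g x) + 'd f x +o_ 0 id.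
  have dg : 'd g x = 'd f x :> (V -> W) by exact: diff_unique.
  by apply/diff_locallyP; rewrite dg.
have fg' : \forall h \near (0 : V), f (h + x) = g (h + x).
  have cs : {for 0, continuous (shift x)}.
    apply: (@continuousD _ _ _ id (cst x)); first exact: cvg_id.
    exact: cst_continuous.
  have : nbhs (shift x 0) [set y | f y = g y] by rewrite /= add0r.
  by move=> /cs.
have /eqaddoP := fE => H.
apply/eqaddoP => e e0; rewrite -(nbhs_singleton fg).
have He : \forall h \near (0 : V), `|f (h + x) - (f x + 'd f x h)| <= e * `|h|.
  exact: (H e e0).
suff : \forall h \near (0 : V), `|g (h + x) - (f x + 'd f x h)| <= e * `|h| by [].
near=> h; rewrite -(near fg' h)//; near: h; exact: He.
Unshelve. all: by end_near. Qed.

(** * Algebra of C^k maps *)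

Section gen.
Variables (V W : normedModType R).

Lemma Ck_ext (O : set V) n : open O -> forall f g : V -> W,
  (forall x, O x -> f x = g x) -> Ck n O f -> Ck n O g.
Proof.
move=> oO; elim: n => [f g fg cf x Ox|n IH f g fg /CkSE[df Df]].
  by apply: near_eq_continuous (cf x Ox); apply: near_open fg.
split=> [x Ox|v].
  by apply: near_eq_differentiable (df x Ox); apply: near_open fg.
apply: IH (Df v) => x Ox; by apply: near_eq_derive; apply: near_open fg.
Qed.

Lemma smooth_ext (O : set V) (f g : V -> W) : open O ->
  (forall x, O x -> f x = g x) -> smooth O f -> smooth O g.
Proof. by move=> oO fg sf n; apply: Ck_ext (sf n). Qed.

Lemma Ck_cst (O : set V) n : forall (a : W), Ck n O (cst a : V -> W).
Proof.
elim: n => [a x _|n IH a]; first exact: cst_continuous.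
split=> [x _|v]; first exact: differentiable_cst.
have -> : 'D_v (cst a : V -> W) = cst 0 by apply/funext => x; rewrite derive_cst.
exact: IH.
Qed.

Lemma CkD (O : set V) n : open O -> forall f g : V -> W,
  Ck n O f -> Ck n O g -> Ck n O (fun x => f x + g x).
Proof.
move=> oO; elim: n => [f g cf cg x Ox|n IH f g /CkSE[df Df] /CkSE[dg Dg]].
  by apply: continuousD; [exact: cf|exact: cg].
split=> [x Ox|v]; first by apply: differentiableD; [exact: df|exact: dg].
apply: Ck_ext (IH _ _ (Df v) (Dg v)) => // x Ox.
by rewrite [RHS]deriveD//; apply: diff_derivable; [exact: df|exact: dg].
Qed.

Lemma Ck_sum (O : set V) n (J : Type) (r : seq J) (f : J -> V -> W) : open O ->
  (forall i, Ck n O (f i)) -> Ck n O (fun x => \sum_(i <- r) f i x).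
Proof.
move=> oO cf; elim: r => [|i r IH].
  by apply: Ck_ext (Ck_cst O n 0) => // x _; rewrite big_nil.
apply: Ck_ext (CkD oO (cf i) IH) => // x _; by rewrite big_cons.
Qed.

Lemma CkZl (O : set V) n : open O -> forall (k : V -> R) (w : W),
  Ck n O k -> Ck n O (fun x => k x *: w).
Proof.
move=> oO; elim: n => [k w ck x Ox|n IH k w /CkSE[dk Dk]].
  by apply: (@continuous_comp _ _ _ k ( *:%R^~ w)); [exact: ck|exact: scalel_continuous].
split=> [x Ox|v]; first exact/differentiableZl/dk.
apply: Ck_ext (IH _ w (Dk v)) => // x Ox.
rewrite [RHS]deriveE; last exact/differentiableZl/dk.
by rewrite diffZl ?deriveE//; exact: dk.
Qed.

End gen.

Section gen1.
Variables (V : normedModType R).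

Lemma CkM (O : set V) n : open O -> forall f g : V -> R,
  Ck n O f -> Ck n O g -> Ck n O (fun x => f x * g x).
Proof.
move=> oO; elim: n => [f g cf cg x Ox|n IH f g cf cg].
  by apply: continuousM; [exact: cf|exact: cg].
have [df Df] := CkSE cf; have [dg Dg] := CkSE cg.
split=> [x Ox|v]; first by apply: differentiableM; [exact: df|exact: dg].
apply: (@Ck_ext V _ O n oO (fun x => f x * 'D_v g x + g x * 'D_v f x)) => [x Ox|].
  by rewrite [RHS]deriveM//; apply: diff_derivable; [exact: df|exact: dg].
by apply: CkD => //; apply: IH => //; apply: CkS.
Qed.

Lemma CkV (O : set V) n : open O -> forall f : V -> R,
  (forall x, O x -> f x != 0) ->
  Ck n O f -> Ck n O (fun x => (f x)^-1).
Proof.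
move=> oO; elim: n => [f f0 cf x Ox|n IH f f0 cf].
  by apply: continuousV; [exact: f0|exact: cf].
have [df Df] := CkSE cf.
split=> [x Ox|v]; first by apply: differentiableV; [exact: df|exact: f0].
apply: (@Ck_ext V _ O n oO (fun x => -1 * ((f x)^-1 * (f x)^-1) * 'D_v f x)) => [x Ox|].
  rewrite [RHS]deriveV; [|exact: f0|apply: diff_derivable; exact: df].
  by rewrite expr2 invfM mulN1r.
have cI : Ck n O (fun x => (f x)^-1) by apply: IH => //; exact: CkS.
by do !apply: CkM => //; exact: Ck_cst.
Qed.

End gen1.

Section mx.
Variables (V : normedModType R) (p q : nat).

Lemma mx_sum_delta (f : V -> 'M[R]_(p, q)) x :
  f x = \sum_(ij : 'I_p * 'I_q) f x ij.1 ij.2 *: delta_mx ij.1 ij.2.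
Proof. by rewrite [LHS]matrix_sum_delta pair_bigA. Qed.

Lemma Ck_mx_of (O : set V) n (f : V -> 'M[R]_(p, q)) : open O ->
  (forall i j, Ck n O (fun x => f x i j)) -> Ck n O f.
Proof.
move=> oO cf.
apply: (@Ck_ext V _ O n oO
  (fun x => \sum_(ij : 'I_p * 'I_q) f x ij.1 ij.2 *: delta_mx ij.1 ij.2)).
  by move=> x _; rewrite -mx_sum_delta.
by apply: Ck_sum => // -[i j]; apply: CkZl => //; exact: cf.
Qed.

Lemma Ck_coord (O : set V) n i j : open O -> forall f : V -> 'M[R]_(p, q),
  Ck n O f -> Ck n O (fun x => f x i j : R).
Proof.
move=> oO; elim: n => [f cf x Ox|n IH f /CkSE[df Df]].
  apply: (@continuous_comp _ _ _ f (fun M => M i j)); first exact: cf.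
  exact: coord_continuous.
split=> [x Ox|v].
  by apply: (differentiable_comp (g := fun M : 'M[R]_(p, q) => M i j) (df x Ox)); exact: differentiable_coord.
apply: Ck_ext (IH _ (Df v)) => // x Ox.
rewrite derive_mx ?mxE//; apply: diff_derivable; exact: df.
Qed.

Lemma derive_coord (f : V -> 'M[R]_(p, q)) x v i j :
  differentiable f x -> 'D_v f x i j = 'D_v (fun x => f x i j) x.
Proof. by move=> df; rewrite derive_mx ?mxE//; apply: diff_derivable. Qed.

Lemma differentiable_mx_of (f : V -> 'M[R]_(p, q)) x :
  (forall i j, differentiable (fun x => f x i j) x) -> differentiable f x.
Proof.
move=> cf.
have -> : f = \sum_(ij : 'I_p * 'I_q) (fun x => f x ij.1 ij.2 *: delta_mx ij.1 ij.2).
  by apply/funext => y; rewrite mx_sum_delta; elim/big_ind2: _ => // ? ? ? ? -> ->.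
elim/big_ind : _ => [|? ? |[i j] _]; first exact: differentiable_cst.
  by apply: differentiableD.
by apply: differentiableZl; exact: cf.
Qed.

Lemma continuous_mx_of (f : V -> 'M[R]_(p, q)) x :
  (forall i j, {for x, continuous (fun x => f x i j)}) -> {for x, continuous f}.
Proof.
move=> cf.
have -> : f = \sum_(ij : 'I_p * 'I_q) (fun x => f x ij.1 ij.2 *: delta_mx ij.1 ij.2).
  by apply/funext => y; rewrite mx_sum_delta; elim/big_ind2: _ => // ? ? ? ? -> ->.
elim/big_ind : _ => [|? ? |[i j] _]; first exact: cst_continuous.
  by move=> ? ?; apply: continuousD.
apply: (@continuous_comp _ _ _ (fun x => f x i j) ( *:%R^~ (delta_mx i j))).
  exact: cf.
exact: scalel_continuous.
Qed.

End mx.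

Section comp.
Variables (V : normedModType R).

Lemma derive_comp_rV k (f : 'rV[R]_k -> R) (g : V -> 'rV[R]_k) x v :
  differentiable g x -> differentiable f (g x) ->
  'D_v (f \o g) x = \sum_(i < k) 'D_v (fun y => g y 0 i) x * 'D_(delta_mx 0 i) f (g x).
Proof.
move=> dg df; rewrite deriveE; last exact: differentiable_comp.
rewrite diff_comp//= [X in 'd f _ X]row_sum_delta linear_sum.
by apply: eq_bigr => i _; rewrite linearZ /= -(derive_coord _ _ _ dg) !deriveE.
Qed.

(** Written in coordinates, the chain rule expresses the derivative through coordinate derivatives
    of [g] and through compositions of partial derivatives of [f] with [g]. The induction therefore
    closes only if [f] varies while [g] stays fixed. *)
Lemma Ck_comp_rV k (O : set V) (O' : set 'rV[R]_k) n (g : V -> 'rV[R]_k) :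
  open O -> (forall x, O x -> O' (g x)) ->
  Ck n O g -> forall f : 'rV[R]_k -> R, Ck n O' f -> Ck n O (f \o g).
Proof.
move=> oO gO; elim: n => [cg f cf x Ox|n IH cg f /CkSE[df Df]].
  by apply: continuous_comp; [exact: cg|apply: cf; exact: gO].
have [dg Dg] := CkSE cg.
split=> [x Ox|v].
  by apply: differentiable_comp; [exact: dg|apply: df; exact: gO].
apply: (@Ck_ext _ _ O n oO (fun x => \sum_(i < k)
   'D_v (fun y => g y 0 i) x * ('D_(delta_mx 0 i) f \o g) x)) => [x Ox|].
  by rewrite derive_comp_rV//; [exact: dg|apply: df; exact: gO].
apply: Ck_sum => // i; apply: CkM => //.
  by have [_] := Ck_coord 0 i oO cg; apply.
by apply: IH => //; exact: CkS.
Qed.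

Lemma derive_comp_R (f : R -> R) (g : V -> R) x v :
  differentiable g x -> differentiable f (g x) ->
  'D_v (f \o g) x = 'D_v g x * 'D_1 f (g x).
Proof.
move=> dg df; rewrite deriveE; last exact: differentiable_comp.
by rewrite diff_comp//= -[X in 'd f _ X]mulr1 linearZ /= !deriveE.
Qed.

Lemma Ck_comp_R (O : set V) (O' : set R) n (g : V -> R) :
  open O -> (forall x, O x -> O' (g x)) ->
  Ck n O g -> forall f : R -> R, Ck n O' f -> Ck n O (f \o g).
Proof.
move=> oO gO; elim: n => [cg f cf x Ox|n IH cg f /CkSE[df Df]].
  by apply: continuous_comp; [exact: cg|apply: cf; exact: gO].
have [dg Dg] := CkSE cg.
split=> [x Ox|v].
  by apply: differentiable_comp; [exact: dg|apply: df; exact: gO].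
apply: (@Ck_ext _ _ O n oO (fun x => 'D_v g x * ('D_1 f \o g) x)) => [x Ox|].
  by rewrite derive_comp_R//; [exact: dg|apply: df; exact: gO].
by apply: CkM => //; apply: IH => //; exact: CkS.
Qed.

End comp.

Section matrices.
Variables (V : normedModType R) (O : set V) (oO : open O).

Lemma Ck_cstR n (a : R) : Ck n O (fun _ : V => a).
Proof. exact: Ck_cst. Qed.

Lemma Ck_prod n (J : Type) (r : seq J) (f : J -> V -> R) :
  (forall i, Ck n O (f i)) -> Ck n O (fun x => \prod_(i <- r) f i x).
Proof.
move=> cf; elim: r => [|i r IH].
  by apply: Ck_ext (Ck_cstR n 1) => // x _; rewrite big_nil.
by apply: Ck_ext (CkM oO (cf i) IH) => // x _; rewrite big_cons.
Qed.

Lemma CkN n p q (f : V -> 'M[R]_(p, q)) : Ck n O f -> Ck n O (fun x => - f x).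
Proof.
move=> cf; apply: Ck_mx_of => // i j.
apply: (Ck_ext oO _ (CkM oO (Ck_cstR n (-1)) (Ck_coord i j oO cf))) => x _.
by rewrite mxE mulN1r.
Qed.

Lemma CkB n p q (f g : V -> 'M[R]_(p, q)) :
  Ck n O f -> Ck n O g -> Ck n O (fun x => f x - g x).
Proof. by move=> cf cg; apply: CkD => //; exact: CkN. Qed.

Lemma CkBr n (f g : V -> R) : Ck n O f -> Ck n O g -> Ck n O (fun x => f x - g x).
Proof.
move=> cf cg; apply: CkD => //.
apply: (Ck_ext oO _ (CkM oO (Ck_cstR n (-1)) cg)) => x _.
by rewrite mulN1r.
Qed.

Lemma Ck_scalemx n p q (a : V -> R) (f : V -> 'M[R]_(p, q)) :
  Ck n O a -> Ck n O f -> Ck n O (fun x => a x *: f x).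
Proof.
move=> ca cf; apply: Ck_mx_of => // i j.
apply: (Ck_ext oO _ (CkM oO ca (Ck_coord i j oO cf))) => x _.
by rewrite mxE.
Qed.

Lemma Ck_mulmx n p q r (f : V -> 'M[R]_(p, q)) (g : V -> 'M[R]_(q, r)) :
  Ck n O f -> Ck n O g -> Ck n O (fun x => f x *m g x).
Proof.
move=> cf cg; apply: Ck_mx_of => // i j.
apply: (@Ck_ext V _ O n oO (fun x => \sum_k f x i k * g x k j)).
  by move=> x _; rewrite mxE.
by apply: Ck_sum => // k; apply: CkM => //; apply: Ck_coord.
Qed.

Lemma Ck_trmx n p q (f : V -> 'M[R]_(p, q)) :
  Ck n O f -> Ck n O (fun x => (f x)^T).
Proof.
move=> cf; apply: Ck_mx_of => // i j.
by apply: (Ck_ext oO _ (Ck_coord j i oO cf)) => x _; rewrite mxE.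
Qed.

Lemma Ck_det n p (f : V -> 'M[R]_p) : Ck n O f -> Ck n O (fun x => \det (f x)).
Proof.
move=> cf; apply: Ck_sum => // s; apply: CkM => //; first exact: Ck_cst.
by apply: Ck_prod => i; apply: Ck_coord.
Qed.

Lemma Ck_adj n p (f : V -> 'M[R]_p) : Ck n O f -> Ck n O (fun x => \adj (f x)).
Proof.
move=> cf; apply: Ck_mx_of => // i j.
apply: (@Ck_ext V _ O n oO (fun x => (-1) ^+ (j + i) * \det (row' j (col' i (f x))))).
  by move=> x _; rewrite mxE.
apply: CkM => //; first exact: Ck_cst.
apply: Ck_det; apply: Ck_mx_of => // k l.
by apply: (Ck_ext oO _ (Ck_coord (lift j k) (lift i l) oO cf)) => x _; rewrite !mxE.
Qed.

(** Cramer's rule: the inverse is the adjugate, polynomial in the entries, over the determinant. *)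
Lemma Ck_invmx n p (f : V -> 'M[R]_p) :
  (forall x, O x -> f x \in unitmx) -> Ck n O f -> Ck n O (fun x => invmx (f x)).
Proof.
move=> fu cf.
apply: (@Ck_ext V _ O n oO (fun x => (\det (f x))^-1 *: \adj (f x))).
  by move=> x Ox; rewrite /invmx fu.
apply: Ck_scalemx; last exact: Ck_adj.
apply: CkV => //; last exact: Ck_det.
by move=> x Ox; have := fu _ Ox; rewrite unitmxE unitfE.
Qed.

Lemma Ck_dot n p (f g : V -> 'rV[R]_p) :
  Ck n O f -> Ck n O g -> Ck n O (fun x => dot (f x) (g x)).
Proof.
move=> cf cg; apply: Ck_sum => // i.
by apply: CkM => //; apply: Ck_coord.
Qed.

End matrices.

Section mxderiv.
Variables (V : normedModType R).

Lemma differentiable_mulmx p q r (f : V -> 'M[R]_(p, q)) (g : V -> 'M[R]_(q, r)) x :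
  differentiable f x -> differentiable g x -> differentiable (fun x => f x *m g x) x.
Proof.
move=> df dg; apply: differentiable_mx_of => i j.
have -> : (fun x => (f x *m g x) i j) =
  \sum_k ((fun x => f x i k : R) * (fun x => g x k j : R)).
  by apply/funext => y; rewrite mxE; elim/big_ind2: _ => // ? ? ? ? -> ->.
elim/big_ind : _ => [|? ? |k _]; first exact: differentiable_cst.
  by apply: differentiableD.
apply: differentiableM.
  by apply: (differentiable_comp (g := fun M : 'M[R]_(p, q) => M i k) df);
    exact: differentiable_coord.
by apply: (differentiable_comp (g := fun M : 'M[R]_(q, r) => M k j) dg);
    exact: differentiable_coord.
Qed.

Lemma derivable_coord p q (f : V -> 'M[R]_(p, q)) x v i j :
  differentiable f x -> derivable (fun y => f y i j) x v.
Proof. by move=> df; exact: ((derivable_mxP f x v).1 (diff_derivable df)). Qed.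

Lemma derive_mulmx p q r (f : V -> 'M[R]_(p, q)) (g : V -> 'M[R]_(q, r)) x v :
  differentiable f x -> differentiable g x ->
  'D_v (fun x => f x *m g x) x = 'D_v f x *m g x + f x *m 'D_v g x.
Proof.
move=> df dg; apply/matrixP => i j.
rewrite derive_coord; last exact: differentiable_mulmx.
have -> : (fun x => (f x *m g x) i j) =
  \sum_k ((fun x => f x i k : R) * (fun x => g x k j : R)).
  by apply/funext => y; rewrite mxE; elim/big_ind2: _ => // ? ? ? ? -> ->.
rewrite derive_sum => [|k]; last by apply: derivableM; exact: derivable_coord.
rewrite mxE !mxE -big_split /=; apply: eq_bigr => k _.
rewrite deriveM; [|exact: derivable_coord|exact: derivable_coord].
by rewrite !derive_coord// addrC [_ * g x k j]mulrC.
Qed.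

Lemma derive_mulmxr p q r (f : V -> 'M[R]_(p, q)) (B : 'M[R]_(q, r)) x v :
  differentiable f x -> 'D_v (fun x => f x *m B) x = 'D_v f x *m B.
Proof.
have dB : differentiable (cst B : V -> 'M[R]_(q, r)) x by exact: differentiable_cst.
move=> df; rewrite (derive_mulmx v df dB).
by rewrite derive_cst mulmx0 addr0.
Qed.

Lemma derive_dot p (f g : V -> 'rV[R]_p) x v :
  differentiable f x -> differentiable g x ->
  'D_v (fun x => dot (f x) (g x)) x = dot ('D_v f x) (g x) + dot (f x) ('D_v g x).
Proof.
move=> df dg; rewrite /dot.
have -> : (fun x => \sum_i (f x 0 i * g x 0 i)) =
  \sum_k ((fun x => f x 0 k : R) * (fun x => g x 0 k : R)).
  by apply/funext => y; elim/big_ind2: _ => // ? ? ? ? -> ->.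
rewrite derive_sum => [|k]; last by apply: derivableM; exact: derivable_coord.
rewrite -big_split /=; apply: eq_bigr => k _.
rewrite deriveM; [|exact: derivable_coord|exact: derivable_coord].
by rewrite !derive_coord// addrC [_ * g x 0 k]mulrC.
Qed.

Lemma differentiable_dot p (f g : V -> 'rV[R]_p) x :
  differentiable f x -> differentiable g x -> differentiable (fun x => dot (f x) (g x)) x.
Proof.
move=> df dg.
have -> : (fun x => dot (f x) (g x)) = (fun x => (f x *m (g x)^T) 0 0).
  by apply/funext => y; rewrite mxE; apply: eq_bigr => i _; rewrite mxE.
apply: (differentiable_comp (f := fun x => f x *m (g x)^T) (g := fun M : 'M[R]_1 => M 0 0));
  last exact: differentiable_coord.
apply: differentiable_mulmx => //; apply: differentiable_mx_of => i j.
have -> : (fun x => (g x)^T i j) = (fun x => g x j i) by apply/funext => y; rewrite mxE.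
by apply: (differentiable_comp (g := fun M : 'rV[R]_p => M j i) dg);
    exact: differentiable_coord.
Qed.

Lemma deriveDv (W : normedModType R) (f : V -> W) x a b :
  differentiable f x -> 'D_(a + b) f x = 'D_a f x + 'D_b f x.
Proof. by move=> df; rewrite !deriveE// linearD. Qed.

Lemma deriveZv (W : normedModType R) (f : V -> W) x k a :
  differentiable f x -> 'D_(k *: a) f x = k *: 'D_a f x.
Proof. by move=> df; rewrite !deriveE// linearZ. Qed.

End mxderiv.

Lemma derive_rV_sum k (W : normedModType R) (f : 'rV[R]_k -> W) x v :
  differentiable f x -> 'D_v f x = \sum_(i < k) v 0 i *: 'D_(delta_mx 0 i) f x.
Proof.
move=> df; rewrite deriveE// [X in 'd f _ X]row_sum_delta linear_sum.
by apply: eq_bigr => i _; rewrite linearZ /= deriveE.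
Qed.

End Ck.

(** * Continuity in terms of balls, and norm estimates *)

Section ball.
Variable R : realType.

Lemma nbhs_normball (V : normedModType R) (x : V) (A : set V) :
  nbhs x A -> exists2 e : R, 0 < e & forall y, `|y - x| < e -> A y.
Proof.
move=> /nbhs_ballP[e /= e0 eA]; exists e => // y yx; apply: eA.
by rewrite -ball_normE /= distrC.
Qed.

Lemma normball_nbhs (V : normedModType R) (x : V) (A : set V) (e : R) :
  0 < e -> (forall y, `|y - x| < e -> A y) -> nbhs x A.
Proof.
move=> e0 eA; apply/nbhs_ballP; exists e => //= y.
by rewrite -ball_normE /= distrC; exact: eA.
Qed.

Lemma open_ball (V : normedModType R) (x : V) (O : set V) : open O -> O x ->
  exists2 e : R, 0 < e & forall y, `|y - x| < e -> O y.
Proof. by move=> oO Ox; apply: nbhs_normball; apply: open_nbhs_nbhs. Qed.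

Lemma ball_open_set (V : normedModType R) (A : set V) :
  (forall x, A x -> exists2 e : R, 0 < e & forall y, `|y - x| < e -> A y) -> open A.
Proof. by move=> H; rewrite openE => x /H[e e0 He]; exact: normball_nbhs He. Qed.

Lemma continuous_ball (V W : normedModType R) (x : V) (f : V -> W) e :
  {for x, continuous f} -> 0 < e -> exists2 d : R, 0 < d &
  forall y, `|y - x| < d -> `|f y - f x| < e.
Proof.
move=> cf e0; apply: (@nbhs_normball _ _ [set y | `|f y - f x| < e]).
have /cvgrPdist_lt /(_ e e0) : f @ x --> f x by [].
by apply: filterS => y /=; rewrite distrC.
Qed.

Lemma ball_continuous (V W : normedModType R) (x : V) (f : V -> W) :
  (forall e, 0 < e -> exists2 d : R, 0 < d &
     forall y, `|y - x| < d -> `|f y - f x| < e) -> {for x, continuous f}.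
Proof.
move=> H; apply/cvgrPdist_lt => e e0; have [d d0 Hd] := H e e0.
by apply: (normball_nbhs d0) => y /Hd; rewrite distrC.
Qed.

Lemma within_continuousP (V W : normedModType R) (A : set V) (f : V -> W) :
  {within A, continuous f} <-> forall x, A x -> forall e, 0 < e ->
    exists2 d : R, 0 < d & forall y, A y -> `|y - x| < d -> `|f y - f x| < e.
Proof.
rewrite subspace_continuousP; split=> [H x Ax e e0|H x Ax].
  have /cvgrPdist_lt/(_ e e0) := H x Ax.
  move=> /nbhs_normball[d d0 Hd]; exists d => // y Ay yx.
  by rewrite distrC; exact: (Hd y yx Ay).
apply/cvgrPdist_lt => e e0.
have [d d0 Hd] := H x Ax e e0.
by apply: (normball_nbhs d0) => y yx Ay; rewrite distrC; exact: Hd.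
Qed.

Lemma rV_norm_coord k (x : 'rV[R]_k) i : `|x 0 i| <= `|x|.
Proof.
rewrite [leRHS]/Num.Def.normr/= mx_normrE.
exact: (le_bigmax _ (fun ij => `|x ij.1 ij.2|) (0, i)).
Qed.

Lemma rV_norm_le k (x : 'rV[R]_k) c : 0 <= c -> (forall i, `|x 0 i| <= c) -> `|x| <= c.
Proof.
move=> c0 H; rewrite [leLHS]/Num.Def.normr/= mx_normrE.
by apply/bigmax_le => // -[i j] _ /=; rewrite (ord1 i); exact: H.
Qed.

Lemma rV_norm_lt k (x : 'rV[R]_k) c : 0 < c -> (forall i, `|x 0 i| < c) -> `|x| < c.
Proof.
move=> c0 H; rewrite [ltLHS]/Num.Def.normr/= mx_normrE.
by apply/bigmax_lt => // -[i j] _ /=; rewrite (ord1 i); exact: H.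
Qed.

(** The norm of a matrix is its largest entry in absolute value, whence the factor counting the [k]
    terms of each sum. *)
Lemma mulmx_norm k l (x : 'rV[R]_k) (A : 'M[R]_(k, l)) :
  `|x *m A| <= k%:R * `|x| * `|A|.
Proof.
apply: rV_norm_le; first by rewrite !mulr_ge0.
move=> j; rewrite mxE (le_trans (ler_norm_sum _ _ _))//.
rewrite -mulrA mulr_natl -[X in _ *+ X]card_ord -sumr_const ler_sum// => i _.
rewrite normrM ler_pM// ?rV_norm_coord//.
rewrite [leRHS]/Num.Def.normr/= mx_normrE.
exact: (le_bigmax _ (fun ij => `|A ij.1 ij.2|) (i, j)).
Qed.

End ball.

(** * Mean value theorem on segments and symmetry of second derivatives *)

Section line.
Variables (R : realType).

Lemma addr3K (V : zmodType) (x a b : V) : x + a + b - x = a + b.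
Proof. by rewrite addrC !addrA addNr add0r. Qed.

Lemma is_derive_line (V W : normedModType R) (f : V -> W) a v s :
  derivable f (a + s *: v) v ->
  is_derive s 1 (fun s => f (a + s *: v)) ('D_v f (a + s *: v)).
Proof.
have E : (fun h : R => h^-1 *: (((fun s => f (a + s *: v)) \o shift s) (h *: (1 : R))
      - f (a + s *: v))) =
    (fun h => h^-1 *: ((f \o shift (a + s *: v)) (h *: v) - f (a + s *: v))).
  apply/funext => h /=; congr (_ *: (f _ - _)).
  by rewrite scalerDl -[h%:A]/(h * 1) mulr1 addrCA.
by move=> df; split; rewrite /derivable /derive E.
Qed.

Lemma mvt_line (V : normedModType R) (f : V -> R) a v (c : R) :
  (forall s : R, `|s| <= `|c| -> derivable f (a + s *: v) v) ->
  exists2 s : R, `|s| <= `|c| & f (a + c *: v) - f a = c * 'D_v f (a + s *: v).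
Proof.
move=> H.
pose phi (s : R) := f (a + s *: v).
have dphi (s : R) : `|s| <= `|c| -> is_derive s (1 : R) phi ('D_v f (a + s *: v)).
  by move=> sc; apply: is_derive_line; exact: H.
have cphi x y : (forall s : R, x <= s <= y -> `|s| <= `|c|) ->
    {within `[x, y], continuous phi}.
  move=> xy; apply: derivable_within_continuous => s; rewrite in_itv /= => /xy sc.
  by have [] := dphi s sc.
have [c0|c0|c0] := ltgtP c 0.
- have B s : c <= s <= 0 -> `|s| <= `|c|.
    by move=> /andP[? ?]; rewrite !ler0_norm ?lerN2// ltW.
  have [||s] := @MVT R phi (fun s => 'D_v f (a + s *: v)) c 0 c0.
  - by move=> s; rewrite in_itv /= => /andP[? ?]; apply: dphi; apply: B; rewrite !ltW.
  - exact: cphi.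
  rewrite in_itv /= => /andP[? ?]; rewrite /phi scale0r addr0 => E.
  exists s; first by apply: B; rewrite !ltW.
  by rewrite -opprB E sub0r mulrN opprK mulrC.
- have B s : 0 <= s <= c -> `|s| <= `|c|.
    by move=> /andP[? ?]; rewrite !ger0_norm// ltW.
  have [||s] := @MVT R phi (fun s => 'D_v f (a + s *: v)) 0 c c0.
  - by move=> s; rewrite in_itv /= => /andP[? ?]; apply: dphi; apply: B; rewrite !ltW.
  - exact: cphi.
  rewrite in_itv /= => /andP[? ?]; rewrite /phi scale0r addr0 => E.
  exists s; first by apply: B; rewrite !ltW.
  by rewrite E subr0 mulrC.
- by exists 0; rewrite c0 ?scale0r ?addr0 ?subrr ?mul0r.
Qed.

Lemma mvt_segment (V : normedModType R) (f : V -> R) a b :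
  (forall s : R, 0 <= s <= 1 -> differentiable f (a + s *: (b - a))) ->
  exists2 s : R, 0 <= s <= 1 & f b - f a = 'D_(b - a) f (a + s *: (b - a)).
Proof.
move=> H.
pose phi (s : R) := f (a + s *: (b - a)).
have dphi (s : R) : 0 <= s <= 1 -> is_derive s (1 : R) phi ('D_(b - a) f (a + s *: (b - a))).
  by move=> sc; apply: is_derive_line; apply: diff_derivable; exact: H.
have [||s] := @MVT R phi (fun s => 'D_(b - a) f (a + s *: (b - a))) 0 1 ltr01.
- by move=> s; rewrite in_itv /= => /andP[? ?]; apply: dphi; rewrite !ltW.
- apply: derivable_within_continuous => s; rewrite in_itv /= => s01.
  by have [] := dphi s s01.
rewrite in_itv /= => /andP[? ?]; rewrite /phi scale0r addr0 scale1r subrKC subr0 mulr1 => E.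
by exists s => //; rewrite !ltW.
Qed.

(* Second differences along [a] and [b], evaluated in both orders. *)
Lemma schwarz (V : normedModType R) (f : V -> R) (O : set V) x a b :
  open O -> smooth O f -> O x -> 'D_a ('D_b f) x = 'D_b ('D_a f) x.
Proof.
move=> oO sf Ox.
have key : forall (a b : V) (r : R), 0 < r -> exists2 e : R, 0 < e & forall s, 0 < s < e ->
    exists2 y, `|y - x| < r &
    f (x + s *: a + s *: b) - f (x + s *: a) - f (x + s *: b) + f x
      = s ^+ 2 * 'D_b ('D_a f) y.
  move=> {}a {}b r r0; have [d d0 dO] := open_ball oO Ox.
  (* [s * c] bounds every point of the parallelogram spanned by [s *: a] and [s *: b]; the added 1
     makes the bound strict and positive even for zero directions. *)
  pose c := `|a| + `|b| + 1.
  have c0 : 0 < c by rewrite /c ltr_wpDl// addr_ge0.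
  have [e e0 [er ed]] : exists2 e : R, 0 < e & e * c <= r /\ e * c <= d.
    exists (Num.min r d / c); first by rewrite divr_gt0// lt_min r0 d0.
    by rewrite divfK ?gt_eqF// !ge_min !lexx orbT.
  exists e => // s /andP[s0 se].
  have nearx (u w : R) : `|u| <= s -> `|w| <= s -> `|u *: a + w *: b| < s * c.
    move=> us ws; rewrite (le_lt_trans (ler_normD _ _))// !normrZ.
    rewrite (@le_lt_trans _ _ (s * `|a| + s * `|b|))//.
      by rewrite lerD// ler_wpM2r.
    by rewrite -mulrDr ltr_pM2l// /c ltrDl.
  have inO (u w : R) : `|u| <= s -> `|w| <= s -> O (x + u *: a + w *: b).
    move=> us ws; apply: dO; rewrite addr3K.
    by rewrite (lt_le_trans (nearx _ _ us ws))// (le_trans _ ed)// ler_wpM2r// ltW.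
  have s00 : `|0 : R| <= s by rewrite normr0 ltW.
  have ss : `|s| <= s by rewrite ger0_norm// ltW.
  pose g y := f (y + s *: b) - f y.
  have df y : O y -> differentiable f y by exact: smooth_diff.
  have dshift (y w : V) : O (y + w) -> is_derive y a (fun z => f (z + w)) ('D_a f (y + w)).
    move=> Oyw.
    have E : (fun h : R => h^-1 *: (((fun z => f (z + w)) \o shift y) (h *: a) - f (y + w))) =
       (fun h => h^-1 *: ((f \o shift (y + w)) (h *: a) - f (y + w))).
      by apply/funext => h /=; rewrite addrA.
    by split; rewrite /derivable /derive E//; apply: diff_derivable; exact: df.
  have dg y : O (y + s *: b) -> O y ->
      is_derive y a g ('D_a f (y + s *: b) - 'D_a f y).
    move=> Oyb Oy; apply: is_deriveB; first exact: dshift.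
    by apply: DeriveDef => //; apply: diff_derivable; exact: df.
  have [u us Eu] : exists2 u, `|u| <= `|s| & g (x + s *: a) - g x = s * 'D_a g (x + u *: a).
    apply: mvt_line => u; rewrite (ger0_norm (ltW s0)) => us.
    have [] // := dg (x + u *: a); first exact: inO.
    by rewrite -[x + _]addr0 -(scale0r b); exact: inO.
  rewrite (ger0_norm (ltW s0)) in us.
  have Ox' : O (x + u *: a) by rewrite -[x + _]addr0 -(scale0r b); exact: inO.
  have [w ws Ew] : exists2 w, `|w| <= `|s| &
     'D_a f (x + u *: a + s *: b) - 'D_a f (x + u *: a) =
        s * 'D_b ('D_a f) (x + u *: a + w *: b).
    apply: (mvt_line (f := 'D_a f)) => w; rewrite (ger0_norm (ltW s0)) => ws.
    apply: diff_derivable; apply: (smooth_diff (O := O)); last exact: inO.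
    exact: smooth_derive.
  rewrite (ger0_norm (ltW s0)) in ws.
  exists (x + u *: a + w *: b).
    rewrite addr3K.
    by rewrite (lt_le_trans (nearx _ _ us ws))// (le_trans _ er)// ler_wpM2r// ltW.
  have [_ Dg] := dg (x + u *: a) (inO _ _ us ss) Ox'.
  move: Eu; rewrite Dg Ew /g => E; rewrite expr2 -mulrA -E.
  by rewrite opprD opprK addrA.
have cab : {for x, continuous ('D_a ('D_b f))}.
  by apply: smooth_cont Ox; do 2!apply: smooth_derive.
have cba : {for x, continuous ('D_b ('D_a f))}.
  by apply: smooth_cont Ox; do 2!apply: smooth_derive.
apply/eqP; rewrite -subr_eq0 -normr_le0; apply/ler_addgt0Pl => e e0; rewrite addr0.
have e20 : 0 < e / 2 by rewrite divr_gt0.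
have [d1 d10 H1] := continuous_ball cab e20.
have [d2 d20 H2] := continuous_ball cba e20.
have [e1 e10 K1] := key a b _ d20.
have [e2 e2p K2] := key b a _ d10.
pose s := Num.min e1 e2 / 2.
have m0 : 0 < Num.min e1 e2 by rewrite lt_min e10 e2p.
have s0 : 0 < s by rewrite divr_gt0.
have sm : s < Num.min e1 e2 by rewrite /s gtr_pMr// invf_lt1// ltr1n.
have [s1 s2] : s < e1 /\ s < e2 by move: sm; rewrite lt_min => /andP[].
have [y yx Ey] := K1 s (introT andP (conj s0 s1)).
have [z zx Ez] := K2 s (introT andP (conj s0 s2)).
(* The second difference is symmetric in the two directions, so its two evaluations agree once
   [s ^+ 2] is cancelled. *)
have yz : 'D_b ('D_a f) y = 'D_a ('D_b f) z.
  apply: (mulfI (x := s ^+ 2)); first by rewrite expf_neq0// gt_eqF.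
  apply: (etrans (esym Ey)); apply: (etrans _ Ez).
  by rewrite (addrAC x); congr (_ + _); rewrite [LHS]addrAC.
move: (H1 z zx) (H2 y yx) yz; clear.
move: ('D_a ('D_b f) x) ('D_b ('D_a f) x) ('D_a ('D_b f) z) ('D_b ('D_a f) y).
move=> A B A' B' H1 H2 E; subst B'.
rewrite -(subrKA A') (le_trans (ler_normD _ _))// (splitr e) lerD//.
  by rewrite distrC ltW.
exact: ltW.
Qed.

End line.

(** * From directional derivatives to Fréchet derivatives *)

Section C1.
Variables (R : realType).

Lemma linear_approx (V W : normedModType R) (f : V -> W) (d : {linear V -> W}) x :
  continuous d -> (forall e : R, 0 < e -> \forall h \near (0 : V),
    `|f (h + x) - (f x + d h)| <= e * `|h|) ->
  differentiable f x /\ 'd f x = d :> (V -> W).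
Proof.
move=> cd H; have E0 : f \o shift x = cst (f x) + d +o_ 0 id.
  by apply/eqaddoP => e e0; exact: H.
have E : 'd f x = d :> (V -> W) by exact: diff_unique.
by split=> //; apply/diff_locallyP; rewrite E.
Qed.

(** The increment is split along the coordinate path [p 0, ..., p k] from [x] to [h + x]. On each
    edge the mean value theorem produces a partial derivative at a point near [x], close to its
    value at [x] by continuity. *)
Lemma C1_differentiable k (f : 'rV[R]_k -> R) (O : set 'rV[R]_k) x :
  open O -> O x ->
  (forall y i, O y -> derivable f y (delta_mx 0 i)) ->
  (forall i, {for x, continuous ('D_(delta_mx 0 i) f)}) ->
  differentiable f x.
Proof.
move=> oO Ox df cf.
pose d (h : 'rV[R]_k) : R := \sum_i h 0 i * 'D_(delta_mx 0 i) f x.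
have lind : linear d.
  move=> c u v; rewrite /d scaler_sumr -big_split /=; apply: eq_bigr => i _.
  by rewrite !mxE mulrDl -mulrA.
pose dM := GRing.isLinear.Build _ _ _ _ _ lind.
pose dL : {linear _ -> _} := HB.pack d dM.
have cd : continuous dL.
  move=> h; suff : Ck 0 setT d by apply.
  apply: Ck_sum; first exact: openT.
  move=> i; apply: CkM; first exact: openT.
    by move=> y _; exact: coord_continuous.
  exact: Ck_cstR.
suff H : forall e, 0 < e -> \forall h \near (0 : 'rV[R]_k),
    `|f (h + x) - (f x + dL h)| <= e * `|h| by have [] := linear_approx cd H.
move=> e e0.
have [r0 r00 r0O] := open_ball oO Ox.
(* Each of the [k] edges contributes at most [e'] times the norm of [h]; the successor keeps the
   quotient meaningful in dimension 0. *)
pose e' := e / k.+1%:R.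
have e'0 : 0 < e' by rewrite divr_gt0.
have [r r_gt0 [rO rd]] : exists2 r : R, 0 < r & (forall y, `|y - x| < r -> O y) /\
   forall y i, `|y - x| < r -> `|'D_(delta_mx 0 i) f y - 'D_(delta_mx 0 i) f x| < e'.
  suff : nbhs x [set y | O y /\ forall i, `|'D_(delta_mx 0 i) f y - 'D_(delta_mx 0 i) f x| < e'].
    by move=> /nbhs_normball[r r0' H]; exists r => //; split=> [y /H[]|y i /H[]].
  apply: filterI; first exact: open_nbhs_nbhs.
  suff : \forall y \near x, forall i, `|'D_(delta_mx 0 i) f y - 'D_(delta_mx 0 i) f x| < e' by [].
  near=> y => i; move: i; near: y; apply: filter_forall => i.
  have [d' d'0 H] := continuous_ball (cf i) e'0.
  exact: normball_nbhs d'0 H.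
apply: (normball_nbhs r_gt0) => h; rewrite subr0 => hr.
pose p (j : nat) : 'rV[R]_k := \row_i (x 0 i + (if (i < j)%N then h 0 i else 0)).
have p0 : p 0%N = x by apply/rowP => i; rewrite mxE ltn0 addr0.
have pk : p k = h + x by apply/rowP => i; rewrite !mxE ltn_ord addrC.
have ps (i : 'I_k) : p i.+1 = p i + h 0 i *: delta_mx 0 i.
  apply/rowP => j; rewrite !mxE -addrA eqxx /= ltnS leq_eqVlt.
  have [->|ij] := eqVneq j i; first by rewrite eqxx ltnn/= mulr1 add0r.
  rewrite (_ : (j == i :> nat) = false) ?mulr0 ?addr0//.
  by apply/negbTE; apply: contra ij => /eqP/val_inj ->.
have pb (i : 'I_k) s : `|s| <= `|h 0 i| -> `|p i + s *: delta_mx 0 i - x| < r.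
  move=> sh; apply: rV_norm_lt => // j; rewrite !mxE eqxx /=.
  have [->|ij] := eqVneq j i.
    rewrite ltnn addr0 mulr1 addrAC subrr add0r (le_lt_trans sh)//.
    by rewrite (le_lt_trans (rV_norm_coord _ _)).
  rewrite mulr0 addr0 addrAC subrr add0r; case: ifP => _; last by rewrite normr0.
  by rewrite (le_lt_trans (rV_norm_coord _ _)).
have step (i : 'I_k) : `|f (p i.+1) - f (p i) - h 0 i * 'D_(delta_mx 0 i) f x| <= e' * `|h|.
  rewrite ps; have [s sh ->] : exists2 s : R, `|s| <= `|h 0 i| &
     f (p i + h 0 i *: delta_mx 0 i) - f (p i) = h 0 i * 'D_(delta_mx 0 i) f (p i + s *: delta_mx 0 i).
    by apply: mvt_line => s sh; apply: df; apply: rO; exact: pb.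
  rewrite -mulrBr normrM mulrC ler_pM// ?rV_norm_coord//.
  by apply: ltW; apply: rd; exact: pb.
have tel : f (h + x) - f x = \sum_(i < k) (f (p i.+1) - f (p i)).
  by have := telescope_sumr (fun j => f (p j)) (leq0n k); rewrite big_mkord pk p0.
rewrite opprD addrA tel /d -sumrB (le_trans (ler_norm_sum _ _ _))//.
rewrite (@le_trans _ _ (\sum_(i < k) e' * `|h|))//; first by apply: ler_sum => i _.
rewrite sumr_const card_ord -[_ *+ k]mulr_natl mulrA ler_wpM2r// /e'.
rewrite mulrCA ger_pMr// ler_pdivrMr// mul1r ler_nat; exact: leqnSn.
Unshelve. all: by end_near. Qed.

(** Each iterated derivative supplied by [smooth_on] has continuous partial derivatives, which
    upgrades it to a Fréchet differentiable map. *)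
Lemma smooth_on_rV k p (S : set 'rV[R]_k) (f : 'rV[R]_k -> 'rV[R]_p) :
  smooth_on S f -> exists O, [/\ open O, S `<=` O & smooth O f].
Proof.
move=> [ O [oO SO H]]; exists O; split=> // n.
suff : forall vs, Ck n O (iter_derive vs f) by move=> /(_ [::]).
elim: n => [|n IH] vs; first by move=> x Ox; have [] := H vs x Ox.
split=> [x Ox|v]; last exact: (IH (v :: vs)).
apply: differentiable_mx_of => i j; rewrite {i}(ord1 i).
have dc y v : O y -> derivable (fun x => iter_derive vs f x 0 j) y v.
  move=> Oy; have [D _] := H vs y Oy.
  exact: ((derivable_mxP _ _ _).1 (D v)).
apply: (C1_differentiable oO Ox) => [y i Oy|i]; first exact: dc.
apply: (@near_eq_continuous _ _ (fun y => 'D_(delta_mx 0 i) (iter_derive vs f) y 0 j)).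
  apply: (near_open oO Ox) => y Oy; rewrite derive_mx ?mxE//.
  by have [D _] := H vs y Oy; exact: D.
apply: (@continuous_comp _ _ _ ('D_(delta_mx 0 i) (iter_derive vs f)) (fun M => M 0 j)).
  by have [_] := H (delta_mx 0 i :: vs) x Ox.
exact: coord_continuous.
Qed.

Lemma smooth_on_R (W : normedModType R) (S : set R) (f : R -> W) :
  smooth_on S f -> exists O, [/\ open O, S `<=` O & smooth O f].
Proof.
move=> [ O [oO SO H]]; exists O; split=> // n.
suff : forall vs, Ck n O (iter_derive vs f) by move=> /(_ [::]).
elim: n => [|n IH] vs; first by move=> x Ox; have [] := H vs x Ox.
split=> [x Ox|v]; last exact: (IH (v :: vs)).
by apply/derivable1_diffP; have [D _] := H vs x Ox; exact: D.
Qed.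

Lemma smooth_smooth_on (V W : normedModType R) (S O : set V) (f : V -> W) :
  open O -> S `<=` O -> smooth O f -> smooth_on S f.
Proof.
move=> oO SO sf; exists O; split=> // vs x Ox.
have svs : smooth O (iter_derive vs f).
  by elim: vs => //= v vs IH; exact: smooth_derive.
split; first by move=> v; apply: diff_derivable; exact: smooth_diff Ox.
exact: smooth_cont Ox.
Qed.

End C1.

(** * The inverse function theorem *)

Section IFT.
Variables (R : realType).

Lemma Ck_comp_mx (V : normedModType R) k p q n (O : set V) (O' : set 'rV[R]_k)
    (g : V -> 'rV[R]_k) (f : 'rV[R]_k -> 'M[R]_(p, q)) :
  open O -> open O' -> (forall x, O x -> O' (g x)) ->
  Ck n O g -> Ck n O' f -> Ck n O (fun x => f (g x)).
Proof.
move=> oO oO' gO cg cf; apply: Ck_mx_of => // i j.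
exact: (Ck_comp_rV oO gO cg (Ck_coord i j oO' cf)).
Qed.

Lemma Ck_comp_mxR (V : normedModType R) p q n (O : set V) (O' : set R)
    (g : V -> R) (f : R -> 'M[R]_(p, q)) :
  open O -> open O' -> (forall x, O x -> O' (g x)) ->
  Ck n O g -> Ck n O' f -> Ck n O (fun x => f (g x)).
Proof.
move=> oO oO' gO cg cf; apply: Ck_mx_of => // i j.
exact: (Ck_comp_R oO gO cg (Ck_coord i j oO' cf)).
Qed.

Lemma unitmx_inj k (A : 'M[R]_k) :
  (forall v : 'rV_k, v *m A = 0 -> v = 0) -> A \in unitmx.
Proof.
move=> H; rewrite -row_free_unit -kermx_eq0; apply/eqP/row_matrixP => i.
by rewrite row0; apply: H; rewrite -row_mul mulmx_ker row0.
Qed.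

Lemma diff_approx (V W : normedModType R) (f : V -> W) x e :
  differentiable f x -> 0 < e -> exists2 d : R, 0 < d & forall h, `|h| < d ->
    `|f (x + h) - f x - 'd f x h| <= e * `|h|.
Proof.
move=> df e0; have [_ /eqaddoP H] := (diff_locallyP _ _).1 df.
have He : \forall h \near (0 : V), `|f (h + x) - (f x + 'd f x h)| <= e * `|h|.
  exact: (H e e0).
have [d d0 Hd] := nbhs_normball He; exists d => // h hd.
by have := Hd h; rewrite subr0 opprD addrA [h + x]addrC; exact.
Qed.

Lemma closed_ball_compact k (x0 : 'rV[R]_k) r :
  compact [set x | `|x - x0| <= r].
Proof.
apply: bounded_closed_compact.
  exists (`|x0| + r); split; first exact: num_real.
  move=> c cr x /= xr; rewrite -(subrK x0 x) (le_trans (ler_normD _ _))//.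
  by rewrite (le_trans _ (ltW cr))// addrC lerD2l.
have -> : [set x | `|x - x0| <= r] = (fun x => `|x - x0|) @^-1` [set z | z <= r] by [].
apply: closed_comp; last exact: closed_le.
move=> x _; apply: continuous_comp; last exact: norm_continuous.
by apply: continuousB; [exact: cvg_id|exact: cst_continuous].
Qed.

(** Instead of iterating [T], the displacement of [T] is minimized over the compact ball. At a
    minimizer [x] the displacement of [T x] is at most half that of [x], so the minimum is 0. *)
Lemma contraction_fixed k (T : 'rV[R]_k -> 'rV[R]_k) x0 r : 0 <= r ->
  (forall x, `|x - x0| <= r -> `|T x - x0| <= r) ->
  (forall x y, `|x - x0| <= r -> `|y - x0| <= r -> `|T x - T y| <= 2^-1 * `|x - y|) ->
  exists2 x, `|x - x0| <= r & T x = x.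
Proof.
move=> r0 Tr Tc; pose A := [set x : 'rV[R]_k | `|x - x0| <= r].
have A0 : A !=set0 by exists x0; rewrite /A /= subrr normr0.
have [x xA xmin] : exists2 x, x \in A & forall y, y \in A -> `|T x - x| <= `|T y - y|.
  apply: (@EVT_min_rV R k (fun x => `|T x - x|)) => //.
    exact: closed_ball_compact.
  apply/within_continuousP => y yA e e0.
  have e20 : 0 < e / 2 by rewrite divr_gt0.
  exists (e / 2) => // z zA zy.
  rewrite (le_lt_trans (ler_dist_dist _ _))//.
  have -> : T z - z - (T y - y) = (T z - T y) - (z - y).
    by apply/rowP => j; rewrite !mxE; ring.
  rewrite (le_lt_trans (ler_normB _ _))//.
  by have := Tc _ _ zA yA; move: zy; lra.
move: xA; rewrite inE => xA; exists x => //.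
have TA : T x \in A by rewrite inE; apply: Tr.
have := xmin _ TA; move: TA; rewrite inE => TA.
move=> /le_trans /(_ (Tc _ _ TA xA)) H; apply/eqP; rewrite -subr_eq0 -normr_le0.
by move: H; lra.
Qed.

(** With [B] the inverse Jacobian at [x0], the map [h x = x - f x *m B] is 1/2-Lipschitz near [x0],
    and solving [f x = y] amounts to finding a fixed point of [h x + y *m B]. The same estimate
    makes the inverse Lipschitz, from which its differentiability follows. *)
Theorem inverse_function k (f : 'rV[R]_k -> 'rV[R]_k) (O : set 'rV[R]_k) x0 :
  open O -> smooth O f -> O x0 -> (forall v, 'D_v f x0 = 0 -> v = 0) ->
  exists V W g, [/\ open V, V x0, V `<=` O, open W & [/\ smooth W g,
    forall x, V x -> W (f x) /\ g (f x) = x &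
    forall y, W y -> V (g y) /\ f (g y) = y]].
Proof.
move=> oO sf Ox0 inj.
pose J x : 'M[R]_k := \matrix_(i, j) 'D_(delta_mx 0 i) f x 0 j.
have sJ : smooth O J.
  move=> n; apply: Ck_mx_of => // i j.
  apply: (@Ck_ext _ _ _ _ n oO (fun x => 'D_(delta_mx 0 i) f x 0 j)).
    by move=> x _; rewrite mxE.
  by apply: Ck_coord => //; exact: smooth_derive.
have DJ x v : O x -> 'D_v f x = v *m J x.
  move=> Ox; rewrite derive_rV_sum; last exact: smooth_diff Ox.
  apply/rowP => j; rewrite summxE mxE; apply: eq_bigr => i _.
  by rewrite !mxE.
have Ju0 : J x0 \in unitmx by apply: unitmx_inj => v; rewrite -DJ//; exact: inj.
pose B := invmx (J x0).
(* Multiplying by a matrix costs a factor [k] in the maximum norm; this bound on [1%:M - J x *m B]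
   leaves the Lipschitz constant 1/2 for [h]. *)
pose e := (2 * k.+1%:R)^-1 : R.
have e0 : 0 < e by rewrite invr_gt0 mulr_gt0.
have [r r0 rP] : exists2 r : R, 0 < r & forall x, `|x - x0| < r ->
    [/\ O x, J x \in unitmx & `|1%:M - J x *m B| < e].
  suff : nbhs x0 [set x | [/\ O x, J x \in unitmx & `|1%:M - J x *m B| < e]].
    by move=> /nbhs_normball.
  have c1 : {for x0, continuous (fun x => \det (J x))}.
    have : smooth O (fun x => \det (J x)) by move=> n; apply: Ck_det.
    by move=> /smooth_cont; apply.
  have c2 : {for x0, continuous (fun x => 1%:M - J x *m B)}.
    have : smooth O (fun x => 1%:M - J x *m B).
      by move=> n; apply: CkB => //; [exact: Ck_cst|apply: Ck_mulmx => //; exact: Ck_cst].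
    by move=> /smooth_cont; apply.
  have d0 : 0 < `|\det (J x0)| by rewrite normr_gt0 -unitfE -unitmxE.
  have [r1 r10 H1] := continuous_ball c1 d0.
  have [r2 r20 H2] := continuous_ball c2 e0.
  have [r3 r30 H3] := open_ball oO Ox0.
  apply: (@normball_nbhs _ _ _ _ (Num.min r1 (Num.min r2 r3))).
    by rewrite !lt_min r10 r20 r30.
  move=> x; rewrite !lt_min => /andP[x1 /andP[x2 x3]]; split.
  - exact: H3.
  - rewrite unitmxE unitfE; apply/eqP => E.
    by have := H1 _ x1; rewrite {1}E sub0r normrN ltxx.
  - by have := H2 _ x2; rewrite /B mulmxV ?Ju0 ?subrr ?subr0.
pose h x := x - f x *m B.
have hlip x y : `|x - x0| < r -> `|y - x0| < r -> `|h x - h y| <= 2^-1 * `|x - y|.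
  move=> xr yr; apply: rV_norm_le => [|i]; first by rewrite mulr_ge0 ?invr_ge0.
  have seg (s : R) : 0 <= s <= 1 -> `|y + s *: (x - y) - x0| < r.
    move=> /andP[s0 s1].
    have -> : y + s *: (x - y) - x0 = s *: (x - x0) + (1 - s) *: (y - x0).
      rewrite scalerBl scale1r !scalerBr.
      by apply/rowP => j; rewrite !mxE; ring.
    rewrite (le_lt_trans (ler_normD _ _))// !normrZ !ger0_norm ?subr_ge0//.
    have [->|sn0] := eqVneq s 0; first by rewrite mul0r add0r subr0 mul1r.
    have sp : 0 < s by rewrite lt_neqAle eq_sym sn0.
    have -> : r = s * r + (1 - s) * r by ring.
    by rewrite ltr_leD ?ltr_pM2l// ler_wpM2l ?subr_ge0// ltW.
  have dh z : `|z - x0| < r -> differentiable h z.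
    move=> /rP[Oz _ _]; apply: differentiableB; first exact: ex_diff.
    by apply: differentiable_mulmx; [exact: smooth_diff Oz|exact: differentiable_cst].
  have Dh z v : `|z - x0| < r -> 'D_v h z = v *m (1%:M - J z *m B).
    move=> zr; have [Oz _ _] := rP _ zr.
    have dfz : differentiable f z by exact: smooth_diff Oz.
    have dfB : differentiable (fun x => f x *m B) z.
      by apply: differentiable_mulmx => //; exact: differentiable_cst.
    have -> : 'D_v h z = v - 'D_v (fun x => f x *m B) z.
      have E := @deriveB _ _ _ id (fun x => f x *m B) z v (@derivable_id _ _ z v) (diff_derivable dfB).
      by rewrite (@derive_id _ _ z v) in E.
    by rewrite derive_mulmxr// DJ// mulmxBr mulmx1 mulmxA.
  have [s s01 E] : exists2 s : R, 0 <= s <= 1 &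
      h x 0 i - h y 0 i = 'D_(x - y) (fun z => h z 0 i) (y + s *: (x - y)).
    apply: (mvt_segment (f := fun z => h z 0 i)) => s s01.
    apply: (differentiable_comp (g := fun M : 'rV[R]_k => M 0 i) (dh _ (seg _ s01))).
    exact: differentiable_coord.
  have -> : (h x - h y) 0 i = h x 0 i - h y 0 i by rewrite !mxE.
  rewrite E -derive_coord; last exact/dh/seg.
  rewrite Dh; last exact: seg.
  rewrite (le_trans (rV_norm_coord _ _))// (le_trans (mulmx_norm _ _))//.
  have [_ _ /ltW He] := rP _ (seg _ s01).
  rewrite (@le_trans _ _ (k%:R * `|x - y| * e))//.
    by rewrite ler_wpM2l// mulr_ge0.
  rewrite mulrAC ler_wpM2r// /e invfM mulrCA ger_pMr ?invr_gt0//.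
  by rewrite ler_pdivrMr// mul1r ler_nat.
have fE x : f x *m B = x - h x by rewrite /h opprB addrC subrK.
have flip x y : `|x - x0| < r -> `|y - x0| < r -> `|x - y| <= 2 * `|(f x - f y) *m B|.
  move=> xr yr; have := hlip _ _ xr yr.
  have -> : (f x - f y) *m B = (x - y) - (h x - h y).
    by rewrite mulmxBl !fE; apply/rowP => j; rewrite !mxE; ring.
  move: (h x - h y) (x - y) => u v H.
  have : `|v| <= `|v - u| + `|u| by rewrite -[X in `|X| <= _](subrK u) ler_normD.
  lra.
have BI : B *m J x0 = 1%:M by rewrite mulVmx.
(* On the ball of radius [r / 2] the values of [h] stay within [r / 4] of [h x0]; the other [r / 4]
   is left to [(y - f x0) *m B], so the fixed-point map preserves that ball. *)
pose W := [set y | `|(y - f x0) *m B| < r / 4].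
have r20 : 0 < r / 2 by rewrite divr_gt0.
have r2r : r / 2 < r by rewrite ltr_pdivrMr// ltr_pMr// ltr1n.
have gex y : W y -> exists x, `|x - x0| < r / 2 /\ f x = y.
  move=> Wy; have [||x xr Tx] := @contraction_fixed k (fun x => h x + y *m B) x0 (r / 2) (ltW r20).
  - move=> x xr.
    have -> : h x + y *m B - x0 = (h x - h x0) + (y - f x0) *m B.
      by rewrite mulmxBl fE; move: (y *m B) => u; apply/rowP => j; rewrite !mxE; ring.
    rewrite (le_trans (ler_normD _ _))//.
    have := hlip x x0 (le_lt_trans xr r2r); rewrite subrr normr0 => /(_ r0).
    by move: Wy xr; rewrite /W /=; lra.
  - move=> x z xr zr; rewrite opprD addrACA subrr addr0.
    by apply: hlip; exact: le_lt_trans r2r.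
  exists x; split; last first.
    apply/eqP; rewrite -subr_eq0 -[f x - y]mulmx1 -BI mulmxA mulmxBl fE.
    by rewrite -addrA -opprD Tx subrr mul0mx.
  have xE : x - x0 = (h x - h x0) + (y - f x0) *m B.
    by rewrite mulmxBl fE -[in LHS]Tx; move: (y *m B) => u; apply/rowP => j; rewrite !mxE; ring.
  rewrite xE (le_lt_trans (ler_normD _ _))//.
  have := hlip x x0 (le_lt_trans xr r2r); rewrite subrr normr0 => /(_ r0).
  by move: Wy xr; rewrite /W /=; lra.
pose g y := xget 0 [set x | `|x - x0| < r / 2 /\ f x = y].
have gP y : W y -> `|g y - x0| < r / 2 /\ f (g y) = y.
  by move=> /gex[x xP]; exact: (@xgetPex _ 0 [set x | `|x - x0| < r / 2 /\ f x = y] (ex_intro _ x xP)).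
have oW : open W.
  have -> : W = (fun y => `|(y - f x0) *m B|) @^-1` [set z | z < r / 4] by [].
  apply: open_comp; last exact: open_lt.
  move=> y _; apply: continuous_comp; last exact: norm_continuous.
  have : Ck 0 setT (fun y => (y - f x0) *m B).
    apply: Ck_mulmx; [exact: openT| |exact: Ck_cst].
    by apply: CkB; [exact: openT|move=> z _; exact: cvg_id|exact: Ck_cst].
  by apply.
have injf x y : `|x - x0| < r -> `|y - x0| < r -> f x = f y -> x = y.
  move=> xr yr E; have := flip _ _ xr yr; rewrite E subrr mul0mx normr0 mulr0.
  by rewrite normr_le0 subr_eq0 => /eqP.
have b2 x : `|x - x0| < r / 2 -> `|x - x0| < r by move=> H; exact: lt_trans r2r.
pose C := (2 * (k%:R * `|B|)) + 1.
have C0 : 0 < C by rewrite /C ltr_wpDl// !mulr_ge0.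
have glip y z : W y -> W z -> `|g y - g z| <= C * `|y - z|.
  move=> Wy Wz; have [gy fgy] := gP _ Wy; have [gz fgz] := gP _ Wz.
  have := flip _ _ (b2 _ gy) (b2 _ gz); rewrite fgy fgz => /le_trans; apply.
  rewrite (@le_trans _ _ (2 * (k%:R * `|y - z| * `|B|)))//.
    by rewrite ler_wpM2l// mulmx_norm.
  by rewrite mulrAC mulrA ler_wpM2r// /C lerDl.
have dg y : W y -> differentiable g y /\
    forall v, 'd g y v = v *m invmx (J (g y)).
  move=> Wy; have [gy fgy] := gP _ Wy.
  have [Og Jg _] := rP _ (b2 _ gy).
  pose Q := invmx (J (g y)).
  have lq : linear (fun v : 'rV[R]_k => v *m Q) by move=> c u v; rewrite mulmxDl scalemxAl.
  pose qM := GRing.isLinear.Build _ _ _ _ _ lq.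
  pose qL : {linear _ -> _} := HB.pack (fun v : 'rV[R]_k => v *m Q) qM.
  suff [dgy E] : differentiable g y /\ 'd g y = qL :> ('rV[R]_k -> 'rV[R]_k).
    by split=> // v; rewrite E.
  apply: linear_approx.
    have : Ck 0 setT (fun v : 'rV[R]_k => v *m Q).
      apply: Ck_mulmx; [exact: openT|by move=> z _; exact: cvg_id|exact: Ck_cst].
    by move=> H z; exact: H.
  move=> eps eps0.
  (* The remainder of [f] at [g y] reaches [g] multiplied by at most the norm cost of [Q] and the
     Lipschitz constant [C] of [g]; dividing by [M] in advance absorbs both. *)
  pose M := k%:R * `|Q| * C + 1.
  have M0 : 0 < M by rewrite /M ltr_wpDl// !mulr_ge0// ltW.
  have eM : 0 < eps / M by rewrite divr_gt0.
  have [d d0 Hd] := diff_approx (smooth_diff sf Og) eM.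
  have [w w0 Hw] := open_ball oW Wy.
  apply: (@normball_nbhs _ _ _ _ (Num.min w (d / C))); first by rewrite lt_min w0 divr_gt0.
  move=> z; rewrite subr0 lt_min => /andP[zw zd] /=.
  have Wz : W (z + y) by apply: Hw; rewrite addrK.
  have [gz fgz] := gP _ Wz.
  have lz := glip _ _ Wz Wy; rewrite addrK in lz.
  have := Hd (g (z + y) - g y); rewrite [g y + (_ - _)]addrC subrK fgz fgy addrK.
  have -> : 'd f (g y) (g (z + y) - g y) = (g (z + y) - g y) *m J (g y).
    by rewrite -DJ// deriveE//; exact: smooth_diff Og.
  have lt : `|g (z + y) - g y| < d.
    by rewrite (le_lt_trans lz)// mulrC -ltr_pdivlMr.
  move=> /(_ lt) H.
  have -> : g (z + y) - (g y + z *m Q) = - ((z - (g (z + y) - g y) *m J (g y)) *m Q).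
    by rewrite mulmxBl -mulmxA mulmxV// mulmx1 opprB opprD addrA.
  rewrite normrN (le_trans (mulmx_norm _ _))// mulrAC.
  rewrite (@le_trans _ _ (k%:R * `|Q| * (eps / M * (C * `|z|))))//.
    rewrite ler_wpM2l ?mulr_ge0// (le_trans H)// ler_wpM2l//; exact: ltW.
  have -> : k%:R * `|Q| * (eps / M * (C * `|z|)) = eps * `|z| * (k%:R * `|Q| * C / M) by ring.
  rewrite ler_piMr ?mulr_ge0 ?(ltW eps0)//.
  by rewrite ler_pdivrMr// mul1r /M lerDl.
pose V := [set x | `|x - x0| < r / 2 /\ W (f x)].
have VO : V `<=` O by move=> x [/b2/rP[]].
exists V, W, g; split=> //.
- apply: ball_open_set => x [xr Wfx].
  have [Ox _ _] := rP _ (b2 _ xr).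
  have [e1 e10 H1] := open_ball oW Wfx.
  have [e2 e20 H2] := continuous_ball (smooth_cont sf Ox) e10.
  exists (Num.min e2 (r / 2 - `|x - x0|)); first by rewrite lt_min e20 subr_gt0.
  move=> y; rewrite lt_min => /andP[y1 y2]; split; last exact/H1/H2.
  by have := ler_normD (y - x) (x - x0); rewrite subrKA; lra.
- split; rewrite ?subrr ?normr0//; rewrite /W /= subrr mul0mx normr0 divr_gt0//.
split.
(* The derivative of [g] is the inverse Jacobian composed with [g] itself, so each order of
   regularity of [g] yields the next one. *)
- elim=> [y Wy|n IH]; first by apply: differentiable_continuous; have [] := dg _ Wy.
  split=> [y Wy|v]; first by have [] := dg _ Wy.
  apply: (@Ck_ext _ _ _ _ n oW (fun y => v *m invmx (J (g y)))).
    by move=> y Wy; have [dgy <-] := dg _ Wy; rewrite deriveE.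
  pose U := [set x | `|x - x0| < r].
  have oU : open U.
    have -> : U = ball x0 r by apply/seteqP; split => x; rewrite /U -ball_normE /= distrC.
    exact: ball_open.
  apply: Ck_mulmx => //; first exact: Ck_cst.
  apply: (@Ck_comp_mx _ _ _ _ _ W U g (fun x => invmx (J x))) => //.
    by move=> y /gP[/b2].
  apply: (Ck_invmx oU); first by move=> x /rP[].
  by apply: Ck_sub (sJ n) => x /rP[].
- move=> x [xr Wfx]; split=> //; have [gx fgx] := gP _ Wfx.
  by apply: injf => //; exact: b2.
- by move=> y Wy; have [gy fgy] := gP _ Wy; split=> //; split=> //; rewrite fgy.
Qed.

End IFT.

(** * Orthogonal projections onto row spaces *)

Local Notation proj := Defs.proj.

Section ballR.
Variable R : realType.

Lemma nbhs_ballR (x : R) (A : set R) :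
  nbhs x A -> exists2 e : R, 0 < e & forall y, `|y - x| < e -> A y.
Proof.
move=> /nbhs_ballP[e /= e0 eA]; exists e => // y yx; apply: eA.
by rewrite /ball /= distrC.
Qed.

Lemma ball_nbhsR (x : R) (A : set R) (e : R) :
  0 < e -> (forall y, `|y - x| < e -> A y) -> nbhs x A.
Proof.
move=> e0 eA; apply/nbhs_ballP; exists e => //= y.
by rewrite /ball /= distrC; exact: eA.
Qed.

Lemma open_ballR (x : R) (O : set R) : open O -> O x ->
  exists2 e : R, 0 < e & forall y, `|y - x| < e -> O y.
Proof. by move=> oO Ox; apply: nbhs_ballR; apply: open_nbhs_nbhs. Qed.

Lemma derive1_approx (W : normedModType R) (f : R -> W) t e :
  differentiable f t -> 0 < e -> exists2 d : R, 0 < d & forall s, `|s - t| < d ->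
    `|f s - f t - (s - t) *: derive1 f t| <= e * `|s - t|.
Proof.
move=> df e0; have [d d0 H] := diff_approx df e0; exists d => // s std.
have := H _ std; have -> : t + (s - t) = s by rewrite addrC subrK.
by have -> : 'd f t (s - t) = (s - t) *: derive1 f t by rewrite (congr1 (fun g => g (s - t)) (diff1E df)).
Qed.

End ballR.

Section Dot.
Variables (R : realType) (N : nat).
Local Notation E := 'rV[R]_N.
Implicit Types u v w : E.

Lemma dotE u v : dot u v = (u *m v^T) 0 0.
Proof. by rewrite mxE; apply: eq_bigr => i _; rewrite mxE. Qed.

Lemma dotC u v : dot u v = dot v u.
Proof. by apply: eq_bigr => i _; rewrite mulrC. Qed.

Lemma dotDl u v w : dot (u + v) w = dot u w + dot v w.
Proof. by rewrite -big_split; apply: eq_bigr => i _; rewrite mxE mulrDl. Qed.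

Lemma dotZl a u v : dot (a *: u) v = a * dot u v.
Proof. by rewrite mulr_sumr; apply: eq_bigr => i _; rewrite mxE mulrA. Qed.

Lemma dotDr u v w : dot u (v + w) = dot u v + dot u w.
Proof. by rewrite dotC dotDl !(dotC u). Qed.

Lemma dotZr a u v : dot u (a *: v) = a * dot u v.
Proof. by rewrite dotC dotZl (dotC u). Qed.

Lemma dotNl u v : dot (- u) v = - dot u v.
Proof. by rewrite -scaleN1r dotZl mulN1r. Qed.

Lemma dotNr u v : dot u (- v) = - dot u v.
Proof. by rewrite dotC dotNl dotC. Qed.

Lemma dotBl u v w : dot (u - v) w = dot u w - dot v w.
Proof. by rewrite dotDl dotNl. Qed.

Lemma dotBr u v w : dot u (v - w) = dot u v - dot u w.
Proof. by rewrite dotDr dotNr. Qed.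

Lemma dot0l v : dot 0 v = 0.
Proof. by rewrite -(scale0r 0) dotZl mul0r. Qed.

Lemma dot0r v : dot v 0 = 0.
Proof. by rewrite dotC dot0l. Qed.

Lemma dot_sumr (J : Type) (r : seq J) u (F : J -> E) :
  dot u (\sum_(i <- r) F i) = \sum_(i <- r) dot u (F i).
Proof.
by elim: r => [|i r IH]; rewrite ?big_nil ?dot0r// !big_cons dotDr IH.
Qed.

Lemma dot_suml (J : Type) (r : seq J) u (F : J -> E) :
  dot (\sum_(i <- r) F i) u = \sum_(i <- r) dot (F i) u.
Proof. by rewrite dotC dot_sumr; apply: eq_bigr => i _; rewrite dotC. Qed.

Lemma dot_ge0 v : 0 <= dot v v.
Proof. by apply: sumr_ge0 => i _; rewrite -expr2 sqr_ge0. Qed.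

Lemma dot_eq0 v : dot v v = 0 -> v = 0.
Proof.
move=> H; apply/rowP => i; rewrite mxE; apply/eqP; rewrite -sqrf_eq0 expr2.
by move/eqP: H; rewrite psumr_eq0 => [/allP/(_ i)|j _];
  [rewrite mem_index_enum => /(_ isT)|rewrite -expr2 sqr_ge0].
Qed.

Lemma norm_dot u v : `|dot u v| <= N%:R * `|u| * `|v|.
Proof.
rewrite (le_trans (ler_norm_sum _ _ _))// -mulrA mulr_natl.
rewrite -[X in _ *+ X]card_ord -sumr_const ler_sum// => i _.
by rewrite normrM ler_pM// rV_norm_coord.
Qed.

Lemma norm_sqrt_dot v : `|v| <= Num.sqrt (dot v v).
Proof.
apply: rV_norm_le => [|i]; first exact: sqrtr_ge0.
rewrite -sqrtr_sqr ler_sqrt ?dot_ge0// /dot (bigD1 i)//= expr2 lerDl.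
by apply: sumr_ge0 => j _; rewrite -expr2 sqr_ge0.
Qed.

End Dot.

Section Vspace.
Variables (R : realType) (N : nat).
Local Notation E := 'rV[R]_N.

(** A subspace of largest dimension inside [S] is all of [S], since a vector of [S] outside it would
    enlarge it. *)
Lemma subspace_vspace (S : set E) : S 0 ->
  (forall a u v, S u -> S v -> S (a *: u + v)) -> exists U : {vspace E}, S = [set` U].
Proof.
move=> S0 Sl.
pose P (d : nat) := `[< exists U : {vspace E}, \dim U = d /\ [set` U] `<=` S >].
have exP : exists d, P d.
  exists 0%N; apply/asboolP; exists 0%VS; rewrite dimv0; split=> // v /=.
  by rewrite memv0 => /eqP ->.
have bP d : P d -> (d <= \dim (fullv : {vspace E}))%N.
  by move=> /asboolP[U [<- _]]; apply/dimvS/subvf.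
case: (ex_maxnP exP bP) => d /asboolP[U [dU US]] dmax.
exists U; apply/seteqP; split=> // v Sv /=.
apply: contrapT => vU.
have US' : [set` (U + <[v]>)%VS] `<=` S.
  move=> w /= /memv_addP[u uU [x /vlineP[k ->] ->]].
  by rewrite addrC; apply: Sl => //; exact: US.
have : (\dim (U + <[v]>)%VS <= d)%N.
  by apply: dmax; apply/asboolP; exists (U + <[v]>)%VS.
rewrite -dU => H.
have : (U + <[v]>)%VS == U by rewrite eq_sym eqEdim addvSl.
move=> /eqP E0; apply: vU; rewrite -E0.
by apply: (subvP (addvSr U <[v]>)); exact: memv_line.
Qed.

(** Having codimension one is read as: subtracting a multiple of the transverse vector [d] brings
    any vector of [T] into [U]. One direction serves for the nullity of a given solution, the other
    for the dimension of the rulings of a constructed one. *)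
Lemma dim_hyperplane (U T : {vspace E}) d :
  (U <= T)%VS -> d \in T -> d \notin U ->
  (\dim U).+1 = \dim T <-> (forall v, v \in T -> exists a, v - a *: d \in U).
Proof.
move=> UT dT dU.
have d0 : d != 0 by apply: contraNneq dU => ->; exact: mem0v.
have disj : (U :&: <[d]>)%VS = 0%VS.
  apply/eqP; rewrite -subv0; apply/subvP => w; rewrite memv_cap memv0 => /andP[wU].
  move=> /vlineP[k kE]; rewrite {}kE in wU *.
  have [->|k0] := eqVneq k 0; first by rewrite scale0r.
  by have := memvZ k^-1 wU; rewrite scalerA mulVf// scale1r (negbTE dU).
have dims : \dim (U + <[d]>) = (\dim U).+1.
  by rewrite dimv_disjoint_sum// dim_vline d0 addn1.
have sub : (U + <[d]> <= T)%VS by rewrite subv_add UT -memvE dT.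
split=> [H v vT|H].
  have : (U + <[d]>)%VS == T by rewrite eqEdim sub dims H leqnn.
  move=> /eqP ET; rewrite -ET in vT.
  have /memv_addP[u uU [x /vlineP[k ->] ->]] := vT.
  by exists k; rewrite addrK.
rewrite -dims; apply/eqP; rewrite eqn_leq dimvS//=; apply: dimvS.
apply/subvP => v /H[a aU]; apply/memv_addP.
exists (v - a *: d) => //; exists (a *: d); last by rewrite subrK.
by apply/vlineP; exists a.
Qed.

End Vspace.

Section Gram.
Variables (R : realType) (N m : nat).
Local Notation E := 'rV[R]_N.

Definition rowsp (A : 'M[R]_(m, N)) : set E := [set v | exists z, v = z *m A].

Definition gram_unit (A : 'M[R]_(m, N)) := A *m A^T \in unitmx.

Lemma gram_unitP (A : 'M[R]_(m, N)) :
  gram_unit A <-> (forall z : 'rV_m, z *m A = 0 -> z = 0).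
Proof.
split=> [u z zA|H].
  by rewrite -[z]mulmx1 -(mulmxV u) !mulmxA zA !mul0mx.
apply: unitmx_inj => z zA; apply: H; apply: dot_eq0.
by rewrite dotE trmx_mul !mulmxA -(mulmxA z) zA mul0mx mxE.
Qed.

(** The orthogonal projection onto [rowsp A] when the Gram matrix is invertible. Being rational in
    the entries of [A], it shows the smooth dependence that [proj], defined by choice, conceals. *)
Definition gproj (A : 'M[R]_(m, N)) (v : E) : E :=
  v *m A^T *m invmx (A *m A^T) *m A.

Lemma gproj_rowsp A v : rowsp A (gproj A v).
Proof. by eexists; reflexivity. Qed.

Lemma gproj_orth A v z : gram_unit A -> dot (v - gproj A v) (z *m A) = 0.
Proof.
move=> u; rewrite dotE trmx_mul mulmxA mulmxBl /gproj.
by rewrite -[_ *m A *m A^T]mulmxA mulmxKV// subrr mul0mx mxE.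
Qed.

Lemma proj_uniq (D : {vspace E}) (v w : E) :
  w \in D -> (forall z, z \in D -> dot (v - w) z = 0) -> proj [set` D] v = w.
Proof.
move=> wD wo; have [pD po] : [set w | [set` D] w /\ orth [set` D] (v - w)] (proj [set` D] v).
  by apply: xgetPex; exists w.
have H : dot (proj [set` D] v - w) (proj [set` D] v - w) = 0.
  have dD : proj [set` D] v - w \in D by rewrite memvB.
  have := wo _ dD; have := po _ dD => po'.
  have -> : v - w = (v - proj [set` D] v) + (proj [set` D] v - w) by rewrite subrKA.
  by rewrite dotDl po' add0r.
apply/eqP; rewrite -subr_eq0; apply/eqP; exact: dot_eq0.
Qed.

Lemma span_rows (f : nat -> E) v :
  (v \in <<mkseq f m>>%VS) <-> rowsp (\matrix_(i < m) f i) v.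
Proof.
have E0 (z : 'rV_m) : z *m \matrix_(i < m) f i = \sum_(i < m) z 0 i *: f i.
  apply/rowP => j; rewrite mxE summxE; apply: eq_bigr => i _.
  by rewrite !mxE.
split=> [|[z ->]].
  have sz : size (mkseq f m) == m by rewrite size_mkseq.
  rewrite -[mkseq f m]/(tval (Tuple sz)) => /coord_span ->.
  exists (\row_i coord (Tuple sz) i v); rewrite E0; apply: eq_bigr => i _.
  by rewrite mxE /= nth_mkseq.
rewrite E0; apply: memv_suml => i _; apply: memvZ; apply: memv_span.
by rewrite /mkseq; apply: map_f; rewrite mem_iota /=.
Qed.

Lemma dim_rowsp (D : {vspace E}) (A : 'M[R]_(m, N)) :
  [set` D] = rowsp A -> (\dim D = m <-> gram_unit A).
Proof.
move=> DA.
pose s := [tuple row i A | i < m].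
have Ds : D = << s >>%VS.
  apply/vspaceP => v; apply/idP/idP => [vD|].
    have : [set` D] v by []. rewrite DA => -[z ->].
    rewrite mulmx_sum_row; apply: memv_suml => i _; apply: memvZ; apply: memv_span.
    by apply/mapP; exists i => //; rewrite mem_enum.
  move=> /coord_span ->; apply: memv_suml => i _; apply: memvZ.
  have : rowsp A (row i A) by exists (delta_mx 0 i); rewrite rowE.
  by rewrite -DA /= (_ : s`_i = row i A)// -tnth_nth tnth_mktuple.
rewrite gram_unitP; split=> [dD z zA|H].
  have : free s by rewrite /free -Ds dD size_tuple.
  move=> /freeP fr; apply/rowP => i; rewrite mxE; apply: (fr (fun i => z 0 i)).
  rewrite -[RHS]zA mulmx_sum_row; apply: eq_bigr => j _.
  by rewrite -tnth_nth tnth_mktuple.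
have : free s.
  apply/freeP => k kE i.
  suff : (\row_i k i) = 0 :> 'rV_m by move=> /rowP/(_ i); rewrite !mxE.
  apply: H; rewrite -kE mulmx_sum_row; apply: eq_bigr => j _.
  by rewrite mxE -tnth_nth tnth_mktuple.
by rewrite /free -Ds size_tuple => /eqP.
Qed.

Lemma proj_gram (D : {vspace E}) (A : 'M[R]_(m, N)) v :
  [set` D] = rowsp A -> gram_unit A -> proj [set` D] v = gproj A v.
Proof.
move=> DA u; apply: proj_uniq.
  by have := gproj_rowsp A v; rewrite -DA.
move=> z zD; have : [set` D] z by []. rewrite DA => -[y ->].
exact: gproj_orth.
Qed.

End Gram.

Section Proj.
Variables (R : realType) (N : nat).
Local Notation E := 'rV[R]_N.
Implicit Types (D : {vspace E}) (u v : E).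

Lemma vspace_frame D : exists A : 'M[R]_(\dim D, N), [set` D] = rowsp A /\ gram_unit A.
Proof.
pose A : 'M[R]_(\dim D, N) := \matrix_(i < \dim D) (vbasis D)`_i.
have DA : [set` D] = rowsp A.
  have E0 : << mkseq (fun i => (vbasis D)`_i) (\dim D) >>%VS = D.
    have /span_basis E1 := vbasisP D; rewrite -[RHS]E1; congr (<<_>>%VS).
    by have := mkseq_nth 0 (vbasis D); rewrite size_tuple.
  by apply/seteqP; split => v; [rewrite -{1}E0 => /span_rows|move=> /span_rows; rewrite E0].
by exists A; split=> //; apply/(dim_rowsp DA).
Qed.

Lemma proj_in D v : proj [set` D] v \in D.
Proof.
have [A [DA u]] := vspace_frame D; rewrite (proj_gram _ DA u).
by have := gproj_rowsp A v; rewrite -DA.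
Qed.

Lemma perp_orth D v w : w \in D -> dot (perp_proj [set` D] v) w = 0.
Proof.
have [A [DA u]] := vspace_frame D; rewrite /perp_proj (proj_gram _ DA u) => wD.
have : [set` D] w by []. rewrite DA => -[z ->]; exact: gproj_orth.
Qed.

Lemma proj_id D v : v \in D -> proj [set` D] v = v.
Proof. by move=> vD; apply: proj_uniq => // z _; rewrite subrr dot0l. Qed.

Lemma proj_lin D a u v : proj [set` D] (a *: u + v) = a *: proj [set` D] u + proj [set` D] v.
Proof.
apply: proj_uniq.
  by apply: memvD; [apply: memvZ|]; exact: proj_in.
move=> z zD; rewrite opprD addrACA -scalerBr dotDl dotZl.
by rewrite -![_ - proj _ _]/(perp_proj _ _) !perp_orth// mulr0 addr0.
Qed.

Lemma dot_proj D v w : w \in D -> dot (proj [set` D] v) w = dot v w.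
Proof.
move=> wD; apply/eqP; rewrite eq_sym -subr_eq0 -dotBl.
by rewrite -[_ - proj _ _]/(perp_proj _ _) perp_orth.
Qed.

Lemma proj_eq0 D v : (forall w, w \in D -> dot v w = 0) -> proj [set` D] v = 0.
Proof. by move=> H; apply: proj_uniq; rewrite ?mem0v// => z zD; rewrite subr0 H. Qed.

Lemma perp_proj_eq0 D v : perp_proj [set` D] v = 0 <-> v \in D.
Proof.
split=> [/eqP|vD]; last by rewrite /perp_proj proj_id ?subrr.
by rewrite subr_eq0 => /eqP ->; exact: proj_in.
Qed.

Lemma perp_proj_lin D a u v :
  perp_proj [set` D] (a *: u + v) = a *: perp_proj [set` D] u + perp_proj [set` D] v.
Proof. by rewrite /perp_proj proj_lin scalerBr opprD addrACA. Qed.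

Lemma perp_projD D u v :
  perp_proj [set` D] (u + v) = perp_proj [set` D] u + perp_proj [set` D] v.
Proof. by rewrite -[u]scale1r perp_proj_lin !scale1r. Qed.

End Proj.

(** * Derivatives determined by the values on an interval *)

Section Interval.
Variables (R : realType) (I : set R).
Hypothesis (I_itv : is_interval I) (I_nondeg : I° !=set0).

Lemma interval_near t e : I t -> 0 < e -> exists s, [/\ I s, s != t & `|s - t| < e].
Proof.
move=> It e0; have [s0 s0I] := I_nondeg.
have [r r0 rI] := nbhs_ballR s0I.
have [s1 [Is1 s1t]] : exists s1, I s1 /\ s1 != t.
  have [E|E] := eqVneq s0 t; last by exists s0; split=> //; apply: rI; rewrite subrr normr0.
  exists (s0 + r / 2); split.
    by apply: rI; rewrite addrC addKr ger0_norm ?divr_ge0 ?ltW// ltr_pdivrMr// ltr_pMr// ltr1n.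
  by rewrite -E -subr_eq0 addrC addKr mulf_neq0 ?gt_eqF.
pose d := `|s1 - t|; have d0 : 0 < d by rewrite normr_gt0 subr_eq0.
pose c := Num.min 1 (e / (2 * d)).
have c0 : 0 < c by rewrite lt_min ltr01 divr_gt0 ?mulr_gt0.
have c1 : c <= 1 by rewrite ge_min lexx.
exists (t + c * (s1 - t)); split.
- have [ts|st] := leP t s1.
    by apply: (I_itv It Is1); nra.
  by apply: (I_itv Is1 It); nra.
- have: c * (s1 - t) != 0 by rewrite mulf_eq0 negb_or subr_eq0 s1t gt_eqF.
  by apply: contraNneq => /eqP; rewrite -subr_eq0 addrAC subrr add0r.
- rewrite addrC addKr normrM gtr0_norm// -/d.
  have c2 : c <= e / (2 * d) by rewrite ge_min lexx orbT.
  rewrite (@le_lt_trans _ _ (e / (2 * d) * d))//; first by rewrite ler_wpM2r// ltW.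
  by rewrite invfM mulrA divfK ?gt_eqF// ltr_pdivrMr// ltr_pMr// ltr1n.
Qed.

(** Each point of a nondegenerate interval is a limit of other points of it, so difference quotients
    inside [I] determine the derivative. At an endpoint [f] and [g] may well differ outside [I]. *)
Lemma derive1_eq_on (W : normedModType R) (f g : R -> W) t :
  I t -> differentiable f t -> differentiable g t ->
  (\forall s \near t, I s -> f s = g s) -> derive1 f t = derive1 g t.
Proof.
move=> It df dg H; apply/eqP; rewrite -subr_eq0 -normr_le0.
apply/ler_addgt0Pl => e e0; rewrite addr0.
have e20 : 0 < e / 2 by rewrite divr_gt0.
have [d1 d10 H1] := derive1_approx df e20.
have [d2 d20 H2] := derive1_approx dg e20.
have [d3 d30 H3] := nbhs_ballR H.
have [s [Is st sd]] := @interval_near t (Num.min d1 (Num.min d2 d3)) It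
   (ltac:(by rewrite !lt_min d10 d20 d30)).
move: sd; rewrite !lt_min => /andP[s1 /andP[s2 s3]].
have st0 : 0 < `|s - t| by rewrite normr_gt0 subr_eq0.
have := H1 _ s1; have := H2 _ s2.
have ft : f t = g t by apply: H3 => //; rewrite subrr normr0.
rewrite (H3 _ s3 Is) ft => K2 K1.
rewrite -(ler_pM2l st0) -normrZ scalerBr.
have -> : (s - t) *: derive1 f t - (s - t) *: derive1 g t =
  (g s - g t - (s - t) *: derive1 g t) - (g s - g t - (s - t) *: derive1 f t).
  move: (_ *: _) (_ *: _) (g s - g t) => X Y Z.
  by rewrite [RHS]addrC opprB addrA subrK.
rewrite (le_trans (ler_normB _ _))// mulrC (splitr e) mulrDl lerD//.
Qed.

End Interval.

(** * Graph charts of embedded submanifolds *)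

Section Jac.
Variables (R : realType).

Lemma derive_comp (U V W : normedModType R) (f : V -> W) (g : U -> V) x v :
  differentiable g x -> differentiable f (g x) ->
  'D_v (fun y => f (g y)) x = 'D_('D_v g x) f (g x).
Proof.
move=> dg df; rewrite deriveE; last exact: (differentiable_comp (f := g)).
by rewrite (diff_comp dg df) /= !deriveE.
Qed.

Lemma differentiable_comp' (U V W : normedModType R) (f : V -> W) (g : U -> V) x :
  differentiable g x -> differentiable f (g x) -> differentiable (fun y => f (g y)) x.
Proof. by move=> dg df; exact: (differentiable_comp (f := g)). Qed.

Definition jac k p (f : 'rV[R]_k -> 'rV[R]_p) (x : 'rV[R]_k) : 'M[R]_(k, p) :=
  \matrix_(i < k) 'D_(delta_mx 0 i) f x.

Lemma deriveJ k p (f : 'rV[R]_k -> 'rV[R]_p) x v :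
  differentiable f x -> 'D_v f x = v *m jac f x.
Proof.
move=> df; rewrite derive_rV_sum//.
apply/rowP => j; rewrite summxE mxE; apply: eq_bigr => i _.
by rewrite !mxE.
Qed.

Lemma smooth_jac k p (f : 'rV[R]_k -> 'rV[R]_p) O :
  open O -> smooth O f -> smooth O (jac f).
Proof.
move=> oO sf n; apply: Ck_mx_of => // i j.
apply: (@Ck_ext _ _ _ _ n oO (fun x => 'D_(delta_mx 0 i) f x 0 j)).
  by move=> x _; rewrite mxE.
by apply: Ck_coord => //; exact: smooth_derive.
Qed.

Lemma derive_mulmxl (V : normedModType R) p q r (B : 'M[R]_(p, q)) (g : V -> 'M[R]_(q, r)) x v :
  differentiable g x -> 'D_v (fun x => B *m g x) x = B *m 'D_v g x.
Proof.
have dB : differentiable (cst B : V -> 'M[R]_(p, q)) x by exact: differentiable_cst.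
by move=> dg; rewrite (derive_mulmx v dB dg) derive_cst mul0mx add0r.
Qed.

Lemma smooth_mulmxr (V : normedModType R) p l (f : V -> 'M[R]_(p, l)) O q (B : 'M[R]_(l, q)) :
  open O -> smooth O f -> smooth O (fun x => f x *m B).
Proof. by move=> oO sf n; apply: Ck_mulmx => //; exact: Ck_cst. Qed.

Lemma Ck_id (V : normedModType R) n (O : set V) : Ck n O id.
Proof.
case: n => [x _|n]; first exact: cvg_id.
split=> [x _|v]; first exact: ex_diff.
have -> : 'D_v id = cst v :> (V -> V) by apply/funext => x; rewrite derive_id.
exact: Ck_cst.
Qed.

Lemma derive_affine (V : normedModType R) (a v : V) s :
  'D_1 (fun s : R => a + s *: v) s = v.
Proof.
have := @is_derive_line R V V id a v s (@derivable_id _ _ _ _).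
by case=> _ ->; rewrite derive_id.
Qed.

Lemma Ck_affine k n (a v : 'rV[R]_k) O : open O -> Ck n O (fun s : R => a + s *: v).
Proof.
move=> oO; apply: CkD => //; first exact: Ck_cst.
by apply: Ck_scalemx => //; [exact: Ck_id|exact: Ck_cst].
Qed.

End Jac.

Section Graph.
Variables (R : realType) (N m : nat).
Local Notation E := 'rV[R]_N.
Implicit Types (M U : set E) (W : set 'rV[R]_m) (F : 'rV[R]_m -> E) (L : 'M[R]_(N, m)).

(** [F] parametrizes the part of [M] inside [U] as a graph over the linear coordinates [q *m L]; the
    open set [U] separates this part from the rest of [M]. *)
Definition graph_patch M L W F U :=
  [/\ open W, smooth W F, (forall x, W x -> F x *m L = x), open U & F @` W = M `&` U].

(** The chart followed by a right inverse [L] of its Jacobian at [u0] has the identity as derivative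
    there. Inverting this map locally and composing with the chart turns the chart into a graph. *)
Lemma graph_exists M p : embedded_submanifold m M -> M p ->
  exists L W F U, graph_patch M L W F U /\ U p.
Proof.
move=> eM Mp; have [U [V [phi [oU Up oV [sphi imm [g [gphi cg]]] phiV]]]] := eM p Mp.
have [ O [oO VO sO]] := smooth_on_rV sphi.
have sV : smooth V phi by exact: smooth_sub sO.
have [u0 Vu0 pE] : (phi @` V) p by rewrite phiV.
pose J := jac phi u0.
have uJ : gram_unit J.
  apply/gram_unitP => z zJ; apply: (imm u0) => //.
  by rewrite deriveJ//; exact: smooth_diff Vu0.
pose L := J^T *m invmx (J *m J^T).
have JL : J *m L = 1%:M by rewrite mulmxA mulmxV.
pose psi u := phi u *m L.
have spsi : smooth V psi by exact: smooth_mulmxr.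
have [V' [W' [h [oV' V'u0 V'V oW' [sh hV hW]]]]] : exists V' W' g, [/\ open V', V' u0, V' `<=` V, open W' &
   [/\ smooth W' g, forall x, V' x -> W' (psi x) /\ g (psi x) = x &
     forall y, W' y -> V' (g y) /\ psi (g y) = y]].
  apply: inverse_function => // v.
  have dphi : differentiable phi u0 by exact: smooth_diff Vu0.
  by rewrite derive_mulmxr// deriveJ// -mulmxA JL mulmx1.
pose F x := phi (h x).
(* Shrinking the chart to [V'] calls for an ambient open set that cuts out exactly the image of
   [V']; the continuity of the inverse of the chart on its image provides one. *)
pose U' := U `&` [set y | exists q e, [/\ (phi @` V') q, 0 < e, `|y - q| < e &
    forall q', (phi @` V) q' -> `|q' - q| < e -> V' (g q')]].
have inU q : (phi @` V') q -> U' q.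
  move=> [v V'v <-]; have Vv := V'V _ V'v.
  have VUv : (phi @` V) (phi v) by exists v.
  split; first by move: VUv; rewrite phiV => -[].
  have [e1 e10 H1] := open_ball oV' V'v.
  have /within_continuousP/(_ (phi v)) := cg.
  move=> /(_ (ex_intro2 _ _ v Vv erefl) e1 e10)[d d0 Hd].
  exists (phi v), d; split; [by exists v|by []|by rewrite subrr normr0|].
  by move=> q' Vq' q'd; apply: H1; rewrite -(gphi v Vv); exact: Hd.
exists L, W', F, U'; split; last first.
  by apply: inU; exists u0.
split=> //.
- move=> n; apply: (Ck_comp_mx (O' := V')) => //.
    by move=> x /hW[].
  by apply: Ck_sub (sV n).
- by move=> x /hW[].
- apply: openI => //; apply: ball_open_set => y [q [e [Vq e0 yq H]]].
  exists (e - `|y - q|); first by rewrite subr_gt0.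
  move=> z zy; exists q, e; split=> //.
  by have := ler_normD (z - y) (y - q); rewrite subrKA; lra.
- apply/seteqP; split=> [q [x Wx <-]|q [Mq U'q]].
    have [V'h _] := hW _ Wx.
    split; last by apply: inU; exists (h x).
    have : (phi @` V) (F x) by exists (h x) => //; exact: V'V.
    by rewrite phiV => -[].
  have [Uq [q0 [e [_ _ qq0 H]]]] := U'q.
  have Vq : (phi @` V) q by rewrite phiV.
  have := H q Vq qq0; case: Vq => u Vu uq; rewrite -uq gphi// => V'u.
  by have [W'u hu] := hV _ V'u; exists (psi u) => //; rewrite /F hu.
Qed.

Section patch.
Variables (M : set E) (L : 'M[R]_(N, m)) (W : set 'rV[R]_m) (F : 'rV[R]_m -> E) (U : set E).
Hypothesis G : graph_patch M L W F U.

Lemma patch_open : open W. Proof. by case: G. Qed.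
Lemma patch_smooth : smooth W F. Proof. by case: G. Qed.
Lemma patchL x : W x -> F x *m L = x. Proof. by case: G => _ _ + _ _; exact. Qed.
Lemma patch_diff x : W x -> differentiable F x.
Proof. by move=> Wx; exact: smooth_diff patch_smooth Wx. Qed.

Lemma patch_in x : W x -> M (F x) /\ U (F x).
Proof.
case: G => _ _ _ _ FW Wx; have : (F @` W) (F x) by exists x.
by rewrite FW.
Qed.

Lemma patch_out q : M q -> U q -> W (q *m L) /\ F (q *m L) = q.
Proof.
move=> Mq Uq; case: G => _ _ FL _ FW; have : (F @` W) q by rewrite FW.
by move=> [x Wx <-]; rewrite FL.
Qed.

Lemma patch_near x : W x -> \forall q \near F x, M q -> W (q *m L) /\ F (q *m L) = q.
Proof.
move=> Wx; have [_ UF] := patch_in Wx; case: G => _ _ _ oU _.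
by apply: (near_open oU UF) => q Uq Mq; exact: patch_out.
Qed.

Lemma patch_derL x a : W x -> 'D_a F x *m L = a.
Proof.
move=> Wx; rewrite -derive_mulmxr; last exact: patch_diff.
rewrite -[RHS](@derive_id R _ x a); apply: near_eq_derive.
by apply: (near_open patch_open Wx) => y; exact: patchL.
Qed.

Lemma patch_der2L x a b : W x -> 'D_a ('D_b F) x *m L = 0.
Proof.
move=> Wx; rewrite -derive_mulmxr; last first.
  by apply: smooth_diff Wx; apply: smooth_derive; exact: patch_smooth.
rewrite -(@derive_cst R _ _ b x a); apply: near_eq_derive.
by apply: (near_open patch_open Wx) => y Wy; rewrite patch_derL.
Qed.

(** Near 0 a curve in [M] is the image under [F] of its own projection by [L], which determines its
    velocity from [v *m L]. Conversely, the image of a straight line in [W] realizes each such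
    velocity. *)
Lemma tangent_patch x v : W x ->
  tangent_space M (F x) v <-> v = 'D_(v *m L) F x.
Proof.
move=> Wx; split=> [[c [sc c0 Mc <-]]|->].
  have [ O [oO O0 sO]] := smooth_on_R sc.
  have dc : differentiable c 0 by apply: smooth_diff sO _; exact: O0.
  have cc : {for 0, continuous c} by exact: differentiable_continuous.
  have E0 : \forall s \near (0 : R), c s = F (c s *m L).
    have H : \forall s \near (0 : R), M (c s) -> W (c s *m L) /\ F (c s *m L) = c s.
      by have := patch_near Wx; rewrite -c0 => /cc.
    near=> s; have Hs : M (c s) by near: s.
    have : M (c s) -> W (c s *m L) /\ F (c s *m L) = c s by near: s.
    by case.
  rewrite derive1E {1}(near_eq_derive _ E0).
  have dcL : differentiable (fun s => c s *m L) 0.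
    by apply: differentiable_mulmx => //; exact: differentiable_cst.
  have cL0 : c 0 *m L = x by rewrite c0 patchL.
  rewrite (@derive_comp _ _ _ _ F (fun s => c s *m L))//; last by rewrite cL0; exact: patch_diff.
  by rewrite cL0 derive_mulmxr.
set b := v *m L.
exists (fun s => F (x + s *: b)); split.
- pose O := [set s : R | W (x + s *: b)].
  have oO : open O.
    apply: open_comp; last exact: patch_open.
    move=> s _; apply: differentiable_continuous.
    exact: (smooth_diff (O := setT) (fun n => Ck_affine n x b openT)).
  apply: (smooth_smooth_on oO).
    by move=> _ ->; rewrite /O /= scale0r addr0.
  move=> n; apply: (@Ck_comp_mx _ _ _ _ _ _ O W (fun s => x + s *: b) F).
  + exact: oO.
  + exact: patch_open.
  + by [].
  + exact: Ck_affine.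
  + exact: patch_smooth.
- by rewrite scale0r addr0.
- have cl : {for (0 : R), continuous (fun s : R => x + s *: b)}.
    apply: differentiable_continuous.
    exact: (smooth_diff (O := setT) (fun n => Ck_affine n x b openT)).
  have : nbhs (x + (0 : R) *: b) W.
    by rewrite scale0r addr0; apply: open_nbhs_nbhs; split=> //; exact: patch_open.
  move=> /cl H; have H' : \forall s \near (0 : R), W (x + s *: b) := H.
  near=> s; have Ws : W (x + s *: b) by near: s.
  by have [] := patch_in Ws.
- rewrite derive1E (@derive_comp _ _ _ _ F (fun s : R => x + s *: b)).
  + by rewrite derive_affine scale0r addr0.
  + exact: (smooth_diff (O := setT) (fun n => Ck_affine n x b openT)).
  + by rewrite scale0r addr0; exact: patch_diff.
Unshelve. all: by end_near. Qed.

Lemma tangent_patchP x v : W x ->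
  tangent_space M (F x) v <-> exists b, v = 'D_b F x.
Proof.
move=> Wx; rewrite tangent_patch//; split=> [vE|[b ->]]; first by exists (v *m L).
by rewrite patch_derL.
Qed.

Lemma tangent_rowsp x : W x -> tangent_space M (F x) = rowsp (jac F x).
Proof.
move=> Wx; apply/seteqP; split=> v.
  move=> /(tangent_patchP v Wx)[b ->]; exists b; rewrite deriveJ//; exact: patch_diff.
move=> [b ->]; apply/(tangent_patchP _ Wx); exists b.
by rewrite deriveJ//; exact: patch_diff.
Qed.

Lemma jac_patch_unit x : W x -> gram_unit (jac F x).
Proof.
move=> Wx; apply/gram_unitP => z zJ.
by rewrite -(patch_derL z Wx) deriveJ ?zJ ?mul0mx//; exact: patch_diff.
Qed.

Lemma rowsp_vspace k (A : 'M[R]_(k, N)) : exists D : {vspace E}, rowsp A = [set` D].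
Proof.
apply: subspace_vspace; first by exists 0; rewrite mul0mx.
by move=> a _ _ [y ->] [z ->]; exists (a *: y + z); rewrite mulmxDl scalemxAl.
Qed.

Lemma tangent_vspace x : W x -> exists D : {vspace E},
  tangent_space M (F x) = [set` D] /\ \dim D = m.
Proof.
move=> Wx; have [D DE] := rowsp_vspace (jac F x); exists D.
rewrite tangent_rowsp//; split=> //.
by apply/(dim_rowsp (esym DE)); exact: jac_patch_unit.
Qed.

(** In the patch a tangent extension reads [c y *m jac F y]. Differentiating [c] contributes a
    vector of the tangent space, which the normal projection kills, so all extensions give the same
    value and the choice in the definition is harmless. *)
Lemma sff_patch x a b : W x ->
  second_fundamental_form M (F x) ('D_a F x) ('D_b F x) =
  perp_proj (tangent_space M (F x)) ('D_a ('D_b F) x).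
Proof.
move=> Wx; rewrite /second_fundamental_form; set S := [set _ | _].
have SE z : S z -> z = perp_proj (tangent_space M (F x)) ('D_a ('D_b F) x).
  move=> [Y [sY tY Yp ->]].
  have [ O [oO Op sO]] := smooth_on_rV sY.
  have dY : differentiable Y (F x) by apply: smooth_diff sO _; exact: Op.
  have cF : {for x, continuous F} by exact: smooth_cont patch_smooth Wx.
  pose c y := Y (F y) *m L.
  have dYF : differentiable (fun y => Y (F y)) x.
    by apply: differentiable_comp' => //; exact: patch_diff.
  have dc : differentiable c x.
    by apply: differentiable_mulmx => //; exact: differentiable_cst.
  have dJ : differentiable (jac F) x.
    by apply: smooth_diff Wx; apply: smooth_jac; [exact: patch_open|exact: patch_smooth].
  have E0 : \forall y \near x, Y (F y) = c y *m jac F y.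
    have H : \forall y \near x, M (F y) -> tangent_space M (F y) (Y (F y)) := cF _ tY.
    have WW : \forall y \near x, W y by apply: (near_open patch_open Wx).
    near=> y.
    have Wy : W y by near: y.
    have [MF _] := patch_in Wy.
    have HM : M (F y) -> tangent_space M (F y) (Y (F y)) by near: y.
    have /(tangent_patch _ Wy) {1}-> := HM MF.
    by rewrite deriveJ//; exact: patch_diff.
  have -> : 'D_('D_a F x) Y (F x) = 'D_a c x *m jac F x + 'D_a ('D_b F) x.
    rewrite -derive_comp//; last exact: patch_diff.
    rewrite (near_eq_derive _ E0) derive_mulmx//; congr (_ + _).
    have -> : c x = b by rewrite /c Yp patch_derL.
    rewrite -derive_mulmxl//; apply: near_eq_derive.
    apply: (near_open patch_open Wx) => y Wy; rewrite deriveJ//; exact: patch_diff.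
  have [D [DE _]] := tangent_vspace Wx; rewrite DE perp_projD.
  have -> : perp_proj [set` D] ('D_a c x *m jac F x) = 0.
    apply/perp_proj_eq0; have : rowsp (jac F x) ('D_a c x *m jac F x) by eexists.
    by rewrite -tangent_rowsp// DE.
  by rewrite add0r.
suff : exists z, S z by move=> /(xgetPex 0)/SE.
exists (perp_proj (tangent_space M (F x)) ('D_('D_a F x) (fun q => 'D_b F (q *m L)) (F x))).
exists (fun q => 'D_b F (q *m L)).
have cL n O : open O -> Ck n O (fun q : E => q *m L).
  by move=> oO; apply: Ck_mulmx => //; [exact: Ck_id|exact: Ck_cst].
split=> //.
- pose O := [set q : E | W (q *m L)].
  have oO : open O.
    apply: open_comp; last exact: patch_open.
    by move=> q _; apply: (cL 0%N setT openT).
  apply: (smooth_smooth_on oO).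
    by move=> _ ->; rewrite /O /= patchL.
  move=> n; apply: (@Ck_comp_mx _ _ _ _ _ _ O W (fun q => q *m L) ('D_b F)).
  + exact: oO.
  + exact: patch_open.
  + by [].
  + exact: cL.
  + by apply: smooth_derive; exact: patch_smooth.
- have := patch_near Wx; apply: filterS => q H Mq; have [Wq qE] := H Mq.
  by rewrite -{1}qE; apply/(tangent_patchP _ Wq); exists b.
- by rewrite patchL.
Unshelve. all: by end_near. Qed.

(** Second derivatives of [F] are annihilated by [L], whereas a tangent vector is determined by its
    image under [L]. Hence a second derivative whose normal part vanishes is itself zero. *)
Lemma nullity_patch x v : W x ->
  nullity M (F x) v <-> exists b, v = 'D_b F x /\ forall a, 'D_b ('D_a F) x = 0.
Proof.
move=> Wx; have [D [DE _]] := tangent_vspace Wx.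
have key a b : second_fundamental_form M (F x) ('D_b F x) ('D_a F x) = 0 <->
    'D_b ('D_a F) x = 0.
  rewrite sff_patch// DE perp_proj_eq0; split=> [|->]; last exact: mem0v.
  have -> : ('D_b ('D_a F) x \in D) = [set` D] ('D_b ('D_a F) x) :> Prop by [].
  rewrite -DE => /(tangent_patch _ Wx) ->; rewrite patch_der2L//.
  by rewrite deriveJ ?mul0mx//; exact: patch_diff.
split=> [[/(tangent_patchP _ Wx)[b ->] H]|[b [-> H]]].
  exists b; split=> // a; apply/key; apply: H.
  by apply/(tangent_patchP _ Wx); exists a.
split; first by apply/(tangent_patchP _ Wx); exists b.
by move=> y /(tangent_patchP _ Wx)[a ->]; apply/key.
Qed.

End patch.

End Graph.

Opaque derive.

(** * Rulings of a rank-one graph *)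

Section Segment.
Variables (R : realType).

Lemma segment_const k p (f : 'rV[R]_k -> 'rV[R]_p) x v :
  (forall s : R, 0 <= s <= 1 -> differentiable f (x + s *: v) /\ 'D_v f (x + s *: v) = 0) ->
  f (x + v) = f x.
Proof.
move=> H; apply/rowP => i; apply/eqP; rewrite -subr_eq0.
have [s s01 ->] : exists2 s : R, 0 <= s <= 1 &
   f (x + v) 0 i - f x 0 i = 'D_(x + v - x) (fun y => f y 0 i) (x + s *: (x + v - x)).
  apply: (mvt_segment (f := fun y => f y 0 i)) => s s01; rewrite [x + v]addrC addrK.
  have [df _] := H s s01.
  by apply: (differentiable_comp' (f := fun M : 'rV[R]_p => M 0 i) df); exact: differentiable_coord.
rewrite [x + v]addrC addrK; have [df E] := H s s01.
by rewrite -derive_coord// E mxE.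
Qed.

(* [h ^ 2 * exp (- 2 C s)] is nonincreasing. *)
Lemma linear_ode_zero (h G : R -> R) (C : R) :
  (forall s : R, 0 <= s <= 1 -> is_derive s (1 : R) h (h s * G s)) ->
  (forall s, 0 <= s <= 1 -> G s <= C) -> h 0 = 0 ->
  forall s, 0 <= s <= 1 -> h s = 0.
Proof.
move=> dh GC h0 t /andP[t0 t1].
pose phi (s : R) := h s ^+ 2 * expR (- (2 * C) * s).
have dphi (s : R) : 0 <= s <= 1 ->
    is_derive s (1 : R) phi (2 * h s ^+ 2 * (G s - C) * expR (- (2 * C) * s)).
  move=> s01; have Dh := dh s s01.
  have -> : phi = (h ^+ 2) * (fun s => expR (- (2 * C) * s)).
    by apply/funext => u; rewrite /phi !fctE.
  have De : is_derive s (1 : R) (fun s => expR (- (2 * C) * s)) (- (2 * C) * expR (- (2 * C) * s)).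
    have dl : differentiable (fun s : R => - (2 * C) * s) s.
      by apply: differentiableM; [exact: differentiable_cst|exact: ex_diff].
    have de : differentiable (@expR R) (- (2 * C) * s).
      by apply/derivable1_diffP; exact: derivable_expR.
    apply: DeriveDef; first by apply: diff_derivable; exact: (differentiable_comp' dl de).
    rewrite (derive_comp_R (1 : R) dl de).
    have -> : 'D_(1 : R) (@expR R) (- (2 * C) * s) = expR (- (2 * C) * s).
      by have [_ ->] := is_derive_expR (- (2 * C) * s).
    congr (_ * _).
    by rewrite -derive1E derive1Ml ?derive1_id ?mulr1.
  have D2 := is_deriveM (is_deriveX 2 Dh) De.
  apply: is_derive_eq D2 _; rewrite !fctE /=.
  rewrite -![_ *: _]/(_ * _) /=; ring.
have [->|tn0] := eqVneq t 0; first by [].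
have tp : 0 < t by rewrite lt_neqAle eq_sym tn0.
have [c ct E] : exists2 c, c \in `]0, t[%R & phi t - phi 0 =
    2 * h c ^+ 2 * (G c - C) * expR (- (2 * C) * c) * (t - 0).
  apply: (@MVT R phi (fun c => 2 * h c ^+ 2 * (G c - C) * expR (- (2 * C) * c))) => //.
    move=> s; rewrite in_itv /= => /andP[s0 st]; apply: dphi; lra.
  apply: derivable_within_continuous => s; rewrite in_itv /= => /andP[s0 st].
  by have [] := dphi s ltac:(lra).
move: ct; rewrite in_itv /= => /andP[c0 ct].
have Gc : G c - C <= 0 by rewrite subr_le0; apply: GC; lra.
have e0 : 0 <= expR (- (2 * C) * c) := expR_ge0 _.
have phit : phi t <= 0.
  have : phi t - phi 0 <= 0.
    rewrite E subr0; apply: mulr_le0_ge0 => //.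
    apply: mulr_le0_ge0 => //; apply: mulr_ge0_le0 => //.
    by rewrite mulr_ge0// sqr_ge0.
  by rewrite {2}/phi h0 expr0n mul0r subr0.
apply/eqP; rewrite -sqrf_eq0 -(mulIr_eq0 _ (mulIf (lt0r_neq0 (expR_gt0 (- (2 * C) * t))))).
by rewrite eq_le phit /= /phi mulr_ge0 ?sqr_ge0// expR_ge0.
Qed.

End Segment.

Section RankOneGraph.
Variables (R : realType) (N m : nat).
Local Notation E := 'rV[R]_N.
Variables (M : set E) (L : 'M[R]_(N, m)) (W : set 'rV[R]_m) (F : 'rV[R]_m -> E) (U : set E).
Hypothesis (G : graph_patch M L W F U) (m0 : (0 < m)%N) (rk1 : rank_one m M).

(** The nullity of [M] at [F x] read in graph coordinates: the kernel of the vector-valued Hessian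
    of [F]. *)
Variant Knull (x b : 'rV[R]_m) : Prop :=
  KnullI of (forall a, 'D_b ('D_a F) x = 0).

Lemma KnullE x b a : Knull x b -> 'D_b ('D_a F) x = 0.
Proof. by case. Qed.

Let oW : open W := patch_open G.
Let sF : smooth W F := patch_smooth G.

Lemma smoothDF a : smooth W ('D_a F).
Proof. exact: smooth_derive. Qed.

(** The isomorphism sending [b] to ['D_b F x] carries the null directions onto the nullity, a
    hyperplane of the tangent space, so any direction that is not null spans a complement. *)
Lemma Knull_codim x d b : W x -> ~ Knull x d -> exists al, Knull x (b - al *: d).
Proof.
move=> Wx nd; have [D [DE dimD]] := tangent_vspace G Wx.
have [MF _] := patch_in G Wx.
have [Un [dimU UE]] := rk1 MF.
have NU b' : 'D_b' F x \in Un <-> Knull x b'.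
  have -> : ('D_b' F x \in Un) = [set` Un] ('D_b' F x) :> Prop by [].
  rewrite -UE; split=> [/(nullity_patch G _ Wx)[b2 [E0 K2]]|K2].
    have E1 : b' = b2 by rewrite -(patch_derL G b' Wx) E0; exact: (patch_derL G).
    by rewrite E1; split.
  apply/(nullity_patch G _ Wx); exists b'; split=> // a; exact: KnullE.
have TD b' : 'D_b' F x \in D.
  have : tangent_space M (F x) ('D_b' F x) by apply/(tangent_patchP G _ Wx); exists b'.
  by rewrite DE.
have UD : (Un <= D)%VS.
  apply/subvP => v vU; have : [set` Un] v by []. rewrite -UE => -[+ _].
  by rewrite DE.
have dU : 'D_d F x \notin Un by apply/negP => /NU.
have dims : (\dim Un).+1 = \dim D by rewrite dimU dimD prednK.
have [al H] := (dim_hyperplane UD (TD d) dU).1 dims _ (TD b).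
exists al; apply/NU.
have dF := patch_diff G Wx.
by rewrite deriveDv// -scaleN1r !deriveZv// scaleN1r.
Qed.

Variables (x0 d : 'rV[R]_m).
Hypothesis (Wx0 : W x0) (dd0 : 'D_d ('D_d F) x0 != 0).

(* The ball on which one scalar component [f] of [F] has [D_d D_d f <> 0]: there
   the null directions are the kernel of the linear form [v |-> D_v D_d f]. *)
Lemma rank_one_form : exists (r : R) (l : 'rV[R]_m -> 'rV[R]_m -> R), [/\ 0 < r,
  forall x, `|x - x0| < r -> W x,
  (forall v, smooth [set x | `|x - x0| < r] (l ^~ v)) /\
    (forall x, `|x - x0| < r -> linear (l x : _ -> R^o)),
  forall x v, `|x - x0| < r -> l x v = 0 <-> Knull x v &
  [/\ forall x, `|x - x0| < r -> l x d != 0 &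
    forall x v, `|x - x0| < r -> `|x + v - x0| < r -> l x v = 0 ->
    [/\ (forall a, 'D_a F (x + v) = 'D_a F x), l (x + v) v = 0 & F (x + v) = F x + 'D_v F x]]].
Proof.
have [k fk] : exists k, ('D_d ('D_d F) x0) 0 k != 0.
  apply: contrapT => H; move/eqP: dd0; apply; apply/rowP => k; rewrite mxE.
  by apply: contrapT => /eqP Hk; apply: H; exists k.
pose f x := F x 0 k.
have sf : smooth W f by move=> n; apply: Ck_coord.
have fE a x : W x -> 'D_a f x = 'D_a F x 0 k.
  by move=> Wx; rewrite -derive_coord//; exact: (patch_diff G Wx).
have ffE a b x : W x -> 'D_a ('D_b f) x = 'D_a ('D_b F) x 0 k.
  move=> Wx; rewrite derive_coord; last exact: smooth_diff (smoothDF b) Wx.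
  apply: near_eq_derive; apply: (near_open oW Wx) => y; exact: fE.
pose l x v := 'D_v ('D_d f) x.
have lE : forall x v, l x v = 'D_v ('D_d f) x by [].
have sDf b : smooth W ('D_b f) by exact: smooth_derive.
have sl v : smooth W (l ^~ v) by exact: smooth_derive (sDf d).
clearbody l.
have l0 : l x0 d != 0 by rewrite lE ffE.
have [r r0 rP] : exists2 r : R, 0 < r & forall x, `|x - x0| < r -> W x /\ l x d != 0.
  have [r1 r10 H1] := open_ball oW Wx0.
  have n0 : 0 < `|l x0 d| by rewrite normr_gt0.
  have [r2 r20 H2] := continuous_ball (smooth_cont (sl d) Wx0) n0.
  exists (Num.min r1 r2); first by rewrite lt_min r10.
  move=> x; rewrite lt_min => /andP[x1 x2]; split; first exact: H1.
  by apply/eqP => E0; have := H2 _ x2; rewrite E0 sub0r normrN ltxx.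
have llin x : W x -> linear (l x : _ -> R^o).
  move=> Wx a u v; have dDf := smooth_diff (sDf d) Wx.
  by rewrite !lE (deriveDv _ _ dDf) (deriveZv _ _ dDf).
have lK0 x u : W x -> Knull x u -> l x u = 0.
  by move=> Wx Ku; rewrite lE ffE// (KnullE _ Ku) mxE.
(* Modulo a null direction [v] is [al *: d], and then [l x v = al * l x d] with [l x d] nonzero. *)
have lK x v : `|x - x0| < r -> l x v = 0 <-> Knull x v.
  move=> xr; have [Wx ld] := rP x xr; split=> [lv|Kv]; last exact: lK0.
  have nd : ~ Knull x d by move=> Kd; move/eqP: ld; apply; exact: lK0.
  have [al Kal] := Knull_codim v Wx nd.
  have := lK0 x _ Wx Kal.
  have -> : v - al *: d = (- al) *: d + v by rewrite scaleNr addrC.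
  rewrite (llin x Wx) lv addr0 => /eqP; rewrite scaler_eq0 oppr_eq0 (negbTE ld) orbF.
  by move=> /eqP al0; rewrite al0 scale0r subr0 in Kal; exact: Kal.
(* The Hessian of [f] vanishes on a hyperplane complementary to [d], hence has rank one; this
   identity expresses it. *)
have sq x v : `|x - x0| < r -> l x d * 'D_v ('D_v f) x = l x v ^+ 2.
  move=> xr; have [Wx ld] := rP x xr.
  have nd : ~ Knull x d by move=> Kd; move/eqP: ld; apply; exact: lK0.
  have [al Kal] := Knull_codim v Wx nd.
  set ka := v - al *: d in Kal.
  have vE : v = al *: d + ka by rewrite addrC subrK.
  clearbody ka.
  have dDf b : differentiable ('D_b f) x by exact: smooth_diff (sDf b) Wx.
  have k1 b : 'D_ka ('D_b f) x = 0.
    by rewrite ffE// (KnullE _ Kal) mxE.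
  have lv : l x v = al * l x d.
    by rewrite vE (llin x Wx) (lK0 x ka Wx Kal) addr0.
  have -> : 'D_v ('D_v f) x = al * 'D_d ('D_v f) x.
    have E1 := deriveDv (al *: d) ka (dDf v).
    rewrite -vE in E1.
    rewrite [X in _ + X](k1 v) addr0 (deriveZv al d (dDf v)) in E1.
    exact: E1.
  have -> : 'D_d ('D_v f) x = al * l x d.
    by rewrite (schwarz d v oW sf Wx) -lE lv.
  by rewrite lv; ring.
have ob : open [set x : 'rV[R]_m | `|x - x0| < r].
  apply: ball_open_set => x xr; exists (r - `|x - x0|); first by rewrite subr_gt0.
  by move=> y yx /=; have := ler_normD (y - x) (x - x0); rewrite subrKA; lra.
have bW : [set x : 'rV[R]_m | `|x - x0| < r] `<=` W by move=> x /rP[].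
exists r, l; split=> //.
- by split=> [v|x /bW]; [exact: smooth_sub (sl v)|exact: llin].
split=> [x /rP[]//|x v xr xvr lxv].
have seg (s : R) : 0 <= s <= 1 -> `|x + s *: v - x0| < r.
  move=> /andP[s0 s1].
  have -> : x + s *: v - x0 = s *: (x + v - x0) + (1 - s) *: (x - x0).
    by apply/rowP => j; rewrite !mxE; ring.
  rewrite (le_lt_trans (ler_normD _ _))// !normrZ !ger0_norm ?subr_ge0//.
  have [->|sn0] := eqVneq s 0; first by rewrite mul0r add0r subr0 mul1r.
  have sp : 0 < s by rewrite lt_neqAle eq_sym sn0.
  have -> : r = s * r + (1 - s) * r by ring.
  by rewrite ltr_leD ?ltr_pM2l// ler_wpM2l ?subr_ge0// ltW.
(* The coefficient of the linear equation: by symmetry of third derivatives the derivative of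
   [l y v] along [v] is that of [l y v ^+ 2 / l y d] along [d], and a factor [l y v] comes out. *)
pose g y := 2 * 'D_d (l ^~ v) y / l y d - l y v * 'D_d (l ^~ d) y / (l y d) ^+ 2.
have sDl b : smooth [set x | `|x - x0| < r] ('D_d (l ^~ b)).
  by apply: smooth_derive; exact: smooth_sub (sl b).
have slr b : smooth [set x | `|x - x0| < r] (l ^~ b) by exact: smooth_sub (sl b).
have cg y : `|y - x0| < r -> {for y, continuous g}.
  move=> yr; have [_ ld] := rP y yr.
  suff H : Ck 0 [set x | `|x - x0| < r] g by exact: H.
  apply: CkBr => //; (apply: CkM => //; last first).
  - by apply: CkV => // [z /rP[]|]//; exact: slr.
  - by apply: CkM => //; [exact: Ck_cstR|exact: sDl].
  - apply: (CkV ob) => [z /rP[_ ldz]|]; first by rewrite expf_neq0.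
    by apply: (CkM ob); exact: slr.
  - by apply: CkM => //; [exact: slr|exact: sDl].
have Dg y : `|y - x0| < r -> 'D_v (l ^~ v) y = l y v * g y.
  move=> yr; have [Wy ld] := rP y yr.
  have -> : 'D_v (l ^~ v) y = 'D_d ('D_v ('D_v f)) y.
    rewrite -(schwarz v d ob (fun n => Ck_sub bW (sDf v n)) yr).
    apply: near_eq_derive; apply: (near_open ob yr) => z zr.
    by rewrite lE; exact: (schwarz v d oW sf (bW _ zr)).
  have -> : 'D_d ('D_v ('D_v f)) y = 'D_d (fun y => l y v ^+ 2 / l y d) y.
    apply: near_eq_derive; apply: (near_open ob yr) => z zr.
    have [_ ldz] := rP z zr.
    by rewrite -(sq z v zr) mulrC mulKf.
  have dlv : differentiable (l ^~ v) y by exact: smooth_diff (slr v) yr.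
  have dld : differentiable (l ^~ d) y by exact: smooth_diff (slr d) yr.
  have D1 := derivableP (diff_derivable (v := d) dlv).
  have D2 := derivableP (diff_derivable (v := d) dld).
  have DV : is_derive y d (fun y => (l y d)^-1) (- (l y d) ^- 2 *: 'D_d (l ^~ d) y).
    apply: DeriveDef; last by rewrite deriveV// ; exact: diff_derivable.
    by apply: derivableV => //; exact: diff_derivable.
  have [_ E0] := is_deriveM (is_deriveX 2 D1) DV.
  rewrite (_ : (fun y => l y v ^+ 2 / l y d) = (l ^~ v) ^+ 2 * (fun y => (l y d)^-1)); last first.
    by apply/funext => z; rewrite !fctE.
  rewrite E0 !fctE /g /= -![_ *: _]/(_ * _) /=.
  by field.
have lz s : 0 <= s <= 1 -> l (x + s *: v) v = 0.
  pose h (s : R) := l (x + s *: v) v.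
  have [C CP] : exists C, forall s, 0 <= s <= 1 -> g (x + s *: v) <= C.
    have cw : {within `[0, 1], continuous (fun s : R => g (x + s *: v))}.
      apply: continuous_in_subspaceT => u; rewrite inE /= in_itv /= => u01.
      apply: (@continuous_comp _ _ _ (fun s : R => x + s *: v) g).
        exact: (Ck_affine 0 x v openT).
      by apply: cg; exact: seg.
    have [c _ cmax] := EVT_max ler01 cw.
    by exists (g (x + c *: v)) => u u01; apply: cmax; rewrite in_itv.
  have hz := @linear_ode_zero R h (fun s => g (x + s *: v)) C.
  apply: hz => [u u01||]; [|exact: CP|].
    rewrite -(Dg _ (seg u u01)).
    apply: is_derive_line; apply: diff_derivable; exact: smooth_diff (slr v) (seg u u01).
  by rewrite /h scale0r addr0.
have Kz s : 0 <= s <= 1 -> Knull (x + s *: v) v.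
  by move=> s01; apply/lK; [exact: seg|exact: lz].
have DaE s a : 0 <= s <= 1 -> 'D_a F (x + s *: v) = 'D_a F x.
  move=> s01; have [s0 s1] := andP s01.
  apply: (@segment_const _ _ _ ('D_a F) x (s *: v)) => u u01; rewrite scalerA.
  have us : 0 <= u * s <= 1 by have [u0 u1] := andP u01; nra.
  have Wus := bW _ (seg _ us).
  have dDa : differentiable ('D_a F) (x + (u * s) *: v) by exact: smooth_diff (smoothDF a) Wus.
  by split=> //; rewrite deriveZv// (KnullE _ (Kz _ us)) scaler0.
have s11 : 0 <= (1 : R) <= 1 by lra.
split.
- by move=> a; rewrite -(DaE 1 a s11) scale1r.
- by have := lz 1 s11; rewrite scale1r.
have dF y : W y -> differentiable F y by move=> Wy; exact: (patch_diff G Wy).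
have dl y : differentiable (fun y : 'rV[R]_m => y *m jac F x) y.
  by apply: differentiable_mulmx; [exact: ex_diff|exact: differentiable_cst].
(* With the Jacobian constant on the segment, [F] minus its linear part is constant there, so the
   image of the segment is straight. *)
have : (fun y => F y - y *m jac F x) (x + v) = (fun y => F y - y *m jac F x) x.
  apply: (@segment_const _ _ _ (fun y => F y - y *m jac F x) x v) => s s01.
  have Ws := bW _ (seg s s01); split.
    by apply: differentiableB; [exact: dF|exact: dl].
  have -> : 'D_v (fun y => F y - y *m jac F x) (x + s *: v) =
     'D_v F (x + s *: v) - 'D_v (fun y => y *m jac F x) (x + s *: v).
    by apply: deriveB; apply: diff_derivable; [exact: dF|exact: dl].
  rewrite derive_mulmxr; last exact: ex_diff.
  rewrite (@derive_id _ _ (x + s *: v) v) DaE// -deriveJ ?subrr//.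
  by apply: dF; exact: bW.
rewrite /= mulmxDl (deriveJ v (dF x (bW _ xr))).
move: (F (x + v)) (F x) (x *m jac F x) (v *m jac F x); clear.
by move=> A B X Y /eqP; rewrite subr_eq addrA subrK => /eqP.
Qed.

End RankOneGraph.

(** * The second fundamental form along the curve *)

Section Schwarz_rV.
Variables (R : realType).

Lemma schwarz_rV k p (f : 'rV[R]_k -> 'rV[R]_p) (O : set 'rV[R]_k) x a b :
  open O -> smooth O f -> O x -> 'D_a ('D_b f) x = 'D_b ('D_a f) x.
Proof.
move=> oO sf Ox; apply/rowP => j.
have sj : smooth O (fun x => f x 0 j) by move=> n; apply: Ck_coord.
have E u v : 'D_u ('D_v f) x 0 j = 'D_u ('D_v (fun x => f x 0 j)) x.
  rewrite derive_coord; last exact: smooth_diff (smooth_derive v sf) Ox.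
  apply: near_eq_derive; apply: (near_open oO Ox) => y Oy.
  by rewrite derive_coord//; exact: smooth_diff sf Oy.
apply: (etrans (E a b)); apply: (etrans (schwarz a b oO sj Ox)).
exact: (esym (E b a)).
Qed.

Lemma differentiable_const (V W : normedModType R) (a : W) (x : V) : differentiable (fun _ : V => a) x.
Proof. exact: differentiable_cst. Qed.

Lemma derive1_fun (W : normedModType R) (f : R -> W) : derive1 f = 'D_1 f.
Proof. by apply/funext => t; rewrite derive1E. Qed.

Lemma smooth_derive1 (W : normedModType R) (f : R -> W) O : smooth O f -> smooth O (derive1 f).
Proof. by rewrite derive1_fun; exact: smooth_derive. Qed.

Lemma derive1_comp_rV k p (f : 'rV[R]_k -> 'rV[R]_p) (x : R -> 'rV[R]_k) t :
  differentiable x t -> differentiable f (x t) ->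
  derive1 (fun s => f (x s)) t = 'D_(derive1 x t) f (x t).
Proof. by move=> dx df; rewrite !derive1E (derive_comp (1 : R) dx df). Qed.

Lemma linear_form_mx k (f : 'rV[R]_k -> R) : linear (f : _ -> R^o) ->
  exists C : 'M[R]_(k, 1), forall v, f v = (v *m C) 0 0.
Proof.
move=> lf; exists (\col_i f (delta_mx 0 i)) => v.
pose fM := GRing.isLinear.Build _ _ _ _ _ lf.
pose fL : {linear _ -> _} := HB.pack (f : _ -> R^o) fM.
rewrite mxE [X in f X]row_sum_delta -[f]/(fL : _ -> _) linear_sum.
by apply: eq_bigr => i _; rewrite linearZ /= !mxE.
Qed.

Lemma finite_smooth (W : normedModType R) (e : nat -> R -> W) m t0 :
  (forall i, (i < m)%N -> smooth_on [set t0] (e i)) ->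
  exists2 r : R, 0 < r & forall i, (i < m)%N -> smooth [set t | `|t - t0| < r] (e i).
Proof.
elim: m => [|m IH] H; first by exists 1.
have [r r0 Hr] := IH (fun i im => H i (ltnW im)).
have [ O [oO O0 sO]] := smooth_on_R (H m (ltnSn m)).
have [r' r'0 Hr'] := open_ballR oO (O0 t0 erefl).
exists (Num.min r r'); first by rewrite lt_min r0.
move=> i; rewrite ltnS leq_eqVlt => /orP[/eqP ->|im].
  by apply: smooth_sub sO => t /=; rewrite lt_min => /andP[_]; exact: Hr'.
by apply: smooth_sub (Hr i im) => t /=; rewrite lt_min => /andP[].
Qed.

Lemma open_ball_set (V : normedModType R) (t0 : V) r : open [set t | `|t - t0| < r].
Proof.
apply: ball_open_set => x xr; exists (r - `|x - t0|); first by rewrite subr_gt0.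
by move=> y yx /=; have := ler_normD (y - x) (x - t0); rewrite subrKA; move: xr yx => /=; lra.
Qed.

Lemma open_ball_setR (t0 r : R) : open [set t | `|t - t0| < r].
Proof. exact: (@open_ball_set R^o t0 r). Qed.

Lemma smooth_gram N m (A : R -> 'M[R]_(m, N)) O t0 : open O -> smooth O A -> O t0 ->
  gram_unit (A t0) -> exists2 r : R, 0 < r & forall t, `|t - t0| < r -> O t /\ gram_unit (A t).
Proof.
move=> oO sA Ot u.
have sd : smooth O (fun t => \det (A t *m (A t)^T)).
  by move=> n; apply: Ck_det => //; apply: Ck_mulmx => //; exact: Ck_trmx.
have d0 : \det (A t0 *m (A t0)^T) != 0 by rewrite -unitfE -unitmxE.
have n0 : 0 < `|\det (A t0 *m (A t0)^T)| by rewrite normr_gt0.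
have /cvgrPdist_lt/(_ _ n0) := smooth_cont sd Ot.
move=> /nbhs_ballR[r1 r10 H1]; have [r2 r20 H2] := open_ballR oO Ot.
exists (Num.min r1 r2); first by rewrite lt_min r10.
move=> t; rewrite lt_min => /andP[t1 t2]; split; first exact: H2.
rewrite /gram_unit unitmxE unitfE; apply/eqP => E0.
by have := H1 t t1; rewrite /= E0 subr0 ltxx.
Qed.

End Schwarz_rV.

Arguments open_ball_setR : clear implicits.

Record cauchy_data (R : realType) (N m : nat) (I : set R) (gamma : R -> 'rV[R]_N)
    (D : R -> {vspace 'rV[R]_N}) : Prop := CauchyData {
  cd_itv : is_interval I;
  cd_nondeg : I° !=set0;
  cd_emb : smooth_embedding I gamma;
  cd_dist : smooth_distribution m I D;
  cd_tan : forall t, I t -> derive1 gamma t \in D t;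
  cd_curv : forall t, I t -> perp_proj [set` D t] (derive1n 2 gamma t) != 0 }.

Lemma sgn_close (R : realDomainType) (a c : R) : `|a - c| < `|c| -> 0 < c * a.
Proof.
case: (ltgtP c 0) => [cn|cp|->]; last by rewrite normr0 ltNge normr_ge0.
  by rewrite (ltr0_norm cn) ltr_norml => /andP[h1 h2]; rewrite nmulr_rgt0//; lra.
by rewrite (gtr0_norm cp) ltr_norml => /andP[h1 h2]; rewrite pmulr_rgt0//; lra.
Qed.

Section Data.
Variables (R : realType) (N m : nat).
Local Notation E := 'rV[R]_N.
Variables (I : set R) (gamma : R -> E) (D : R -> {vspace E}).
Hypothesis H : cauchy_data m I gamma D.

Let Ieq (W : normedModType R) (f g : R -> W) t := @derive1_eq_on R I (cd_itv H) (cd_nondeg H) W f g t.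

Lemma gamma_smooth : exists O, [/\ open O, I `<=` O & smooth O gamma].
Proof. by have [s _ _] := cd_emb H; exact: smooth_on_R s. Qed.

(** Smoothness and independence of the rows hold on a full ball around [t0], by continuity of the
    Gram determinant, even when [t0] is an endpoint; only at points of [I] do the rows relate to
    [D]. *)
Lemma local_frame t0 : I t0 -> exists (A : R -> 'M[R]_(m, N)) (r : R), [/\ 0 < r,
  smooth [set t | `|t - t0| < r] A, (forall t, `|t - t0| < r -> gram_unit (A t)) &
  forall t, `|t - t0| < r -> I t -> [set` D t] = rowsp (A t)].
Proof.
move=> It0; have [dimD /(_ t0 It0)[e [se eD]]] := cd_dist H.
have [r1 r10 s1] := finite_smooth se.
have [r2 r20 H2] := nbhs_ballR eD.
pose A t : 'M[R]_(m, N) := \matrix_(i < m) e i t.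
have oB := open_ball_setR _ t0 r1.
have sA : smooth [set t | `|t - t0| < r1] A.
  move=> n; apply: Ck_mx_of => // i j.
  apply: (@Ck_ext _ _ _ _ n oB (fun t => e i t 0 j)); first by move=> t _; rewrite mxE.
  by apply: Ck_coord => //; exact: s1.
have DA t : `|t - t0| < r2 -> I t -> [set` D t] = rowsp (A t).
  move=> tr It; rewrite (H2 t tr It); apply/seteqP; split=> v.
    by move=> /span_rows.
  by move=> vA; apply/(span_rows m (fun i => e i t)).
have t00 r : 0 < r -> `|t0 - t0| < r by rewrite subrr normr0.
have u0 : gram_unit (A t0) by apply/(dim_rowsp (DA t0 (t00 _ r20) It0)); exact: dimD.
have [r3 r30 H3] := smooth_gram oB sA (t00 _ r10) u0.
exists A, (Num.min r2 r3); split.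
- by rewrite lt_min r20.
- by apply: smooth_sub sA => t /=; rewrite lt_min => /andP[_ /H3[]].
- by move=> t; rewrite lt_min => /andP[_ /H3[]].
- by move=> t; rewrite lt_min => /andP[tr _]; exact: DA.
Qed.

(** Differentiating the vanishing product of a normal section with a section [Y] of [D] moves the
    derivative from one to the other. The resulting pairing formula determines [rho] without
    reference to the extension and replaces its definition by choice from here on. *)
Lemma rho_spec t nu : I t -> orth [set` D t] nu ->
  rho I D t nu \in D t /\ forall Y : R -> E, differentiable Y t ->
    (\forall u \near t, I u -> Y u \in D u) ->
    dot (rho I D t nu) (Y t) = - dot nu (derive1 Y t).
Proof.
move=> It nuD; rewrite /rho; set S := [set _ | _].
suff : exists w, S w.
  move=> /(xgetPex 0)[s [ss sD st ->]]; split; first exact: proj_in.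
  move=> Y dY YD; have Yt : Y t \in D t by apply: (nbhs_singleton YD).
  rewrite dot_proj//.
  have [ O [oO Ot sO]] := smooth_on_R ss.
  have ds : differentiable s t by apply: smooth_diff sO _; exact: Ot.
  have : derive1 (fun u => dot (s u) (Y u)) t = derive1 (cst 0) t.
    apply: Ieq; [by []|exact: differentiable_dot|exact: differentiable_const|].
    by move: sD YD; apply: filterS2 => u su Yu Iu; apply: su => //; exact: Yu.
  rewrite derive1_cst derive1E derive_dot// -!derive1E st => /eqP.
  by rewrite addr_eq0 => /eqP.
have [A [r [r0 sA uA DA]]] := local_frame It.
pose B := [set u : R | `|u - t| < r].
have oB : open B := open_ball_setR _ t r.
have Bt : B t by rewrite /B /= subrr normr0.
(* Removing from the constant [nu] its projection onto the moving row space is an admissible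
   extension, so the choice in [rho] is made from a nonempty set. *)
exists (proj [set` D t] (derive1 (fun u => nu - gproj (A u) nu) t)).
exists (fun u => nu - gproj (A u) nu); split=> //.
- apply: (smooth_smooth_on oB); first by move=> _ ->.
  move=> n; apply: CkB => //; first exact: Ck_cst.
  apply: (Ck_mulmx oB); last exact: sA.
  apply: (Ck_mulmx oB).
    by apply: (Ck_mulmx oB); [exact: Ck_cst|apply: (Ck_trmx oB); exact: sA].
  apply: (Ck_invmx oB); first by move=> u /uA.
  by apply: (Ck_mulmx oB); [exact: sA|apply: (Ck_trmx oB); exact: sA].
- apply: (near_open oB Bt) => u Bu Iu; rewrite (DA u Bu Iu) => w [z ->].
  exact: gproj_orth (uA u Bu).
- by rewrite -(proj_gram _ (DA t Bt It) (uA t Bt)) proj_eq0 ?subr0.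
Qed.

Lemma section_through t w : I t -> w \in D t -> exists Y : R -> E,
  [/\ differentiable Y t, (\forall u \near t, I u -> Y u \in D u) & Y t = w].
Proof.
move=> It wD; have [A [r [r0 sA uA DA]]] := local_frame It.
pose B := [set u : R | `|u - t| < r].
have oB : open B := open_ball_setR _ t r.
have Bt : B t by rewrite /B /= subrr normr0.
have : [set` D t] w by []. rewrite (DA t Bt It) => -[z ->].
exists (fun u => z *m A u); split=> //.
  by apply: differentiable_mulmx; [exact: differentiable_const|exact: smooth_diff sA Bt].
apply: (near_open oB Bt) => u Bu Iu.
have -> : (z *m A u \in D u) = [set` D u] (z *m A u) :> Prop by [].
by rewrite (DA u Bu Iu); exists z.
Qed.

Lemma orth_lin t a nu mu : orth [set` D t] nu -> orth [set` D t] mu ->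
  orth [set` D t] (a *: nu + mu).
Proof. by move=> n1 m1 w wD; rewrite dotDl dotZl n1// m1// mulr0 addr0. Qed.

(** The pairing formula is linear in the normal vector; applied to a section through the difference
    of the two sides it makes the squared length of that difference vanish. *)
Lemma rho_lin t a nu mu : I t -> orth [set` D t] nu -> orth [set` D t] mu ->
  rho I D t (a *: nu + mu) = a *: rho I D t nu + rho I D t mu.
Proof.
move=> It n1 m1; have [p1 q1] := rho_spec It n1; have [p2 q2] := rho_spec It m1.
have [p3 q3] := rho_spec It (orth_lin a n1 m1).
set z := rho I D t (a *: nu + mu) - (a *: rho I D t nu + rho I D t mu).
have zD : z \in D t by apply: memvB => //; apply: memvD => //; exact: memvZ.
have [Y [dY YD Yt]] := section_through It zD.
suff : dot z z = 0 by move/dot_eq0/eqP; rewrite subr_eq0 => /eqP.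
rewrite -{2}Yt /z dotBl dotDl dotZl q1// q2// q3// dotDl dotZl.
ring.
Qed.

(** A distinguished vector of the image of [rho]. Its product with the velocity is minus the squared
    length of the normal part of the acceleration, so it is nonzero and, under the rank condition,
    spans the image. *)
Definition rho_curv t := rho I D t (perp_proj [set` D t] (derive1n 2 gamma t)).

Lemma perp_orth' t v : orth [set` D t] (perp_proj [set` D t] v).
Proof. by move=> w wD; exact: perp_orth. Qed.

Lemma dot_rho_gamma t nu : I t -> orth [set` D t] nu ->
  dot (rho I D t nu) (derive1 gamma t) = - dot nu (derive1n 2 gamma t).
Proof.
move=> It nuD; have [_ q] := rho_spec It nuD.
have [ O [oO IO sO]] := gamma_smooth.
rewrite q; first by rewrite derive1nS derive1n1.
  by apply: smooth_diff (smooth_derive1 sO) _; exact: IO.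
by apply: (near_open openT Logic.I) => u _ Iu; exact: (cd_tan H).
Qed.

Lemma rho_curv_spec t : I t -> rho_curv t \in D t /\ dot (rho_curv t) (derive1 gamma t) < 0.
Proof.
move=> It; have po := perp_orth' (t := t) (derive1n 2 gamma t).
split; first by have [] := rho_spec It po.
rewrite /rho_curv dot_rho_gamma// oppr_lt0.
set nu := perp_proj _ _.
have -> : dot nu (derive1n 2 gamma t) = dot nu nu.
  rewrite -{1}(subrK (proj [set` D t] (derive1n 2 gamma t)) (derive1n 2 gamma t)).
  by rewrite dotDr -/(perp_proj _ _) (po _ (proj_in _ _)) addr0.
rewrite lt_neqAle dot_ge0 andbT eq_sym; apply/eqP => /dot_eq0 E0.
by move/eqP: (cd_curv H It); rewrite -/nu.
Qed.

Lemma rank_rhoP t : I t -> has_dim (im_rho I D t) 1%N <->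
  (forall nu, orth [set` D t] nu -> exists c, rho I D t nu = c *: rho_curv t).
Proof.
move=> It; have [wD wg] := rho_curv_spec It.
have w0 : rho_curv t != 0.
  by apply: contraTneq wg => ->; rewrite dot0l ltxx.
have imw : im_rho I D t (rho_curv t).
  by exists (perp_proj [set` D t] (derive1n 2 gamma t)) => //; exact: perp_orth'.
split=> [[U [dU UE]] nu nuD|Hc].
  have inU z : im_rho I D t z -> z \in U by rewrite UE.
  have wU := inU _ imw.
  have : (<[rho_curv t]> == U)%VS.
    by rewrite eqEdim -memvE wU dU dim_vline w0.
  move=> /eqP EU; have : rho I D t nu \in U by apply: inU; exists nu.
  by rewrite -EU => /vlineP.
exists <[rho_curv t]>%VS; split; first by rewrite dim_vline w0.
apply/seteqP; split=> [z [nu nuD <-]|z /vlineP[c ->]].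
  by apply/vlineP; exact: Hc.
exists (c *: perp_proj [set` D t] (derive1n 2 gamma t) + 0).
  by apply: orth_lin; [exact: perp_orth'|move=> w _; rewrite dot0l].
have o0 : orth [set` D t] (0 : E) by move=> w _; rewrite dot0l.
rewrite rho_lin//; last exact: perp_orth'.
have -> : rho I D t 0 = 0.
  have := rho_lin 0 It o0 o0; rewrite !scale0r !add0r.
  have := rho_lin 1 It o0 o0; rewrite !scale1r addr0.
  by move=> E0 _; apply: (addrI (rho I D t 0)); rewrite -E0 addr0.
by rewrite addr0.
Qed.

Definition ruling t : set E := [set v | v \in D t /\ orth (im_rho I D t) v].

Lemma rulingP t v : I t -> has_dim (im_rho I D t) 1%N ->
  ruling t v <-> v \in D t /\ dot v (rho_curv t) = 0.
Proof.
move=> It /(rank_rhoP It) Hc; split=> -[vD vo]; split=> //.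
  by apply: vo; exists (perp_proj [set` D t] (derive1n 2 gamma t)) => //; exact: perp_orth'.
by move=> _ [nu nuD <-]; have [c ->] := Hc nu nuD; rewrite dotZr vo mulr0.
Qed.

End Data.

(** * A given solution in a graph patch around the curve *)

Section Solution.
Variables (R : realType) (N m : nat).
Local Notation E := 'rV[R]_N.
Variables (I : set R) (gamma : R -> E) (D : R -> {vspace E}).
Hypothesis H : cauchy_data m I gamma D.
Variables (M : set E).
Hypothesis (m0 : (0 < m)%N) (sol : is_solution m I gamma D M).

Let Ieq (W : normedModType R) (f g : R -> W) t := @derive1_eq_on R I (cd_itv H) (cd_nondeg H) W f g t.

(** Off [I] the smooth extension of [gamma] need not lie on [M]; only its projection is kept inside
    [W] there, which suffices for differentiating at an endpoint. *)
Lemma solution_patch t0 : I t0 -> exists (L : 'M[R]_(N, m)) W F U (r : R), [/\ graph_patch M L W F U, 0 < r &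
  exists2 O : set R, open O /\ smooth O gamma &
  forall t, `|t - t0| < r -> [/\ O t, W (gamma t *m L) & I t -> F (gamma t *m L) = gamma t]].
Proof.
move=> It0; have [eM _ gM _] := sol.
have Mg t : I t -> M (gamma t) by move=> It; apply: gM; exists t.
have [L [W [F [U [G Ug]]]]] := graph_exists eM (Mg _ It0).
have [ O [oO IO sO]] := gamma_smooth H.
have cg : {for t0, continuous gamma} by apply: smooth_cont sO _; exact: IO.
have [W0 _] := patch_out G (Mg _ It0) Ug.
have oU : open U by case: G.
have n1 : \forall t \near t0, U (gamma t) by apply: cg; exact: open_nbhs_nbhs.
have cgL : {for t0, continuous (fun t => gamma t *m L)}.
  by apply: smooth_cont (smooth_mulmxr L oO sO) _; exact: IO.
have n2 : \forall t \near t0, W (gamma t *m L).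
  by apply: cgL; apply: open_nbhs_nbhs; split=> //; exact: patch_open G.
have n3 : \forall t \near t0, O t by apply: open_nbhs_nbhs; split=> //; exact: IO.
have n : \forall t \near t0, [/\ O t, W (gamma t *m L) & U (gamma t)].
  by near=> t; split; near: t.
have [r r0 Hr] := nbhs_ballR n.
exists L, W, F, U, r; split=> //; exists O => // t /Hr[Ot Wt Ut]; split=> // It.
by have [_ ->] := patch_out G (Mg _ It) Ut.
Unshelve. all: by end_near. Qed.

Section curve2.
Variables (L : 'M[R]_(N, m)) (W : set 'rV[R]_m) (F : 'rV[R]_m -> E) (U : set E) (t0 r : R) (O : set R).
Hypotheses (G : graph_patch M L W F U) (r0 : 0 < r) (oO : open O) (sO : smooth O gamma).
Hypothesis (near0 : forall t, `|t - t0| < r ->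
  [/\ O t, W (gamma t *m L) & I t -> F (gamma t *m L) = gamma t]).
Variable t : R.
Hypotheses (It : I t) (tr : `|t - t0| < r).

Let x (t : R) := gamma t *m L.
Let d := derive1 gamma t *m L.
Let Wx : W (x t). Proof. by have [] := near0 tr. Qed.
Let Fx : F (x t) = gamma t. Proof. by have [_ _] := near0 tr; apply. Qed.
Let Ot : O t. Proof. by have [] := near0 tr. Qed.
Let dg : differentiable gamma t := smooth_diff sO Ot.
Let dx : differentiable x t := smooth_diff (smooth_mulmxr L oO sO) Ot.
Let x'E : derive1 x t = d.
Proof. by rewrite /x /d !derive1E; exact: derive_mulmxr. Qed.
Let sF : smooth W F := patch_smooth G.
Let oW : open W := patch_open G.

Lemma curve_derive s : I s -> `|s - t0| < r ->
  derive1 gamma s = 'D_(derive1 gamma s *m L) F (gamma s *m L).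
Proof.
move=> Is sr; have [Os Ws _] := near0 sr.
have dgs : differentiable gamma s := smooth_diff sO Os.
have dxs : differentiable (fun s => gamma s *m L) s := smooth_diff (smooth_mulmxr L oO sO) Os.
have -> : derive1 gamma s *m L = derive1 (fun s => gamma s *m L) s.
  by rewrite !derive1E derive_mulmxr.
have dFs := patch_diff G Ws.
rewrite -(derive1_comp_rV (x := fun s => gamma s *m L) dxs dFs).
apply: Ieq => //; first exact: (differentiable_comp' dxs dFs).
apply: (near_open (open_ball_setR _ t0 r) sr) => u ur Iu.
by have [_ _ /(_ Iu)] := near0 ur.
Qed.

Lemma tangent_curve v : v \in D t <-> exists b, v = 'D_b F (x t).
Proof.
have [_ _ _ /(_ t It) TE] := sol; rewrite -(tangent_patchP G v Wx) Fx TE.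
by [].
Qed.

(** Along the curve the velocity is its coordinate vector times [jac F]. If this second derivative
    vanished, the acceleration would reduce to a coordinate vector times [jac F], hence be tangent,
    against the curvature assumption. *)
Lemma curve_curv : 'D_d ('D_d F) (x t) != 0.
Proof.
apply/eqP => E0; move/eqP: (cd_curv H It); apply; apply/perp_proj_eq0.
rewrite derive1nS derive1n1.
have dJ : differentiable (jac F) (x t) by exact: smooth_diff (smooth_jac oW sF) Wx.
have dJx : differentiable (fun s => jac F (x s)) t by exact: differentiable_comp' dx dJ.
have dg' : differentiable (derive1 gamma) t by exact: smooth_diff (smooth_derive1 sO) Ot.
have dgL : differentiable (fun s => derive1 gamma s *m L) t.
  by apply: differentiable_mulmx => //; exact: differentiable_const.
have -> : derive1 (derive1 gamma) t = derive1 (fun s => (derive1 gamma s *m L) *m jac F (x s)) t.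
  apply: Ieq => //; first exact: differentiable_mulmx.
  apply: (near_open (open_ball_setR _ t0 r) tr) => s sr Is.
  have [_ Ws _] := near0 sr.
  exact: (etrans (curve_derive Is sr) (deriveJ _ (patch_diff G Ws))).
rewrite derive1E derive_mulmx//.
have -> : (derive1 gamma t *m L) *m 'D_1 (fun s => jac F (x s)) t = 0.
  rewrite (derive_comp (1 : R) dx dJ) -derive1E x'E -/d -derive_mulmxl// -[RHS]E0.
  apply: near_eq_derive; apply: (near_open oW Wx) => y Wy.
  by rewrite deriveJ//; exact: (patch_diff G Wy).
rewrite addr0 -deriveJ; last exact: (patch_diff G Wx).
by apply/tangent_curve; eexists.
Qed.

(** The field ['D_b F] along the curve is a section of [D], and its derivative at [t] is
    ['D_b ('D_d F)] by symmetry, which is 0 for null [b]; the pairing formula concludes. *)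
Lemma rho_null nu b : orth [set` D t] nu -> Knull F (x t) b ->
  dot (rho I D t nu) ('D_b F (x t)) = 0.
Proof.
move=> nuD Kb; have [_ q] := rho_spec H It nuD.
have dDb : differentiable ('D_b F) (x t) by exact: smooth_diff (smooth_derive b sF) Wx.
have := q (fun s => 'D_b F (x s)) (differentiable_comp' dx dDb).
move=> ->.
  rewrite (derive1_comp_rV (f := 'D_b F) dx dDb) x'E (schwarz_rV d b oW sF Wx) (KnullE _ Kb).
  by rewrite dot0r oppr0.
apply: (near_open (open_ball_setR _ t0 r) tr) => s sr Is.
have [_ Ws /(_ Is) Fs] := near0 sr.
have [_ _ _ /(_ s Is) TE] := sol.
have -> : ('D_b F (x s) \in D s) = [set` D s] ('D_b F (x s)) :> Prop by [].
by rewrite -TE -Fs; apply/(tangent_patchP G _ Ws); exists b.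
Qed.

Lemma rho_curv_null b : Knull F (x t) b -> dot (rho_curv I gamma D t) ('D_b F (x t)) = 0.
Proof. by apply: rho_null; exact: perp_orth'. Qed.

Let nKd : ~ Knull F (x t) d.
Proof. by move=> /(KnullE d) E0; move/eqP: curve_curv; apply. Qed.

Lemma null_decomp a : exists al, Knull F (x t) (a - al *: d).
Proof. by have [_ rk _ _] := sol; exact: (Knull_codim G m0 rk). Qed.

(** The image of [rho] is orthogonal to the null hyperplane of [D t], and this hyperplane together
    with the velocity spans [D t]. A vector of the image is thus determined by its product with the
    velocity. *)
Lemma solution_rank : has_dim (im_rho I D t) 1%N.
Proof.
apply/(rank_rhoP H It) => nu nuD.
have [wD wg] := rho_curv_spec H It.
set w := rho_curv I gamma D t in wD wg *.
have wg0 : dot w (derive1 gamma t) != 0 by rewrite lt_eqF.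
have [zD _] := rho_spec H It nuD.
(* The coefficient for which the difference [z] becomes orthogonal to the velocity as well. *)
exists (dot (rho I D t nu) (derive1 gamma t) / dot w (derive1 gamma t)).
apply/eqP; rewrite -subr_eq0; apply/eqP; apply: dot_eq0.
set c := _ / _; set z := _ - _.
have zz : z \in D t by apply: memvB => //; exact: memvZ.
have /tangent_curve[a za] := zz.
have [al Ka] := null_decomp a.
have zg : dot z (derive1 gamma t) = 0 by rewrite /z dotBl dotZl /c divfK ?subrr.
have zk : dot z ('D_(a - al *: d) F (x t)) = 0.
  by rewrite /z dotBl dotZl rho_null// rho_curv_null// mulr0 subrr.
have dFx := patch_diff G Wx.
have zE : z = al *: derive1 gamma t + 'D_(a - al *: d) F (x t).
  rewrite za (curve_derive It tr) -/d -(deriveZv _ _ dFx) -(deriveDv _ _ dFx).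
  by rewrite addrC subrK.
by rewrite {2}zE dotDr dotZr zg zk mulr0 addr0.
Qed.

(** Null vectors are orthogonal to [rho_curv] and the velocity is not, so the component of a ruling
    vector along the velocity must vanish. *)
Lemma ruling_null v : ruling I D t v <-> exists b, Knull F (x t) b /\ v = 'D_b F (x t).
Proof.
rewrite (rulingP H _ It solution_rank); split=> [[/tangent_curve[a vE] vo]|[b [Kb ->]]]; last first.
  split; first by apply/tangent_curve; exists b.
  by rewrite dotC rho_curv_null.
have [al Ka] := null_decomp a.
have [_ wg] := rho_curv_spec H It.
have dFx := patch_diff G Wx.
have vE' : v = al *: derive1 gamma t + 'D_(a - al *: d) F (x t).
  rewrite vE (curve_derive It tr) -/d -(deriveZv _ _ dFx) -(deriveDv _ _ dFx).
  by rewrite addrC subrK.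
have : al = 0.
  move: vo; rewrite vE' dotDl dotZl dotC addrC dotC rho_curv_null// add0r.
  by move=> /eqP; rewrite mulf_eq0 (lt_eqF wg) orbF => /eqP.
move=> al0; exists a; split=> //.
by rewrite al0 scale0r subr0 in Ka.
Qed.

End curve2.

Lemma fst_cont (V W T : normedModType R) (f : V -> T) (p : V * W) :
  {for p.1, continuous f} -> {for p, continuous (fun p : V * W => f p.1)}.
Proof. by move=> cf; apply: (@continuous_comp _ _ _ fst f) => //; exact: cvg_fst. Qed.

Lemma snd_cont (V W T : normedModType R) (f : W -> T) (p : V * W) :
  {for p.2, continuous f} -> {for p, continuous (fun p : V * W => f p.2)}.
Proof. by move=> cf; apply: (@continuous_comp _ _ _ snd f) => //; exact: cvg_snd. Qed.

Lemma linear_form_sum (f : 'rV[R]_m -> R) v : linear (f : _ -> R^o) ->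
  f v = \sum_i v 0 i * f (delta_mx 0 i).
Proof.
move=> /linear_form_mx[C CE]; rewrite CE mxE; apply: eq_bigr => i _.
by rewrite CE -rowE mxE.
Qed.

Lemma linear_formB (f : 'rV[R]_m -> R) u v : linear (f : _ -> R^o) ->
  f (u - v) = f u - f v.
Proof. by move=> /linear_form_mx[C CE]; rewrite !CE mulmxBl !mxE. Qed.

Lemma linear_formN (f : 'rV[R]_m -> R) v : linear (f : _ -> R^o) -> f (- v) = - f v.
Proof. by move=> /linear_form_mx[C CE]; rewrite !CE mulNmx !mxE. Qed.

End Solution.

(** * Uniqueness and the ruled strip *)

Lemma dist_gt0 (R : realDomainType) (a b : R) : `|a - b| < b -> 0 < a.
Proof. by rewrite ltr_norml => /andP[]; lra. Qed.

Section NullForms.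
Variables (R : realType) (m : nat).
Local Notation V := 'rV[R]_m.
Variables (l : V -> V -> R) (x0 : V) (r : R).
Hypothesis ll : forall y, `|y - x0| < r -> linear (l y : _ -> R^o).
Hypothesis cl : forall v y, `|y - x0| < r -> {for y, continuous (fun y => l y v)}.

Lemma cont_sum (T : normedModType R) k (f : 'I_k -> T -> R) (p : T) :
  (forall i, {for p, continuous (f i)}) -> {for p, continuous (fun p => \sum_i f i p)}.
Proof.
move=> cf; elim: (index_enum _) => [|i sq IH].
  have -> : (fun p => \sum_(i <- [::]) f i p) = cst 0.
    by apply/funext => q; rewrite big_nil.
  exact: cst_continuous.
have -> : (fun p => \sum_(j <- i :: sq) f j p) = (fun p => f i p + \sum_(j <- sq) f j p).
  by apply/funext => q; rewrite big_cons.
by apply: continuousD.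
Qed.

Lemma cont_coord (T : topologicalType) (f : T -> V) t i :
  {for t, continuous f} -> {for t, continuous (fun t => f t 0 i)}.
Proof. by move=> cf; apply: (@continuous_comp _ _ _ f (fun v : V => v 0 i)) => //; exact: coord_continuous. Qed.

(** Expanding the second argument in the standard basis reduces joint continuity to continuity in
    the base point. *)
Lemma form_cont (T : normedModType R) (y v : T -> V) (t : T) : `|y t - x0| < r ->
  {for t, continuous y} -> {for t, continuous v} ->
  {for t, continuous (fun t => l (y t) (v t))}.
Proof.
move=> yr cy cv; have E0 : \forall s \near t,
    \sum_i v s 0 i * l (y s) (delta_mx 0 i) = l (y s) (v s).
  have n : \forall s \near t, `|y s - x0| < r.
    apply: (cy [set z | `|z - x0| < r]); apply: open_nbhs_nbhs.
    by split; [exact: open_ball_set|].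
  by apply: filterS n => s ys; rewrite (linear_form_sum (v s) (ll ys)).
apply: near_eq_continuous E0 _; apply: cont_sum => i; apply: continuousM.
  exact: cont_coord.
by apply: (@continuous_comp _ _ _ y (fun y => l y (delta_mx 0 i))) => //; exact: cl.
Qed.

Variables (x : R -> V) (t0 rh : R).
Hypothesis cx : forall s, `|s - t0| < rh -> {for s, continuous x}.
Hypothesis mono : forall y s1 s2, `|y - x0| < r -> `|s1 - t0| < rh -> `|s2 - t0| < rh ->
  s1 < s2 -> 0 < l y (x s2 - x s1).

(** At [x1 = x t + b] with [b] in the kernel, the form applied to [x s - x1] is negative at [t - dl]
    and positive at [t + dl] by monotonicity. Both signs persist for [y] near [x1], and in between
    the kernel hyperplane through [y] meets the curve. *)
Lemma null_line_meets t b dl : 0 < dl -> (forall s, `|s - t| <= dl -> `|s - t0| < rh) ->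
  `|x t + b - x0| < r -> l (x t + b) b = 0 ->
  exists2 eta : R, 0 < eta & forall y, `|y - (x t + b)| < eta ->
    `|y - x0| < r /\ exists s, `|s - t| <= dl /\ l y (x s - y) = 0.
Proof.
move=> dl0 dlP; set x1 := x t + b => x1r lx1.
have dp : `|t + dl - t| <= dl by rewrite addrAC subrr add0r gtr0_norm.
have dm : `|t - dl - t| <= dl by rewrite addrAC subrr add0r normrN gtr0_norm.
have th : `|t - t0| < rh by apply: dlP; rewrite subrr normr0 ltW.
have lB u v y : `|y - x0| < r -> l y (u - v) = l y u - l y v.
  by move=> /ll yr; rewrite (linear_formB u v yr).
have p0 : 0 < l x1 (x (t + dl) - x1).
  have := mono x1r th (dlP _ dp); rewrite ltrDl => /(_ dl0).
  by rewrite {2 3}/x1 opprD addrA [X in _ -> 0 < X]lB// lx1 subr0.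
have q0 : 0 < - l x1 (x (t - dl) - x1).
  have := mono x1r (dlP _ dm) th; rewrite gtrDl oppr_lt0 => /(_ dl0).
  rewrite {2 3}/x1 opprD addrA [X in _ -> 0 < - X]lB// lx1 subr0.
  by rewrite -[x t - _]opprB (linear_formN _ (ll x1r)).
have cpsi s : {for x1, continuous (fun y => l y (x s - y))}.
  apply: (@form_cont V id (fun y => x s - y)) => //.
  by apply: continuousB; [exact: cst_continuous|].
have [e2 e20 H2] := continuous_ball (cpsi (t + dl)) p0.
have [e3 e30 H3] := continuous_ball (cpsi (t - dl)) q0.
have e5 : 0 < r - `|x1 - x0| by rewrite subr_gt0.
exists (Num.min (Num.min e2 e3) (r - `|x1 - x0|)); first by rewrite !lt_min e20 e30.
move=> y; rewrite !lt_min => /andP[/andP[y2 y3] y5].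
have yr : `|y - x0| < r.
  by rewrite (le_lt_trans (ler_distD x1 y x0))// -ltrBrDr.
split=> //.
have hp : 0 < l y (x (t + dl) - y).
  exact: dist_gt0 (H2 y y2).
have hm : l y (x (t - dl) - y) < 0.
  by rewrite -oppr_gt0; apply: dist_gt0 (_ : `|_ - - _| < _); rewrite -opprD normrN; exact: H3.
have sdl s : t - dl <= s -> s <= t + dl -> `|s - t| <= dl.
  by move=> h1 h2; rewrite ler_norml lerBrDl h1 lerBlDl h2.
have [s sI hs] : exists2 s, s \in `[t - dl, t + dl]%R & l y (x s - y) = 0.
  apply: (@IVT R (fun s => l y (x s - y))).
  - by rewrite (le_trans (y := t)) ?gerBl ?lerDl ?(ltW dl0).
  - apply: continuous_in_subspaceT => s; rewrite inE /= in_itv /= => /andP[h1 h2].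
    have cs := cx (dlP s (sdl s h1 h2)).
    apply: (@form_cont R^o (fun _ => y) (fun s => x s - y)) => //; first exact: cst_continuous.
    by apply: continuousB => //; exact: cst_continuous.
  - by rewrite ge_min le_max (ltW hm) (ltW hp) orbT.
move: sI; rewrite in_itv /= => /andP[h1 h2].
by exists s; split=> //; exact: sdl.
Qed.

End NullForms.

Lemma form_mono (R : realType) N (g : R -> 'rV[R]_N) (C : 'M[R]_(N, 1)) (a b : R) : a < b ->
  (forall s, a <= s <= b -> differentiable g s /\ 0 < (derive1 g s *m C) 0 0) ->
  0 < ((g b - g a) *m C) 0 0.
Proof.
move=> ab Hg; pose phi (s : R) : R := (g s *m C) 0 0.
have dphi (s : R) : a <= s <= b -> is_derive s (1 : R) phi ((derive1 g s *m C) 0 0).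
  move=> /Hg[dg _].
  have dgC : differentiable (fun s => g s *m C) s.
    by apply: differentiable_mulmx => //; exact: differentiable_const.
  have dco : differentiable phi s.
    by apply: (differentiable_comp' (f := fun M : 'M[R]_1 => M 0 0) dgC); exact: differentiable_coord.
  have E0 : 'D_1 phi s = (derive1 g s *m C) 0 0.
    have E1 := derive_coord (1 : R) 0 0 dgC.
    by rewrite (derive_mulmxr C (1 : R) dg) -derive1E in E1; exact: esym E1.
  by apply: DeriveDef; [exact: diff_derivable|].
have [c] : exists2 c, c \in `]a, b[%R & phi b - phi a = (derive1 g c *m C) 0 0 * (b - a).
  apply: (@MVT R phi (fun s => (derive1 g s *m C) 0 0)) => //.
    by move=> s; rewrite in_itv /= => /andP[h1 h2]; apply: dphi; rewrite !ltW.
  apply: derivable_within_continuous => s; rewrite in_itv /= => hs.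
  by have [] := dphi s hs.
rewrite in_itv /= => /andP[h1 h2] E0.
have -> : ((g b - g a) *m C) 0 0 = phi b - phi a by rewrite mulmxBl !mxE /phi !mxE.
by rewrite E0 mulr_gt0 ?subr_gt0//; have [] : differentiable g c /\ 0 < (derive1 g c *m C) 0 0
  by apply: Hg; rewrite !ltW.
Qed.

Section Strip.
Variables (R : realType) (N m : nat).
Local Notation E := 'rV[R]_N.
Variables (I : set R) (gamma : R -> E) (D : R -> {vspace E}).
Hypothesis H : cauchy_data m I gamma D.
Variables (M : set E).
Hypothesis (m0 : (0 < m)%N) (sol : is_solution m I gamma D M).

Lemma mulmx_norm_bound (L : 'M[R]_(N, m)) : exists2 K, 0 < K & forall v : E, `|v *m L| <= `|v| * K.
Proof.
exists (N%:R * `|L| + 1); first by rewrite ltr_wpDl// mulr_ge0.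
move=> v; rewrite (le_trans (mulmx_norm _ _))// mulrAC mulrC ler_wpM2l// lerDl.
exact: ler01.
Qed.

(* A point [q] of [M] near the strip lies on the ruling through the point of the
   curve at which the null hyperplane of [q] meets the curve: that point is
   found by the intermediate value theorem. *)
Lemma local_strip t0 : I t0 -> exists2 rho : R, 0 < rho &
  forall t, I t -> `|t - t0| < rho -> forall v, ruling I D t v -> `|v| < rho ->
  M (gamma t + v) /\ (I° t -> forall del, 0 < del -> exists2 eta : R, 0 < eta &
    forall q, M q -> `|q - (gamma t + v)| < eta ->
      exists s, [/\ I s, `|s - t| < del & ruling I D s (q - gamma s)]).
Proof.
move=> It0; have [L [W [F [U [r1 [G r10 [ O [oO sO] near0]]]]]]] := solution_patch H sol It0.
have t0r : `|t0 - t0| < r1 by rewrite subrr normr0.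
have [Ot0 Wx0 _] := near0 _ t0r.
have dd0 := curve_curv H sol G oO sO near0 It0 t0r.
have [_ rk _ _] := sol.
have [r [l [r0 rW [sl ll] lK [ld lseg]]]] := rank_one_form G m0 rk Wx0 dd0.
set d := derive1 gamma t0 *m L in dd0 ld.
pose x t := gamma t *m L.
rewrite -/(x t0) in Wx0 dd0 r0 rW sl ll lK ld lseg; set x0 := x t0 in Wx0 dd0 r0 rW sl ll lK ld lseg.
clear dd0; pose x' t := derive1 gamma t *m L.
have x00 : `|x0 - x0| < r by rewrite subrr normr0.
pose c0 := l x0 d; have c0n : c0 != 0 by exact: ld x00.
(* Whatever the sign of [l], this multiple is positive on the projected velocity at [t0], hence
   nearby. *)
pose k y v := c0 * l y v.
have kl y : `|y - x0| < r -> linear (k y : _ -> R^o).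
  move=> /ll yl a u v; rewrite /k; have -> := yl a u v.
  by rewrite mulrDr /GRing.scale /= mulrCA.
have ck v y : `|y - x0| < r -> {for y, continuous (fun y => k y v)}.
  move=> yr; apply: continuousM; first exact: cst_continuous.
  exact: smooth_cont (sl v) yr.
have sg' : smooth O x' by apply: smooth_mulmxr => //; exact: smooth_derive1.
have sx : smooth O x by exact: smooth_mulmxr.
have kpos : 0 < k x0 (x' t0).
  by rewrite /k -/d -/c0 lt_neqAle eq_sym mulf_neq0//= -expr2 sqr_ge0.
have [e0 e00 sgn] : exists2 e0 : R, 0 < e0 & forall y t,
    `|y - x0| < e0 -> `|t - t0| < e0 -> 0 < k y (x' t).
  have cg := @form_cont _ _ k x0 r kl ck _ (fun p : 'rV[R]_m * R^o => p.1) (fun p => x' p.2) (x0, t0) x00.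
  have c1 : {for (x0, t0), continuous (fun p : 'rV[R]_m * R^o => p.1)} by exact: cvg_fst.
  have c2 : {for (x0, t0), continuous (fun p : 'rV[R]_m * R^o => x' p.2)}.
    by apply: (@snd_cont _ _ R^o _ x'); exact: smooth_cont sg' Ot0.
  have [e1 e10 H1] := continuous_ball (cg c1 c2) kpos.
  clear -H1 e10; exists e1; first exact: e10.
  move=> y t y1 t1; have h : `|(y, t) - (x0, t0)| < e1.
    by rewrite /Num.norm /= gt_max /= y1 t1.
  by have /dist_gt0 := H1 (y, t) h.
pose rr := Num.min r e0; have rr0 : 0 < rr by rewrite lt_min r0.
have rr2 : 0 < rr / 2 by rewrite divr_gt0.
have rrr y : `|y - x0| < rr -> `|y - x0| < r /\ `|y - x0| < e0.
  by rewrite lt_min => /andP.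
have [rh rh0 rhP] : exists2 rh : R, 0 < rh & forall t, `|t - t0| < rh ->
    [/\ `|t - t0| < r1, `|t - t0| < e0 & `|x t - x0| < rr / 2].
  have /cvgrPdist_lt/(_ _ rr2)/nbhs_ballR[e1 e10 H1] := smooth_cont sx Ot0.
  exists (Num.min r1 (Num.min e0 e1)); first by rewrite !lt_min r10 e00.
  by move=> t; rewrite !lt_min => /and3P[? ? /H1]; rewrite distrC.
have [K K0 normL] := mulmx_norm_bound L.
have mono y s1 s2 : `|y - x0| < rr -> `|s1 - t0| < rh -> `|s2 - t0| < rh -> s1 < s2 ->
    0 < k y (x s2 - x s1).
  move=> /rrr[yr ye] s1r s2r s12.
  have [C CE] := linear_form_mx (kl y yr).
  rewrite CE /x -mulmxBl -mulmxA; apply: form_mono s12 _ => s /andP[h1 h2].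
  have sb : `|s - t0| < rh.
    move: s1r s2r; rewrite !ltr_norml => /andP[a1 _] /andP[_ a2].
    by rewrite (lt_le_trans a1) ?lerB//= (le_lt_trans _ a2) ?lerB.
  have [sr se _] := rhP s sb; have [Os _ _] := near0 s sr.
  split; first exact: smooth_diff sO Os.
  by rewrite mulmxA -CE; exact: sgn.
exists (Num.min rh (rr / 2 / K)); first by rewrite lt_min rh0 divr_gt0// divr_gt0.
move=> t It; rewrite lt_min => /andP[th _] v vr; rewrite lt_min => /andP[_ vs].
have [tr te xt] := rhP t th.
have [b [Kb vE]] := (ruling_null H m0 sol G oO sO near0 It tr v).1 vr.
have [_ Wxt /(_ It) Fxt] := near0 t tr.
have bE : v *m L = b by rewrite vE (patch_derL G b Wxt).
have bs : `|b| < rr / 2 by rewrite -bE (le_lt_trans (normL v))// -ltr_pdivlMr.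
have half a : a < rr / 2 -> a < rr.
  by move=> h; rewrite (lt_le_trans h)// ler_pdivrMr// ler_peMr ?ler1n// ltW.
pose x1 := x t + b.
have x1r : `|x1 - x0| < rr.
  rewrite /x1 addrAC (le_lt_trans (ler_normD _ _))//.
  by rewrite [rr]splitr ltrD.
have [x1r' x1e] := rrr _ x1r.
have xtr := (rrr _ (half _ xt)).1.
have lb : l (x t) b = 0 by apply: (lK _ _ xtr).2; exact: Kb.
have [DE lx1 Fx1] := lseg (x t) b xtr x1r' lb.
have gE : gamma t + v = F x1 by rewrite /x1 Fx1 -[F (x t)]/(F (gamma t *m L)) Fxt vE.
have Wx1 : W x1 by exact: rW.
rewrite gE; split; first by have [] := patch_in G Wx1.
move=> It' del del0.
have [e1 e10 H1] := nbhs_ballR It'.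
(* The three bounds keep the new parameter within [del] of [t], inside [I] because [t] is interior,
   and in the range where the curve is monotone for the form. *)
pose dl := Num.min (Num.min (del / 2) (e1 / 2)) ((rh - `|t - t0|) / 2).
have h2 (a : R) : 0 < a -> a / 2 < a by move=> a0; rewrite ltr_pdivrMr// ltr_pMr// ltr1n.
have rt0 : 0 < rh - `|t - t0| by rewrite subr_gt0.
have dl0 : 0 < dl by rewrite !lt_min !divr_gt0.
have dlP s : `|s - t| <= dl -> [/\ I s, `|s - t| < del & `|s - t0| < rh].
  rewrite !le_min => /andP[/andP[a1 a2] a3]; split.
  - by apply: H1; rewrite (le_lt_trans a2) ?h2.
  - by rewrite (le_lt_trans a1) ?h2.
  - by rewrite (le_lt_trans (ler_distD t s t0))// -ltrBrDr (le_lt_trans a3) ?h2.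
have kb : k x1 b = 0 by rewrite /k lx1 mulr0.
have cx s : `|s - t0| < rh -> {for s, continuous x}.
  by move=> /rhP[sr _ _]; have [Os _ _] := near0 s sr; exact: smooth_cont sx Os.
have klr y : `|y - x0| < rr -> linear (k y : _ -> R^o) by move=> /rrr[/kl].
have ckr u y : `|y - x0| < rr -> {for y, continuous (fun y => k y u)} by move=> /rrr[/ck].
have [eta eta0 etaP] := null_line_meets klr ckr cx mono dl0
  (fun s sd => let: And3 _ _ h := dlP s sd in h) x1r kb.
have [e4 e40 H4] := nbhs_normball (patch_near G Wx1).
have Fx1L : F x1 *m L = x1 by exact: (patchL G).
exists (Num.min e4 (eta / K)); first by rewrite lt_min e40 divr_gt0.
move=> q Mq; rewrite lt_min => /andP[qe4 qK].
have [Wq Fq] := H4 q qe4 Mq.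
set y := q *m L in Wq Fq.
have yx1 : `|y - x1| < eta.
  by rewrite -Fx1L -mulmxBl (le_lt_trans (normL _))// -ltr_pdivlMr.
have [yr [s [sd hs]]] := etaP y yx1; have [yr' _] := rrr _ yr.
have [Is sdel st0] := dlP s sd; have [sr _ xs] := rhP s st0.
exists s; split; [exact: Is|exact: sdel|].
have ly : l y (x s - y) = 0 by apply: (mulfI c0n); rewrite mulr0; exact: hs.
have xsr := (rrr _ (half _ xs)).1.
have yE : y + (x s - y) = x s by rewrite addrC subrK.
(* The segment from [y] to [x s] is null at [y], so its image is straight and it is still null at
   [x s]: this places [q] on the ruling through [gamma s]. *)
have := lseg y (x s - y) yr'; rewrite yE => /(_ xsr ly)[DE' ls Fs].
have [_ Wxs /(_ Is) Fxs] := near0 s sr.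
apply: (ruling_null H m0 sol G oO sO near0 Is sr _).2; exists (y - x s); split.
  by apply: (lK _ _ xsr).1; rewrite -opprB (linear_formN _ (ll _ xsr)) ls oppr0.
have dFx := patch_diff G Wxs.
have -> : y - x s = -1 *: (x s - y) by rewrite scaleN1r opprB.
rewrite (deriveZv _ _ dFx) scaleN1r.
rewrite (DE' (x s - y)) -[q in LHS]Fq -[gamma s in LHS]Fxs -[gamma s *m L]/(x s) Fs.
by rewrite opprD addrA subrr add0r.
Qed.

End Strip.

(* [r t] is half the largest radius, at most [1], of a ball around [t] on which [q] holds at
   that radius: it varies at half the speed of [t]. *)
Lemma lipschitz_minorant (R : realType) (J : set R) (q : R -> R -> Prop) :
  (forall t a b, b <= a -> q t a -> q t b) ->
  (forall t0, J t0 -> exists2 a : R, 0 < a & forall t, J t -> `|t - t0| < a -> q t a) ->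
  exists r : R -> R, [/\ forall s t, `|r s - r t| <= `|s - t| / 2,
    forall t, J t -> 0 < r t & forall t, J t -> q t (r t)].
Proof.
move=> qm ql.
pose S t := [set a : R | 0 <= a <= 1 /\ forall s, J s -> `|s - t| < a -> q s a].
have S0 t : S t 0 by split; [rewrite lexx ler01|move=> s _; rewrite ltNge normr_ge0].
have Sb t : has_sup (S t).
  by split; [exists 0|exists 1 => a [/andP[]]].
have supL s t : sup (S s) - `|s - t| <= sup (S t).
  rewrite lerBlDr; apply: ge_sup; first by exists 0.
  move=> a [/andP[a0 a1] aq]; rewrite -lerBlDr.
  have [a2|a2] := leP (a - `|s - t|) 0.
    by rewrite (le_trans a2)// (ub_le_sup (Sb t).2).
  apply: (ub_le_sup (Sb t).2); split.
    by rewrite ltW//= lerBlDr ler_wpDr.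
  move=> u Ju ut; apply: (qm _ a); first by rewrite gerBl.
  apply: aq => //; rewrite (le_lt_trans (ler_distD t u s))//.
  by rewrite (distrC t s) -ltrBrDr.
have sp t : J t -> 0 < sup (S t).
  move=> Jt; have [a a0 aq] := ql t Jt.
  rewrite (lt_le_trans (y := Num.min a 1)) ?lt_min ?a0 ?ltr01//.
  apply: (ub_le_sup (Sb t).2); split; first by rewrite ge_min lexx orbT le_min ltW//= ler01.
  move=> s Js; rewrite lt_min => /andP[st _]; apply: (qm _ a); first by rewrite ge_min lexx.
  exact: aq.
exists (fun t => sup (S t) / 2); split.
- move=> s t; rewrite -mulrBl normrM [`|2^-1|]ger0_norm// ler_wpM2r// ler_norml.
  by have := supL s t; have := supL t s; rewrite (distrC t s) => h1 h2; apply/andP; split; lra.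
- by move=> t Jt; rewrite divr_gt0 ?sp.
move=> t Jt; have sp2 : 0 < sup (S t) / 2 by rewrite divr_gt0 ?sp.
have [b [_ bq] hb] := sup_adherent sp2 (Sb t).
apply: (qm _ b); first by lra.
by apply: bq => //; rewrite subrr normr0; move: (sp _ Jt); lra.
Qed.

(** * Necessity of the rank condition, uniqueness and the strip *)

Section Consequences.
Variables (R : realType) (N m : nat).
Local Notation E := 'rV[R]_N.
Variables (I : set R) (gamma : R -> E) (D : R -> {vspace E}).
Hypotheses (H : cauchy_data m I gamma D) (m0 : (0 < m)%N).

Lemma rank_necessary M t : is_solution m I gamma D M -> I t -> has_dim (im_rho I D t) 1%N.
Proof.
move=> sol It; have [L [W [F [U [r [G r0 [ O [oO sO] near0]]]]]]] := solution_patch H sol It.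
by apply: (solution_rank H m0 sol G oO sO near0 It); rewrite subrr normr0.
Qed.

Lemma ruling0 t : ruling I D t 0.
Proof. by split; [exact: mem0v|move=> w _; rewrite dot0l]. Qed.

Lemma gamma_cont t : I t -> {for t, continuous gamma}.
Proof.
by move=> It; have [ O [oO IO sO]] := gamma_smooth H; apply: smooth_cont sO _; exact: IO.
Qed.

Lemma gamma_close t e : I t -> 0 < e ->
  exists2 d : R, 0 < d & forall s, `|s - t| < d -> `|gamma s - gamma t| < e.
Proof.
move=> It e0; have /cvgrPdist_lt/(_ _ e0)/nbhs_ballR[d d0 Hd] := gamma_cont It.
by exists d => // s /Hd; rewrite distrC.
Qed.

(** A point of [M1] near [gamma t] lies on the ruling of a nearby parameter. The rulings are
    determined by the data alone, and [M2] contains their short pieces. *)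
Lemma unique_near M1 M2 t : is_solution m I gamma D M1 -> is_solution m I gamma D M2 -> I° t ->
  exists2 e : R, 0 < e & forall q, `|q - gamma t| < e -> M1 q -> M2 q.
Proof.
move=> s1 s2 It'; have It := interior_subset It'.
have [a a0 Ha] := local_strip H m0 s1 It; have [b b0 Hb] := local_strip H m0 s2 It.
have tt0 c : 0 < c -> `|t - t| < c by rewrite subrr normr0.
have [_ /(_ It')] := Ha t It (tt0 _ a0) 0 (ruling0 t) ltac:(by rewrite normr0).
have b2 : 0 < b / 2 by rewrite divr_gt0.
have [d d0 Hd] := gamma_close It b2.
have dm : 0 < Num.min d b by rewrite lt_min d0.
move=> /(_ _ dm)[eta eta0 He]; rewrite addr0 in He.
exists (Num.min eta (b / 2)); first by rewrite lt_min eta0.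
move=> q; rewrite lt_min => /andP[q1 q2] Mq.
have [s [Is]] := He q Mq q1; rewrite lt_min => /andP[sd sb] rs.
have [] := Hb s Is sb _ rs; last by rewrite addrC subrK.
rewrite (le_lt_trans (ler_distD (gamma t) _ _))// (splitr b) ltrD//.
by rewrite distrC Hd.
Qed.

Lemma solution_unique M1 M2 : is_solution m I gamma D M1 -> is_solution m I gamma D M2 ->
  exists U, [/\ open U, gamma @` I° `<=` U & M1 `&` U = M2 `&` U].
Proof.
move=> s1 s2.
pose U := [set q | exists p e, [/\ 0 < e, `|q - p| < e & forall y, `|y - p| < e -> M1 y <-> M2 y]].
exists U; split.
- apply: ball_open_set => q [p [e [e0 qp Hp]]]; exists (e - `|q - p|); first by rewrite subr_gt0.
  move=> y yq; exists p, e; split=> //.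
  by rewrite (le_lt_trans (ler_distD q _ _))// -ltrBrDr.
- move=> _ [t It <-]; have [a a0 Ha] := unique_near s1 s2 It; have [b b0 Hb] := unique_near s2 s1 It.
  exists (gamma t), (Num.min a b); split; first by rewrite lt_min a0.
    by rewrite subrr normr0 lt_min a0.
  by move=> y; rewrite lt_min => /andP[ya yb]; split; [exact: Ha|exact: Hb].
- by apply/seteqP; split=> q [Mq [p [e [e0 qp Hp]]]]; (split; last by exists p, e); apply/Hp.
Qed.

Lemma sqrt_dot_cont (v : E) e : 0 < e ->
  exists2 d : R, 0 < d & forall u, `|u - v| < d -> Num.sqrt (dot u u) < Num.sqrt (dot v v) + e.
Proof.
move=> e0; have c1 : {for v, continuous (fun u : E => Num.sqrt (dot u u))}.
  apply: (@continuous_comp _ _ _ (fun u : E => dot u u) Num.sqrt); last exact: sqrt_continuous.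
  by apply: cont_sum => i; apply: continuousM; exact: coord_continuous.
have [d d0 Hd] := continuous_ball c1 e0; exists d => // u /Hd.
by rewrite ltr_norml => /andP[_]; rewrite ltrBlDl.
Qed.

Lemma strip_radius M : is_solution m I gamma D M ->
  exists r : R -> R, [/\ forall s t, `|r s - r t| <= `|s - t| / 2, forall t, I t -> 0 < r t &
  forall t v, I t -> ruling I D t v -> `|v| < r t ->
    M (gamma t + v) /\ (I° t -> forall del, 0 < del -> exists2 eta : R, 0 < eta &
      forall q, M q -> `|q - (gamma t + v)| < eta ->
        exists s, [/\ I s, `|s - t| < del & ruling I D s (q - gamma s)])].
Proof.
move=> sol; pose q t a := forall v, ruling I D t v -> `|v| < a ->
  M (gamma t + v) /\ (I° t -> forall del, 0 < del -> exists2 eta : R, 0 < eta &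
    forall q, M q -> `|q - (gamma t + v)| < eta ->
      exists s, [/\ I s, `|s - t| < del & ruling I D s (q - gamma s)]).
have [||r [rL r0 rq]] := @lipschitz_minorant R I q.
- by move=> t a b ba qa v vr vb; apply: qa => //; exact: lt_le_trans ba.
- move=> t0 It0; have [a a0 Ha] := local_strip H m0 sol It0.
  by exists a => // t It ta v; exact: Ha.
by exists r; split=> // t v It; exact: rq.
Qed.

Lemma relatively_open (M S : set E) : S `<=` M -> (forall t, I° t -> S (gamma t)) ->
  (forall p, S p -> exists2 e : R, 0 < e & forall y, `|y - p| < e -> M y -> S y) ->
  exists U, [/\ open U, gamma @` I° `<=` U & M `&` U = S].
Proof.
move=> SM gS key.
exists [set y | exists p e, [/\ S p, 0 < e, `|y - p| < e & forall y, `|y - p| < e -> M y -> S y]].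
split.
- apply: ball_open_set => y [p [e [Sp e0 yp Hp]]]; exists (e - `|y - p|); first by rewrite subr_gt0.
  move=> z zy; exists p, e; split=> //.
  by rewrite (le_lt_trans (ler_distD y _ _))// -ltrBrDr.
- move=> _ [t It <-]; have St := gS t It.
  have [e e0 He] := key _ St; exists (gamma t), e; split=> //.
  by rewrite subrr normr0.
- apply/seteqP; split=> [y [My [p [e [Sp e0 yp Hp]]]]|y Sy]; first exact: Hp.
  split; first exact: SM.
  have [e e0 He] := key _ Sy; exists y, e; split=> //.
  by rewrite subrr normr0.
Qed.

Lemma lipschitz_continuous (r : R -> R) : (forall s t, `|r s - r t| <= `|s - t| / 2) -> continuous r.
Proof.
move=> rL t; apply/cvgrPdist_lt => e e0; apply: (ball_nbhsR e0) => s st.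
rewrite (le_lt_trans (rL _ _))// distrC (le_lt_trans _ st)// ler_pdivrMr// ler_peMr//.
by rewrite ler1n.
Qed.

Lemma solution_strip M : is_solution m I gamma D M ->
  exists r : R -> R,
    [/\ {within I, continuous r}, (forall t, I t -> 0 < r t),
        ruled_strip I gamma D I r `<=` M &
        exists U, [/\ open U, gamma @` I° `<=` U &
          M `&` U = ruled_strip I gamma D I° r]].
Proof.
move=> sol; have [r [rL r0 rq]] := strip_radius sol.
have stripM : ruled_strip I gamma D I r `<=` M.
  (* The radii of [strip_radius] are measured in the maximum norm, which is below the Euclidean one
     used in [ruled_strip]. *)
  move=> _ [t [v [It vD vo vr ->]]]; have [|//] := rq t v It (conj vD vo).
  exact: le_lt_trans (norm_sqrt_dot v) vr.
have subI : ruled_strip I gamma D I° r `<=` ruled_strip I gamma D I r.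
  by move=> p [t [v [It *]]]; exists t, v; split=> //; exact: interior_subset.
exists r; split=> //.
  by apply/continuous_subspaceT; exact: lipschitz_continuous.
apply: relatively_open; first by move=> p /subI/stripM.
  move=> t It; exists t, 0; split=> //; [exact: mem0v|by move=> w _; rewrite dot0l| |by rewrite addr0].
  by rewrite dot0l sqrtr0; apply: r0; exact: interior_subset.
move=> _ [t [v [It' vD vo vr ->]]]; have It := interior_subset It'.
(* The room left inside the disc is shared equally: the Euclidean length of the ruling vector may
   grow by [g / 2], and the radius, being 1/2-Lipschitz, drops by less than [g / 2]. *)
set g := r t - Num.sqrt (dot v v); have g0 : 0 < g by rewrite subr_gt0.
have g2 : 0 < g / 2 by rewrite divr_gt0.
have [e1 e10 H1] := sqrt_dot_cont v g2.
have e12 : 0 < e1 / 2 by rewrite divr_gt0.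
have [e2 e20 H2] := gamma_close It e12.
have [e3 e30 H3] := open_ballR (@open_interior _ I) It'.
have [|_ /(_ It' (Num.min (Num.min e2 e3) g))] := rq t v It (conj vD vo).
  exact: le_lt_trans (norm_sqrt_dot v) vr.
rewrite !lt_min e20 e30 g0 => /(_ isT)[eta eta0 He].
exists (Num.min eta (e1 / 2)); first by rewrite lt_min eta0.
move=> y; rewrite lt_min => /andP[y1 y2] My; have [s [Is]] := He y My y1.
rewrite !lt_min => /andP[/andP[s2 s3] sg] [sD so].
exists s, (y - gamma s); split=> //; [exact: H3| |by rewrite addrC subrK].
have : `|(y - gamma s) - v| < e1.
  have -> : y - gamma s - v = (y - (gamma t + v)) - (gamma s - gamma t).
    by apply/rowP => j; rewrite !mxE; ring.
  by rewrite (le_lt_trans (ler_normB _ _))// (splitr e1) ltrD// H2.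
move=> /H1 n1; have := rL t s; rewrite ler_norml => /andP[_].
move: n1 sg; rewrite /g (distrC t s); set n := Num.sqrt _; set n' := Num.sqrt _.
by move=> h1 h2 h3; lra.
Qed.

End Consequences.

(** * Developable extensions of the data *)

Section Antiderivative.
Variables (R : realType).

Lemma derive_scale1 (W : normedModType R) (f : R -> W) (t v : R) : differentiable f t ->
  'D_v f t = v *: derive1 f t.
Proof. by move=> df; rewrite derive1E -(deriveZv v (1 : R) df) /GRing.scale /= mulr1. Qed.

Lemma antiderivative_real (h : R -> R) t0 r : 0 < r ->
  (forall s, `|s - t0| < r -> {for s, continuous h}) ->
  exists F : R -> R, forall s, `|s - t0| < r / 2 -> is_derive s (1 : R) F (h s).
Proof.
(* The half-width 3r/4 lies strictly between r/2 and r: the compact interval of integration stays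
   where [h] is continuous and has the ball of radius r/2 in its interior. *)
move=> r0 ch; pose a := t0 - r / 4 * 3; pose u := t0 + r / 4 * 3.
exists (fun x => (\int[lebesgue_measure]_(t in `[a, x]) (h t))%R) => s.
rewrite ltr_norml => /andP[s1 s2].
have su : s < u by rewrite /u; lra.
have as1 : a < s by rewrite /a; lra.
have sr : `|s - t0| < r by rewrite ltr_norml; apply/andP; split; lra.
have hi : lebesgue_measure.-integrable `[a, u] (EFin \o h).
  apply: continuous_compact_integrable; first exact: segment_compact.
  apply: continuous_in_subspaceT => x; rewrite inE /= in_itv /= /a /u => /andP[x1 x2].
  by apply: ch; rewrite ltr_norml; apply/andP; split; lra.
have [dF F'] := continuous_FTC1_closed su hi as1 (ch s sr).
by apply: DeriveDef; [exact: dF|rewrite -derive1E; exact: F'].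
Qed.

Lemma smooth_antiderivative p q (F h : R -> 'M[R]_(p, q)) O : open O -> smooth O h ->
  (forall s, O s -> differentiable F s /\ derive1 F s = h s) -> smooth O F.
Proof.
move=> oO sh HF; case=> [s Os|n]; first exact/differentiable_continuous/(HF s Os).1.
split=> [s /HF[]//|v].
apply: (@Ck_ext _ _ _ _ _ oO (fun s => v *: h s)).
  by move=> s /HF[dF <-]; rewrite derive_scale1.
by apply: (Ck_scalemx oO); [exact: Ck_cstR|exact: sh].
Qed.

Lemma antiderivative p q (h : R -> 'M[R]_(p, q)) t0 r v0 : 0 < r ->
  smooth [set t | `|t - t0| < r] h -> exists F : R -> 'M[R]_(p, q),
    [/\ F t0 = v0, smooth [set t | `|t - t0| < r / 2] F &
      forall s, `|s - t0| < r / 2 -> derive1 F s = h s].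
Proof.
move=> r0 sh; have oB := open_ball_setR R t0 r.
have H ij : {F : R -> R | forall s, `|s - t0| < r / 2 -> is_derive s (1 : R) F (h s ij.1 ij.2)}.
  apply: cid; apply: antiderivative_real => // s sr.
  exact: (Ck_coord ij.1 ij.2 oB (sh 0%N)).
pose G ij := projT1 (H ij); have GP ij := projT2 (H ij).
pose F s : 'M[R]_(p, q) := v0 + \matrix_(i, j) (G (i, j) s - G (i, j) t0).
have FP s : `|s - t0| < r / 2 -> differentiable F s /\ derive1 F s = h s.
  move=> sr; have dF : differentiable F s.
    apply: differentiable_mx_of => i j.
    have -> : (fun s => F s i j) = (fun s => v0 i j + (G (i, j) s - G (i, j) t0)).
      by apply/funext => x; rewrite !mxE.
    have [dG _] := GP (i, j) s sr.
    apply: differentiableD; first exact: differentiable_const.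
    by apply: differentiableB; [apply/derivable1_diffP|exact: differentiable_const].
  split=> //; apply/matrixP => i j; rewrite derive1E.
  apply: (etrans (derive_coord (1 : R) i j dF)).
  have -> : (fun s => F s i j) = (fun s => G (i, j) s + (v0 i j - G (i, j) t0)).
    by apply/funext => x; rewrite !mxE addrCA addrA.
  have [dG GE] := GP (i, j) s sr.
  by rewrite deriveD// derive_cst addr0 GE.
exists F; split.
- by apply/matrixP => i j; rewrite !mxE subrr addr0.
- apply: (smooth_antiderivative (h := h)) FP; first exact: open_ball_setR.
  by apply: smooth_sub sh => s /= sr; rewrite (lt_le_trans sr)// ler_pdivrMr// ler_peMr ?ler1n// ltW.
- by move=> s /FP[].
Qed.

Lemma derive1_zero_const p q (f : R -> 'M[R]_(p, q)) a b :
  (forall s : R, 0 <= s <= 1 -> differentiable f (a + s * (b - a)) /\ derive1 f (a + s * (b - a)) = 0) ->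
  f b = f a.
Proof.
move=> Hf; apply/matrixP => i j; apply/eqP; rewrite -subr_eq0; apply/eqP.
have [|s s01 ->] := @mvt_segment R R^o (fun s => f s i j : R) a b.
  move=> s /Hf[df _]; apply: (differentiable_comp' (f := fun M : 'M[R]_(p, q) => M i j) df).
  exact: differentiable_coord.
have [df f'] := Hf s s01.
have E := derive_coord (b - a : R^o) i j df.
apply: (etrans (esym E)); have -> := derive_scale1 (b - a) df.
by rewrite f' scaler0 mxE.
Qed.

Lemma interval_segment (I : set R) a b s : is_interval I -> I a -> I b -> 0 <= s <= 1 ->
  I (a + s * (b - a)).
Proof.
move=> iI Ia Ib /andP[s0 s1]; case: (leP a b) => ab.
  apply: (iI _ _ Ia Ib); rewrite lerDl mulr_ge0 ?subr_ge0//=.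
  by rewrite -lerBrDl ler_piMl ?subr_ge0.
apply: (iI _ _ Ib Ia); rewrite gerDl mulr_ge0_le0 ?subr_le0 ?(ltW ab)// andbT.
have -> : a + s * (b - a) = b + (1 - s) * (a - b) by ring.
by rewrite lerDl mulr_ge0 ?subr_ge0// ltW.
Qed.

Lemma ball_interval (b r : R) : is_interval [set t : R | `|t - b| < r].
Proof.
move=> s t /=; rewrite !ltr_norml => /andP[s1 s2] /andP[t1 t2] u /andP[u1 u2].
by rewrite ltr_norml; apply/andP; split; lra.
Qed.

Lemma derive1_eq_eq p q (I : set R) (f g : R -> 'M[R]_(p, q)) a b : is_interval I -> I a -> I b ->
  (forall s, I s -> [/\ differentiable f s, differentiable g s & derive1 f s = derive1 g s]) ->
  f a = g a -> f b = g b.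
Proof.
move=> iI Ia Ib Hfg fga; apply/eqP; rewrite -subr_eq0; apply/eqP.
rewrite (@derive1_zero_const _ _ (fun s => f s - g s) a b) ?fga ?subrr// => s s01.
have [df dg fg] := Hfg _ (interval_segment iI Ia Ib s01).
split; first exact: differentiableB.
rewrite derive1E deriveB; [|exact: diff_derivable..].
by rewrite -!derive1E fg subrr.
Qed.

End Antiderivative.

(** Cauchy data in graph form over an open parameter set, free of [I]: the rows of [A] span the
    tangent spaces, their derivative has rank one, and the kernel of [a] gives the rulings. The last
    two fields say that the curve is transverse to the rulings and that the spaces actually turn. *)
Record developable (R : realType) (N m : nat) (O : set R) (L : 'M[R]_(N, m))
    (A : R -> 'M[R]_(m, N)) (g : R -> 'rV[R]_N) (a : R -> 'M[R]_(m, 1))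
    (beta : R -> 'rV[R]_N) : Prop := DevelopableData {
  dv_open : open O;
  dv_A : smooth O A;
  dv_g : smooth O g;
  dv_a : smooth O a;
  dv_L : forall t, O t -> A t *m L = 1%:M;
  dv_g' : forall t, O t -> derive1 g t = derive1 g t *m L *m A t;
  dv_A' : forall t, O t -> derive1 A t = a t *m beta t;
  dv_trans : forall t, O t -> derive1 g t *m L *m a t != 0;
  dv_beta : forall t, O t -> beta t != 0 }.

Section Developable.
Variables (R : realType) (N m : nat).
Local Notation E := 'rV[R]_N.

Lemma derive1_mulmx p q k (f : R -> 'M[R]_(p, q)) (g : R -> 'M[R]_(q, k)) (t : R) :
  differentiable f t -> differentiable g t ->
  derive1 (fun s => f s *m g s) t = derive1 f t *m g t + f t *m derive1 g t.
Proof. by move=> df dg; rewrite !derive1E (derive_mulmx (1 : R) df dg). Qed.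

Lemma derive1_mulmxr p q k (f : R -> 'M[R]_(p, q)) (C : 'M[R]_(q, k)) (t : R) :
  differentiable f t -> derive1 (fun s => f s *m C) t = derive1 f t *m C.
Proof. by move=> df; rewrite !derive1E derive_mulmxr. Qed.

Lemma derive1_mulmxl p q k (C : 'M[R]_(p, q)) (g : R -> 'M[R]_(q, k)) (t : R) :
  differentiable g t -> derive1 (fun s => C *m g s) t = C *m derive1 g t.
Proof.
move=> dg; by rewrite (derive1_mulmx (f := fun _ => C)) ?derive1_cst ?mul0mx ?add0r.
Qed.

Lemma scale_cancel (k c : R) (v : E) : k != 0 -> k^-1 *: ((c *: (k%:M : 'M[R]_1)) *m v) = c *: v.
Proof. by move=> k0; rewrite -scalemxAl mul_scalar_mx !scalerA mulrCA mulVf ?mulr1. Qed.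

Variables (I : set R) (gamma : R -> E) (D : R -> {vspace E}).
Hypothesis H : cauchy_data m I gamma D.

(** Pairing [rho] with the sections [z *m A u] turns the rank condition into a proportionality,
    modulo [D t], between the derivative of the frame and the acceleration. Since [rho] no longer
    occurs, this form passes from one set of data to another sharing the frame near [t]. *)
Lemma rank_frameP (A : R -> 'M[R]_(m, N)) t : I t -> differentiable A t ->
  (\forall u \near t, I u -> [set` D u] = rowsp (A u)) ->
  has_dim (im_rho I D t) 1%N <->
  forall z : 'rV_m, exists c, z *m derive1 A t - c *: derive1n 2 gamma t \in D t.
Proof.
move=> It dA DA; have [wD wg] := rho_curv_spec H It.
set k := perp_proj [set` D t] (derive1n 2 gamma t).
have kD : orth [set` D t] k by exact: perp_orth'.
have DAt : [set` D t] = rowsp (A t) by apply: (nbhs_singleton DA).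
have rhoA nu z : orth [set` D t] nu ->
    dot (rho I D t nu) (z *m A t) = - dot nu (z *m derive1 A t).
  move=> nuD; have [_ q] := rho_spec H It nuD.
  rewrite (q (fun u => z *m A u)) ?(derive1_mulmxl z dA)//.
    by apply: differentiable_mulmx => //; exact: differentiable_const.
  apply: filterS DA => u DA Iu.
  have -> : (z *m A u \in D u) = [set` D u] (z *m A u) :> Prop by [].
  by rewrite (DA Iu); exists z.
rewrite (rank_rhoP H It); split=> [Hc z|Hc nu nuD].
  pose c := dot (rho_curv I gamma D t) (z *m A t) / dot (rho_curv I gamma D t) (derive1 gamma t).
  exists c; apply/perp_proj_eq0; set v := _ - _.
  apply: dot_eq0; have pD : orth [set` D t] (perp_proj [set` D t] v) by exact: perp_orth'.
  have -> : dot (perp_proj [set` D t] v) (perp_proj [set` D t] v) = dot (perp_proj [set` D t] v) v.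
    by rewrite {2}/perp_proj dotBr (pD _ (proj_in _ _)) subr0.
  set p := perp_proj _ v in pD *.
  have [a ra] := Hc p pD; rewrite /v dotBr dotZr.
  have := rhoA p z pD; have := dot_rho_gamma H It pD; rewrite ra !dotZl.
  move=> e1 e2; rewrite -[dot p (derive1n 2 gamma t)]opprK -e1 -[dot p (_ *m _)]opprK -e2.
  by rewrite /c mulrN opprK mulrCA divfK ?addNr ?lt_eqF.
have kk : dot k (derive1n 2 gamma t) != 0.
  by rewrite -oppr_eq0 -(dot_rho_gamma H It kD) lt_eqF.
exists (dot nu (derive1n 2 gamma t) / dot k (derive1n 2 gamma t)).
have [rD _] := rho_spec H It nuD.
apply/eqP; rewrite -subr_eq0; apply/eqP; apply: dot_eq0; set z0 := _ - _.
have z0D : z0 \in D t by apply: memvB => //; exact: memvZ.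
have : [set` D t] z0 by []. rewrite DAt => -[y yE].
have [c yc] := Hc y.
have e (mu : E) : orth [set` D t] mu -> dot mu (y *m derive1 A t) = c * dot mu (derive1n 2 gamma t).
  by move=> /(_ _ yc)/eqP; rewrite dotBr dotZr subr_eq0 => /eqP.
rewrite {2}yE /z0 dotBl dotZl (rhoA _ _ nuD) (rhoA _ _ kD) (e _ nuD) (e _ kD).
by rewrite mulrN opprK mulrCA divfK// addNr.
Qed.

(* In graph coordinates over [D b], normalized by [A *m L = 1], the rank condition says that
   [A'] has rank one; the factorization [A' = a *m beta] extends past an endpoint of [I]. *)
Lemma local_developable b : I b -> (forall t, I t -> has_dim (im_rho I D t) 1%N) ->
  exists (L : 'M[R]_(N, m)) (r : R) (A : R -> 'M[R]_(m, N)) (g : R -> E)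
    (a : R -> 'M[R]_(m, 1)) (beta : R -> E),
  [/\ 0 < r, developable [set t | `|t - b| < r] L A g a beta &
      forall t, I t -> `|t - b| < r -> g t = gamma t /\ [set` D t] = rowsp (A t)].
Proof.
move=> Ib rk; have [A0 [r0 [r00 sA0 uA0 DA0]]] := local_frame H Ib.
have b0 r : 0 < r -> `|b - b| < r by rewrite subrr normr0.
pose L := (A0 b)^T *m invmx (A0 b *m (A0 b)^T).
have oB0 := open_ball_setR R b r0.
have sAL : smooth [set t | `|t - b| < r0] (fun t => A0 t *m L) by exact: smooth_mulmxr.
have AL1 : A0 b *m L = 1%:M by rewrite /L mulmxA mulmxV//; exact: uA0 (b0 _ r00).
have [r1 [r10 r1r0 uAL]] : exists r1, [/\ 0 < r1, r1 <= r0 &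
    forall t, `|t - b| < r1 -> A0 t *m L \in unitmx].
  have sd : smooth [set t | `|t - b| < r0] (fun t => \det (A0 t *m L)).
    by move=> n; apply: (Ck_det oB0); exact: sAL.
  have d0 : \det (A0 b *m L) = 1 by rewrite AL1 det1.
  have := continuous_ball (smooth_cont sd (b0 _ r00)) (ltr01 : 0 < (1 : R)).
  rewrite d0 => -[d dd Hd]; exists (Num.min d r0); split.
  - by rewrite lt_min dd.
  - by rewrite ge_min lexx orbT.
  move=> t; rewrite lt_min => /andP[/Hd td _]; rewrite unitmxE unitfE.
  by apply/eqP => E0; rewrite E0 sub0r normrN normr1 ltxx in td.
pose A1 t := invmx (A0 t *m L) *m A0 t.
have oB1 := open_ball_setR R b r1.
have sA1 : smooth [set t | `|t - b| < r1] A1.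
  have sub1 : [set t | `|t - b| < r1] `<=` [set t | `|t - b| < r0].
    by move=> t /= h; exact: lt_le_trans r1r0.
  move=> n; apply: (Ck_mulmx oB1); last exact: Ck_sub sub1 _ (sA0 n).
  by apply: (Ck_invmx oB1) => //; exact: Ck_sub sub1 _ (sAL n).
have A1L t : `|t - b| < r1 -> A1 t *m L = 1%:M.
  by move=> tr; rewrite /A1 -mulmxA mulVmx//; exact: uAL.
have DA1 t : I t -> `|t - b| < r1 -> [set` D t] = rowsp (A1 t).
  move=> It tr; rewrite (DA0 t (lt_le_trans tr r1r0) It); have u := uAL t tr.
  apply/seteqP; split=> _ [z ->].
    by exists (z *m (A0 t *m L)); rewrite /A1 [RHS]mulmxA mulmxK.
  by exists (z *m invmx (A0 t *m L)); rewrite /A1 mulmxA.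
have [ O [oO IO sO]] := gamma_smooth H.
pose x' t := derive1 gamma t *m L.
have sx' : smooth O x' by apply: smooth_mulmxr => //; exact: smooth_derive1.
have sA1' : smooth [set t | `|t - b| < r1] (derive1 A1) by exact: smooth_derive1.
have dg t : I t -> differentiable gamma t by move=> It; apply: smooth_diff sO _; exact: IO.
have dA1 t : `|t - b| < r1 -> differentiable A1 t by move=> tr; exact: smooth_diff sA1 tr.
have A1'L t : `|t - b| < r1 -> derive1 A1 t *m L = 0.
  move=> tr; rewrite -(derive1_mulmxr L (dA1 t tr)) derive1E.
  rewrite -(derive_cst (1%:M : 'M[R]_m) t (1 : R)); apply: near_eq_derive.
  by apply: (near_open oB1 tr) => s; exact: A1L.
have gD t : I t -> `|t - b| < r1 -> derive1 gamma t = x' t *m A1 t.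
  move=> It tr; have : [set` D t] (derive1 gamma t) by exact: (cd_tan H).
  rewrite (DA1 t It tr) => -[z zE].
  have -> : x' t = z by rewrite /x' zE -mulmxA (A1L t tr) mulmx1.
  exact: zE.
(* [L] is injective on [D t], so a relation modulo [D t] between vectors killed by [L] is an
   equality. This removes the ambiguity left by the rank condition for the normalized frame. *)
have perp0 t v : I t -> `|t - b| < r1 -> v *m L = 0 -> v \in D t -> v = 0.
  move=> It tr vL vD; have : [set` D t] v by [].
  rewrite (DA1 t It tr) => -[z zE]; move: vL; rewrite zE -mulmxA (A1L t tr) mulmx1 => ->.
  by rewrite mul0mx.
have g2 t : I t -> `|t - b| < r1 -> derive1n 2 gamma t - x' t *m derive1 A1 t \in D t.
  move=> It tr; have dx' : differentiable x' t by apply: smooth_diff sx' _; exact: IO.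
  have dg' : differentiable (derive1 gamma) t.
    by apply: smooth_diff (smooth_derive1 sO) _; exact: IO.
  have -> : derive1n 2 gamma t = derive1 x' t *m A1 t + x' t *m derive1 A1 t.
    rewrite derive1nS derive1n1 -(derive1_mulmx dx' (dA1 t tr)).
    apply: (@derive1_eq_on R I (cd_itv H) (cd_nondeg H) _ (derive1 gamma)) => //.
      by apply: differentiable_mulmx => //; exact: dA1.
    by apply: (near_open oB1 tr) => s sr Is; exact: gD.
  rewrite addrK; have -> : (derive1 x' t *m A1 t \in D t) = [set` D t] (derive1 x' t *m A1 t) :> Prop by [].
  by rewrite (DA1 t It tr); exists (derive1 x' t).
have rkA t : I t -> `|t - b| < r1 -> forall z : 'rV_m, exists c,
    z *m derive1 A1 t = c *: (x' t *m derive1 A1 t).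
  move=> It tr z; have DAn : \forall u \near t, I u -> [set` D u] = rowsp (A1 u).
    by apply: (near_open oB1 tr) => u ur Iu; exact: DA1.
  have [c zc] := (rank_frameP It (dA1 t tr) DAn).1 (rk t It) z; exists c.
  apply/eqP; rewrite -subr_eq0; apply/eqP; apply: (perp0 t _ It tr).
    by rewrite mulmxBl -scalemxAl -!mulmxA !(A1'L t tr) !mulmx0 scaler0 subr0.
  have -> : z *m derive1 A1 t - c *: (x' t *m derive1 A1 t) =
      (z *m derive1 A1 t - c *: derive1n 2 gamma t)
      + c *: (derive1n 2 gamma t - x' t *m derive1 A1 t).
    by rewrite scalerBr addrA subrK.
  by apply: memvD => //; apply: memvZ; exact: g2.
have xA0 : x' b *m derive1 A1 b != 0.
  apply/eqP => E0; have := g2 b Ib (b0 _ r10); rewrite E0 subr0 => hD.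
  by move/eqP: (cd_curv H Ib); apply; apply/perp_proj_eq0.
have /existsP[j xAj] : [exists j, (x' b *m derive1 A1 b) 0 j != 0].
  apply: contraNT xA0 => /existsPn h; apply/eqP/rowP => j; rewrite [RHS]mxE.
  by have := h j; rewrite negbK => /eqP.
pose f t := (x' t *m derive1 A1 t) 0 j.
have [r2 r20 H2] := open_ballR oO (IO b Ib).
pose r3 := Num.min r1 r2; have r30 : 0 < r3 by rewrite lt_min r10.
have oB3 := open_ball_setR R b r3.
have r31 t : `|t - b| < r3 -> `|t - b| < r1 by rewrite lt_min => /andP[].
have r3O t : `|t - b| < r3 -> O t by rewrite lt_min => /andP[_]; exact: H2.
have sx'3 : smooth [set t | `|t - b| < r3] x' by exact: smooth_sub sx'.
have sA'3 : smooth [set t | `|t - b| < r3] (derive1 A1) by exact: smooth_sub sA1'.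
have sxA : smooth [set t | `|t - b| < r3] (fun t => x' t *m derive1 A1 t).
  by move=> n; apply: (Ck_mulmx oB3); [exact: sx'3|exact: sA'3].
have sf : smooth [set t | `|t - b| < r3] f.
  by move=> n; exact: (Ck_coord 0 j oB3 (sxA n)).
have fb0 : 0 < `|f b| by rewrite normr_gt0.
have [r4 r40 H4] := continuous_ball (smooth_cont sf (b0 _ r30)) fb0.
pose r5 := Num.min r3 r4; have r50 : 0 < r5 by rewrite lt_min r30.
have oB5 := open_ball_setR R b r5.
have r53 t : `|t - b| < r5 -> `|t - b| < r3 by rewrite lt_min => /andP[].
have f0 t : `|t - b| < r5 -> f t != 0.
  rewrite lt_min => /andP[_ /H4 h]; apply/eqP => E0.
  by rewrite E0 sub0r normrN ltxx in h.
have sub53 : [set t | `|t - b| < r5] `<=` [set t | `|t - b| < r3] by exact: r53.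
(* A matrix of rank one is the product of one of its columns and a row of its row space, divided by
   the common entry: here column [j] and the row [x' t *m derive1 A1 t], whose entry [f t] is
   nonzero. *)
pose a t := derive1 A1 t *m (delta_mx j 0 : 'M[R]_(N, 1)).
pose beta t := (f t)^-1 *: (x' t *m derive1 A1 t).
have sa : smooth [set t | `|t - b| < r5] a.
  by apply: smooth_mulmxr; [exact: oB5|exact: smooth_sub sub53 sA'3].
have sbeta : smooth [set t | `|t - b| < r5] beta.
  move=> n; apply: (Ck_scalemx oB5); last exact: Ck_sub sub53 _ (sxA n).
  by apply: (CkV oB5) => //; exact: Ck_sub sub53 _ (sf n).
have xa t : x' t *m a t = (f t)%:M.
  by rewrite /a mulmxA -colE [LHS]mx11_scalar mxE.
have A1' t : I t -> `|t - b| < r5 -> derive1 A1 t = a t *m beta t.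
  move=> It tr; apply/row_matrixP => i; rewrite !rowE mulmxA /beta -scalemxAr.
  have [c zc] := rkA t It (r31 _ (r53 _ tr)) (delta_mx 0 i).
  have -> : delta_mx 0 i *m a t = c *: (f t)%:M.
    by rewrite -xa /a !mulmxA zc -scalemxAl.
  exact: etrans zc (esym (scale_cancel _ _ (f0 t tr))).
have betaL t : `|t - b| < r5 -> beta t *m L = 0.
  move=> tr; rewrite /beta -scalemxAl -mulmxA A1'L ?mulmx0 ?scaler0//.
  by apply: r31; exact: r53.
have sab : smooth [set t | `|t - b| < r5] (fun t => a t *m beta t).
  by move=> n; apply: (Ck_mulmx oB5); [exact: sa|exact: sbeta].
(* Outside [I] the derivative of [A1] may differ from [a t *m beta t]. Integrating the product
   instead keeps rank one on the whole ball and returns [A1] on [I]; the curve is rebuilt from [A]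
   in the same way. *)
have [A [Ab sA A']] := antiderivative (A1 b) r50 sab.
pose r6 := r5 / 2; have r60 : 0 < r6 by rewrite divr_gt0.
have r65 t : `|t - b| < r6 -> `|t - b| < r5.
  by move=> h; rewrite (lt_le_trans h)// ler_pdivrMr// ler_peMr ?ler1n// ltW.
have oB6 := open_ball_setR R b r6.
have sub65 : [set t | `|t - b| < r6] `<=` [set t | `|t - b| < r5] by exact: r65.
have sxA6 : smooth [set t | `|t - b| < r6] (fun t => x' t *m A t).
  move=> n; apply: (Ck_mulmx oB6); last exact: sA.
  by apply: (Ck_sub _ (sx'3 n)) => t tr; apply: r53; exact: r65.
have [g [gb sg g']] := antiderivative (gamma b) r60 sxA6.
pose r7 := r6 / 2; have r70 : 0 < r7 by rewrite divr_gt0.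
have r76 t : `|t - b| < r7 -> `|t - b| < r6.
  by move=> h; rewrite (lt_le_trans h)// ler_pdivrMr// ler_peMr ?ler1n// ltW.
have iB : is_interval [set t : R | `|t - b| < r7] := @ball_interval R b r7.
have iIB : is_interval (I `&` [set t | `|t - b| < r7]).
  move=> s t [Is sr] [It tr] u su; split; first exact: (cd_itv H Is It su).
  exact: (iB s t sr tr u su).
have dA t : `|t - b| < r6 -> differentiable A t by move=> tr; exact: smooth_diff sA tr.
have dgg t : `|t - b| < r7 -> differentiable g t by move=> tr; exact: smooth_diff sg tr.
have AL t : `|t - b| < r7 -> A t *m L = 1%:M.
  move=> tr; rewrite -(A1L b (b0 _ r10)) -Ab.
  apply: (@derive1_eq_eq _ _ _ _ (fun s => A s *m L) (fun _ => A b *m L) b t iB) => //.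
    exact: b0.
  move=> s /r76 sr; split; [|exact: differentiable_const|].
    by apply: differentiable_mulmx; [exact: dA|exact: differentiable_const].
  by rewrite derive1_cst derive1_mulmxr ?A' -?mulmxA ?betaL ?mulmx0//; [exact: r65|exact: dA].
have AA1 t : I t -> `|t - b| < r7 -> A t = A1 t.
  move=> It tr; apply: (derive1_eq_eq iIB (conj Ib (b0 _ r70)) (conj It tr)) Ab.
  move=> s [Is /r76 sr]; split; first exact: dA.
    by apply: dA1; apply: r31; apply: r53; exact: r65.
  by rewrite (A' s sr) (A1' s Is (r65 _ sr)).
have g'L t : `|t - b| < r7 -> derive1 g t *m L = x' t.
  by move=> tr; rewrite (g' t tr) -mulmxA (AL t tr) mulmx1.
exists L, r7, A, g, a, beta; split; first exact: r70.
  split.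
  - exact: open_ball_setR.
  - by apply: smooth_sub sA; exact: r76.
  - exact: sg.
  - by apply: smooth_sub sa => t tr; apply: r65; exact: r76.
  - exact: AL.
  - by move=> t tr; rewrite (g'L t tr); exact: g'.
  - by move=> t tr; exact: A' (r76 _ tr).
  - move=> t tr; have ft : f t != 0 by apply: f0; apply: r65; exact: r76.
    rewrite (g'L t tr) xa; apply/eqP => /matrixP/(_ 0 0)/eqP.
    by rewrite !mxE eqxx mulr1n (negbTE ft).
  - move=> t tr; have ft : f t != 0 by apply: f0; apply: r65; exact: r76.
    apply/eqP => /rowP/(_ j); rewrite /beta mxE -/(f t) [RHS]mxE mulVf// => /eqP.
    by rewrite oner_eq0.
move=> t It tr; split; last first.
  by rewrite (AA1 t It tr); apply: DA1 => //; apply: r31; apply: r53; apply: r65; exact: r76.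
apply: (derive1_eq_eq iIB (conj Ib (b0 _ r70)) (conj It tr)) gb.
move=> s [Is sr]; split; [exact: dgg|exact: dg|].
rewrite (g' s sr) (AA1 s Is sr); apply: esym; apply: gD => //.
by apply: r31; apply: r53; apply: r65; exact: r76.
Qed.

End Developable.

Section EmbeddingCriterion.
Variables (R : realType) (V W : normedModType R).

(** With [e] arbitrary the right-hand side contains injectivity as well. In this form the condition
    can be checked on glued curves without exhibiting an inverse. *)
Lemma embedding_inverse (S : set V) (f : V -> W) :
  (exists g : W -> V, (forall x, S x -> g (f x) = x) /\ {within f @` S, continuous g}) <->
  (forall t, S t -> forall e : R, 0 < e -> exists2 d : R, 0 < d &
     forall s, S s -> `|f s - f t| < d -> `|s - t| < e).
Proof.
split=> [[g [gf cg]] t St e e0|Hf].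
  have [d d0 Hd] := (within_continuousP _ _).1 cg (f t) (ex_intro2 _ _ t St erefl) e e0.
  exists d => // s Ss sd; have := Hd (f s) (ex_intro2 _ _ s Ss erefl) sd.
  by rewrite !gf.
pose g y := xget 0 [set x | S x /\ f x = y].
have gf x : S x -> g (f x) = x.
  move=> Sx; have [Sg fg] : [set y | S y /\ f y = f x] (g (f x)).
    by apply: (xgetPex 0); exists x.
  apply/eqP; rewrite -subr_eq0 -normr_le0; apply/ler_addgt0Pl => e e0; rewrite addr0.
  have [d d0 Hd] := Hf x Sx e e0; apply: ltW; apply: Hd => //.
  by rewrite fg subrr normr0.
exists g; split=> //; apply/within_continuousP => _ [t St <-] e e0.
have [d d0 Hd] := Hf t St e e0; exists d => // _ [s Ss <-] sd.
by rewrite !gf//; exact: Hd.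
Qed.

End EmbeddingCriterion.

Lemma half_le_of_dist (R : realFieldType) (a b c : R) : a <= b + c -> b < a / 2 -> a / 2 <= c.
Proof. lra. Qed.

Section Pieces.
Variables (R : realType) (N m : nat).
Local Notation E := 'rV[R]_N.

Lemma Ck_bigcup (V W : normedModType R) n (P : set (set V)) : forall f : V -> W,
  (forall O, P O -> Ck n O f) -> Ck n (\bigcup_(O in P) O) f.
Proof.
elim: n => [|n IH] f Hf; first by move=> x [ O PO Ox]; exact: (Hf O PO).
split=> [x [ O PO Ox]|v]; first exact: (Hf O PO).1.
by apply: IH => O PO; exact: (Hf O PO).2.
Qed.

Lemma smooth_local (V W : normedModType R) (S : set V) (f : V -> W) :
  (forall t, S t -> exists O, [/\ open O, O t & smooth O f]) ->
  exists O, [/\ open O, S `<=` O & smooth O f].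
Proof.
move=> Hf; exists (\bigcup_(O in [set O | open O /\ smooth O f]) O); split.
- by apply: bigcup_open => O [].
- by move=> t /Hf[ O [oO Ot sO]]; exists O.
- by move=> n; apply: Ck_bigcup => O [_]; exact.
Qed.

Lemma near_derive1 (W : normedModType R) (f g : R -> W) t :
  (\forall u \near t, f u = g u) -> derive1 f t = derive1 g t.
Proof. by move=> fg; rewrite !derive1E; apply: near_eq_derive. Qed.

Lemma near_derive1n2 (W : normedModType R) (f g : R -> W) t :
  (\forall u \near t, f u = g u) -> derive1n 2 f t = derive1n 2 g t.
Proof.
have D2 (h : R -> W) : derive1n 2 h = derive1 (derive1 h) by rewrite derive1nS derive1n1.
move=> fg; rewrite !D2; apply: near_derive1.
by apply: filterS (nbhs_interior fg) => u; exact: near_derive1.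
Qed.

(** One coordinate of the velocity stays away from 0 near [b]; by the mean value theorem that
    coordinate alone separates parameters at a linear rate. *)
Lemma immersion_lipschitz (g : R -> E) O b : open O -> smooth O g -> O b -> derive1 g b != 0 ->
  exists e c : R, [/\ 0 < e, 0 < c, (forall s, `|s - b| < e -> O s) &
    forall s t, `|s - b| < e -> `|t - b| < e -> c * `|s - t| <= `|g s - g t|].
Proof.
move=> oO sg Ob g'b; have /existsP[j gj] : [exists j, derive1 g b 0 j != 0].
  apply: contraNT g'b => /existsPn h; apply/eqP/rowP => j; rewrite [RHS]mxE.
  by have := h j; rewrite negbK => /eqP.
pose k := derive1 g b 0 j; have k0 : 0 < `|k| / 2 by rewrite divr_gt0 ?normr_gt0.
have cf : {for b, continuous (fun s => derive1 g s 0 j)}.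
  exact: (Ck_coord 0 j oO (smooth_derive1 sg 0%N)).
have [e1 e10 H1] := continuous_ball cf k0; have [e2 e20 H2] := open_ballR oO Ob.
exists (Num.min e1 e2), (`|k| / 2); split=> //; first by rewrite lt_min e10.
  by move=> s; rewrite lt_min => /andP[_]; exact: H2.
move=> s t sb tb; have iB : is_interval [set u : R | `|u - b| < Num.min e1 e2] := @ball_interval R b _.
have dg u : `|u - b| < Num.min e1 e2 -> differentiable g u.
  by rewrite lt_min => /andP[_ /H2 Ou]; exact: smooth_diff sg Ou.
have [|u u01 E0] := @mvt_segment R R^o (fun u => g u 0 j : R) t s.
  move=> u u01; have ub := interval_segment iB tb sb u01.
  by apply: (differentiable_comp' (f := fun M : E => M 0 j) (dg _ ub)); exact: differentiable_coord.
have ub := interval_segment iB tb sb u01.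
have E1 := etrans E0 (esym (derive_coord (s - t : R^o) 0 j (dg _ ub))).
rewrite (le_trans _ (rV_norm_coord (g s - g t) j))//.
have -> : (g s - g t) 0 j = (s - t) * derive1 g (t + u * (s - t)) 0 j.
  rewrite !mxE; apply: (etrans E1); have -> := derive_scale1 (s - t) (dg _ ub).
  by rewrite mxE.
rewrite normrM mulrC ler_wpM2l//.
move: ub; rewrite /= lt_min => /andP[/H1 + _]; rewrite -/k.
set y := derive1 g _ 0 j; move=> yk.
have := ler_distD y k 0; rewrite !subr0 distrC => h.
exact: half_le_of_dist h yk.
Qed.

End Pieces.

(** * Curvature and rank of developable data *)

Section DevelopableFacts.
Variables (R : realType) (N m : nat).
Local Notation E := 'rV[R]_N.
Variables (O : set R) (L : 'M[R]_(N, m)) (A : R -> 'M[R]_(m, N)) (g : R -> E)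
  (a : R -> 'M[R]_(m, 1)) (beta : R -> E).
Hypothesis dv : developable O L A g a beta.

Lemma dev_gram t : O t -> gram_unit (A t).
Proof.
by move=> Ot; apply/gram_unitP => z zA; rewrite -[z]mulmx1 -(dv_L dv Ot) mulmxA zA mul0mx.
Qed.

Lemma dev_regular t : O t -> derive1 g t != 0.
Proof. by move=> /(dv_trans dv); apply: contraNneq => ->; rewrite !mul0mx. Qed.

(** Differentiating [g' = (g' L) A] splits the acceleration into a vector of the row space and a
    multiple of [beta t], whose coefficient is nonzero by [dv_trans]. *)
Lemma dev_second t : O t ->
  derive1n 2 g t = derive1n 2 g t *m L *m A t + derive1 g t *m L *m a t *m beta t.
Proof.
move=> Ot; have D2 : derive1n 2 g = derive1 (derive1 g) by rewrite derive1nS derive1n1.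
have dg' : differentiable (derive1 g) t := smooth_diff (smooth_derive1 (dv_g dv)) Ot.
have dgL : differentiable (fun s => derive1 g s *m L) t.
  by apply: differentiable_mulmx => //; exact: differentiable_const.
have dA : differentiable A t := smooth_diff (dv_A dv) Ot.
rewrite D2 -(derive1_mulmxr L dg') -[_ *m a t *m _]mulmxA -(dv_A' dv Ot).
rewrite -(derive1_mulmx dgL dA); apply: near_derive1.
by apply: (near_open (dv_open dv) Ot) => s; exact: (dv_g' dv).
Qed.

Lemma mul_row11 (v : 'rV[R]_m) (c : 'M[R]_(m, 1)) (b : E) : v *m c *m b = (v *m c) 0 0 *: b.
Proof. by rewrite {1}[v *m c]mx11_scalar mul_scalar_mx. Qed.

Lemma entry_neq0 (v : 'rV[R]_m) (c : 'M[R]_(m, 1)) : v *m c != 0 -> (v *m c) 0 0 != 0.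
Proof. by apply: contraNneq => h; rewrite [v *m c]mx11_scalar h raddf0. Qed.

Lemma dev_curved t (U : {vspace E}) : O t -> [set` U] = rowsp (A t) ->
  perp_proj [set` U] (derive1n 2 g t) != 0.
Proof.
move=> Ot UA; apply/eqP => /perp_proj_eq0 h; have : [set` U] (derive1n 2 g t) by [].
rewrite UA => -[z zE]; have zL : derive1n 2 g t *m L = z.
  by rewrite zE -mulmxA (dv_L dv Ot) mulmx1.
have := dev_second Ot; rewrite zL -zE => /eqP; rewrite eq_sym -subr_eq0 addrAC subrr add0r.
rewrite mul_row11 scaler_eq0 (negbTE (dv_beta dv Ot)) orbF.
by rewrite (negbTE (entry_neq0 (dv_trans dv Ot))).
Qed.

(** Modulo the row space, both the derivative of the frame and the acceleration are multiples of
    [beta t], the latter with nonzero coefficient. *)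
Lemma dev_rank I gamma D t : cauchy_data m I gamma D -> I t -> O t ->
  (\forall u \near t, gamma u = g u) ->
  (\forall u \near t, I u -> [set` D u] = rowsp (A u)) -> has_dim (im_rho I D t) 1%N.
Proof.
move=> H It Ot gg DA; have dA : differentiable A t := smooth_diff (dv_A dv) Ot.
apply/(rank_frameP H It dA DA) => z.
exists ((z *m a t) 0 0 / (derive1 g t *m L *m a t) 0 0).
rewrite (near_derive1n2 gg) (dev_second Ot) (dv_A' dv Ot) mulmxA !mul_row11.
rewrite scalerDr scalerA divfK ?(entry_neq0 (dv_trans dv Ot))// opprD addrCA subrr addr0 -scaleNr scalemxAl.
have : rowsp (A t) ((- ((z *m a t) 0 0 / (derive1 g t *m L *m a t) 0 0)) *: (derive1n 2 g t *m L) *m A t).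
  by eexists; reflexivity.
by rewrite -(nbhs_singleton DA It).
Qed.

End DevelopableFacts.

(** * Extending the data to an open interval *)

Section Extension.
Variables (R : realType) (N m : nat).
Local Notation E := 'rV[R]_N.

Lemma interior_between (I : set R) s t u : is_interval I -> I s -> I u -> s < t < u -> I° t.
Proof.
move=> iI Is Iu /andP[st tu].
have e0 : 0 < Num.min (t - s) (u - t) by rewrite lt_min !subr_gt0 st.
apply: (ball_nbhsR e0) => v; rewrite lt_min => /andP[v1 v2]; apply: (iI _ _ Is Iu).
move: v1 v2; rewrite !ltr_norml => /andP[h1 h2] /andP[h3 h4]; apply/andP; split; lra.
Qed.

(** All of [I] lies on the same side of [b] as the interior point [c], since otherwise [b] would sit
    between two points of [I]; the points between [b] and [c] are interior. *)
Lemma endpoint_side (I : set R) b : is_interval I -> I° !=set0 -> I b -> ~ I° b ->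
  exists2 d : R, 0 < d & forall t, I t -> t != b -> `|t - b| < d -> I° t.
Proof.
move=> iI [c Ic] Ib nb; have cb : c != b by apply: contra_notN nb => /eqP <-.
have Ic' := interior_subset Ic.
exists `|c - b|; first by rewrite normr_gt0 subr_eq0.
move=> t It tb td; move: cb tb; rewrite !neq_lt => /orP[cb|bc] /orP[tb|bt].
- apply: (interior_between iI Ic' Ib); rewrite tb andbT.
  move: td; rewrite (ltr0_norm (_ : c - b < 0)) ?subr_lt0// ltr_norml => /andP[]; lra.
- by case: nb; apply: (interior_between iI Ic' It); rewrite cb.
- by case: nb; apply: (interior_between iI It Ic'); rewrite tb.
apply: (interior_between iI Ib Ic'); rewrite bt /=.
move: td; rewrite (gtr0_norm (_ : 0 < c - b)) ?subr_gt0// ltr_norml => /andP[]; lra.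
Qed.

(** Rows indexed by all natural numbers, with default 0, as the families in [smooth_distribution]
    and [adapted_frame] are. *)
Definition mx_rows k (A : 'M[R]_(k, N)) (i : nat) : E :=
  if insub i is Some j then row j A else 0.

Lemma span_mx_rows k (A : 'M[R]_(k, N)) : [set` <<mkseq (mx_rows A) k>>%VS] = rowsp A.
Proof.
have E0 : A = \matrix_(i < k) mx_rows A i.
  by apply/row_matrixP => i; rewrite rowK /mx_rows valK.
by apply/seteqP; split=> v; [move=> /span_rows|rewrite {1}E0 => /span_rows]; rewrite -?E0.
Qed.

Lemma rank_transfer I gamma (D : R -> {vspace E}) I' gamma' D' t :
  cauchy_data m I gamma D -> cauchy_data m I' gamma' D' -> I t -> I' t ->
  (\forall u \near t, gamma' u = gamma u) ->
  (\forall u \near t, I' u -> I u /\ D' u = D u) ->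
  has_dim (im_rho I D t) 1%N -> has_dim (im_rho I' D' t) 1%N.
Proof.
move=> H H' It It' gg DD rk; have [A [r [r0 sA uA DA]]] := local_frame H It.
have oB := open_ball_setR R t r.
have Bt : `|t - t| < r by rewrite subrr normr0.
have dA : differentiable A t := smooth_diff sA Bt.
have DAn : \forall u \near t, I u -> [set` D u] = rowsp (A u).
  by apply: (near_open oB Bt) => u; exact: DA.
have DAn' : \forall u \near t, I' u -> [set` D' u] = rowsp (A u).
  by apply: filterS2 DAn DD => u DAu DDu I'u; have [Iu ->] := DDu I'u; exact: DAu.
have [_ DDt] := nbhs_singleton DD It'.
apply/(rank_frameP H' It' dA DAn') => z.
have [c zc] := (rank_frameP H It dA DAn).1 rk z.
by exists c; rewrite (near_derive1n2 gg) DDt.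
Qed.

Lemma vspace_set_inj (U V : {vspace E}) : [set` U] = [set` V] -> U = V.
Proof.
move=> UV; apply/vspaceP => v.
by apply/idP/idP => h; [have : [set` V] v by rewrite -UV|have : [set` U] v by rewrite UV].
Qed.

(** Around an endpoint the data are replaced by developable ones that agree with them on [I]. The
    only condition that is not local is embeddedness: the added arc must avoid the remote part of
    the curve, which keeps a positive distance from [gamma b]. *)
Lemma extend_at I gamma (D : R -> {vspace E}) b : cauchy_data m I gamma D ->
  (forall t, I t -> has_dim (im_rho I D t) 1%N) -> I b ->
  exists I' gamma' D', [/\ cauchy_data m I' gamma' D',
    forall t, I' t -> has_dim (im_rho I' D' t) 1%N, I `<=` I', I'° b &
    forall t, I t -> gamma' t = gamma t /\ D' t = D t].
Proof.
move=> H rk Ib; have [Ib'|nb] := pselect (I° b); first by exists I, gamma, D; split.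
have [d d0 side] := endpoint_side (cd_itv H) (cd_nondeg H) Ib nb.
have [L [r [A [g [a [beta [r0 dv gD]]]]]]] := local_developable H Ib rk.
have bb e : 0 < e -> `|b - b| < e by rewrite subrr normr0.
have [e1 [c [e10 c0 e1O lip]]] := immersion_lipschitz (dv_open dv) (dv_g dv) (bb _ r0) (dev_regular dv (bb _ r0)).
have [gb _] := gD b Ib (bb _ r0).
have [_ gimm /embedding_inverse gemb] := cd_emb H.
have [de de0 Hde] := gemb b Ib e1 e10.
have de20 : 0 < de / 2 by rewrite divr_gt0.
have [e2 e20 H2] := continuous_ball (smooth_cont (dv_g dv) (bb _ r0)) de20.
(* Below [d] the other points of [I] are interior, below [r] the developable data exist, below [e1]
   the curve [g] is expanding up to a constant, and below [e2] the added arc stays within [de / 2]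
   of [gamma b]. *)
pose e := Num.min (Num.min (d / 2) (r / 2)) (Num.min e1 e2).
have e0 : 0 < e by rewrite !lt_min !divr_gt0 ?d0 ?r0 ?e10.
have h2 (x : R) : 0 < x -> x / 2 < x by move=> x0; rewrite ltr_pdivrMr// ltr_pMr// ltr1n.
have ed x : x <= e -> x < d by rewrite !le_min => /andP[/andP[h _] _]; rewrite (le_lt_trans h)// h2.
have er x : x <= e -> x < r by rewrite !le_min => /andP[/andP[_ h] _]; rewrite (le_lt_trans h)// h2.
have ee1 x : x < e -> x < e1 by rewrite !lt_min => /andP[_ /andP[]].
have ee2 x : x < e -> x < e2 by rewrite !lt_min => /andP[_ /andP[]].
clearbody e.
pose B := [set t : R | `|t - b| < e].
have oB : open B := open_ball_setR R b e.
pose I' := [set t | I t \/ B t].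
pose gamma' t := if `|t - b| < e then g t else gamma t.
pose D' t := if `|t - b| < e then <<mkseq (mx_rows (A t)) m>>%VS else D t.
have agree t : I t -> gamma' t = gamma t /\ D' t = D t.
  move=> It; rewrite /gamma' /D'; case: ifP => // tb.
  have [-> Dt] := gD t It (er _ (ltW tb)); split=> //.
  by apply: vspace_set_inj; rewrite span_mx_rows Dt.
have Br t : B t -> `|t - b| < r by move=> /ltW; exact: er.
have locB t : B t -> \forall u \near t, gamma' u = g u /\ [set` D' u] = rowsp (A u).
  move=> Bt; apply: (near_open oB Bt) => u Bu; rewrite /gamma' /D' ifT//.
  by split=> //; rewrite ifT// span_mx_rows.
have locI t : I' t -> ~ B t -> I t /\ \forall u \near t,
    [/\ gamma' u = gamma u, D' u = D u & I' u -> I u].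
  move=> [It|//] nBt; split=> //.
  (* At distance exactly [e] the definition of [gamma'] switches; such a point is interior to [I],
     where the two branches agree. *)
  have := nBt; rewrite /B /= => /negP; rewrite -leNgt le_eqVlt => /orP[/eqP te|te].
    have tb : t != b by apply: contraTneq e0 => tb; rewrite te tb subrr normr0 ltxx.
    have te' : `|t - b| <= e by rewrite -te.
    have := side t It tb (ed _ te').
    by apply: filterS => u Iu; have [-> ->] := agree u Iu.
  have te0 : 0 < `|t - b| - e by rewrite subr_gt0.
  apply: (ball_nbhsR te0) => u ut.
  have : (`|u - b| < e) = false.
    apply/negbTE; rewrite -leNgt; have := ler_distD u t b; rewrite (distrC t u) => h.
    by apply: ltW; rewrite -(ltrD2l `|u - t|); apply: lt_le_trans h; rewrite -ltrBrDr.
  rewrite /gamma' /D' => ub; rewrite ub; split=> // -[//|].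
  by rewrite /B /= ub.
have II' : I `<=` I' by left.
have g'cases t : I' t -> (B t /\ derive1 gamma' t = derive1 g t /\ [set` D' t] = rowsp (A t)
      /\ derive1n 2 gamma' t = derive1n 2 g t) \/
    [/\ ~ B t, I t, derive1 gamma' t = derive1 gamma t, D' t = D t &
      derive1n 2 gamma' t = derive1n 2 gamma t].
  move=> I't; have [Bt|nBt] := pselect (B t); [left|right].
    have gg : \forall u \near t, gamma' u = g u by apply: filterS (locB t Bt) => u [].
    have [_ Dt] := nbhs_singleton (locB t Bt).
    by rewrite (near_derive1 gg) (near_derive1n2 gg).
  have [It nI] := locI t I't nBt.
  have gg : \forall u \near t, gamma' u = gamma u by apply: filterS nI => u [].
  have [_ Dt _] := nbhs_singleton nI.
  by rewrite (near_derive1 gg) (near_derive1n2 gg).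
have I'itv : is_interval I'.
  have iB : is_interval B := @ball_interval R b e.
  have Bb : B b by exact: bb.
  move=> s t [Is|Bs] [It|Bt] u /andP[su ut].
  - by left; apply: (cd_itv H Is It); rewrite su.
  - have [ub|bu] := leP u b; first by left; apply: (cd_itv H Is Ib); rewrite su.
    by right; apply: (iB _ _ Bb Bt); rewrite (ltW bu).
  - have [ub|bu] := leP u b; first by right; apply: (iB _ _ Bs Bb); rewrite su.
    by left; apply: (cd_itv H Ib It); rewrite (ltW bu).
  - by right; apply: (iB _ _ Bs Bt); rewrite su.
have H' : cauchy_data m I' gamma' D'.
  split.
  - exact: I'itv.
  - by have [s Is] := cd_nondeg H; exists s; exact: (interiorS II' Is).
  - split.
    + have [|O' [oO' I'O sO']] := @smooth_local R _ _ I' gamma'.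
        move=> t I't; have [Bt|nBt] := pselect (B t).
          exists B; split=> //; apply: (smooth_ext (f := g)) => //.
            by move=> u Bu; rewrite /gamma' ifT.
          by apply: smooth_sub (dv_g dv) => u; exact: Br.
        have [It nI] := locI t I't nBt; have [ O [oO IO sO]] := gamma_smooth H.
        have [e3 e30 H3] := nbhs_ballR nI; have [e4 e40 H4] := open_ballR oO (IO t It).
        exists [set u | `|u - t| < Num.min e3 e4]; split; first exact: open_ball_setR.
          by rewrite /= subrr normr0 lt_min e30.
        apply: (smooth_ext (f := gamma)) (open_ball_setR _ _ _) _ _.
          by move=> u /=; rewrite lt_min => /andP[/H3[-> _ _] _].
        by apply: smooth_sub sO => u /=; rewrite lt_min => /andP[_]; exact: H4.
      exact: smooth_smooth_on oO' I'O sO'.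
    + move=> t v I't; have nz : derive1 gamma' t != 0.
        have [[Bt [-> _]]|[_ It -> _ _]] := g'cases t I't; first exact: (dev_regular dv (Br t Bt)).
        apply/eqP => E0; have := gimm t (1 : R) It; rewrite -derive1E E0 => /(_ erefl)/eqP.
        by rewrite oner_eq0.
      have dg : differentiable gamma' t.
        have [Bt|nBt] := pselect (B t).
          apply: near_eq_differentiable (smooth_diff (dv_g dv) (Br t Bt)).
          by apply: filterS (locB t Bt) => u [->].
        have [It nI] := locI t I't nBt; have [ O [oO IO sO]] := gamma_smooth H.
        apply: near_eq_differentiable (smooth_diff sO (IO t It)).
        by apply: filterS nI => u [->].
      move=> E0; have E1 := esym (derive_scale1 v dg); rewrite E0 in E1.
      by move/eqP: E1; rewrite scaler_eq0 (negbTE nz) orbF => /eqP.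
    (* A point of the old curve coming close to the added arc is close to [gamma b], so its
       parameter falls into the range where [g] separates parameters. *)
    + have far s t : I s -> B t -> `|gamma s - g t| < de / 2 -> `|s - b| < e1.
        move=> Is Bt st; apply: Hde => //; rewrite (le_lt_trans (ler_distD (g t) _ _))//.
        by rewrite (splitr de) ltrD// -gb; apply: H2; exact: ee2.
      have near1 s t : `|s - b| < e1 -> `|t - b| < e1 ->
          forall k, 0 < k -> `|g s - g t| < c * k -> `|s - t| < k.
        by move=> se te k k0 h; rewrite -(ltr_pM2l c0) (le_lt_trans (lip s t se te)).
      have gg s : I' s -> `|s - b| < e1 -> gamma' s = g s.
        move=> I's se; case: I's => [Is|Bs]; last by rewrite /gamma' ifT.
        by rewrite (agree s Is).1; have [-> _] := gD s Is (e1O s se).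
      apply/embedding_inverse => t I't k k0; have ck : 0 < c * k by rewrite mulr_gt0.
      have [Bt|nBt] := pselect (B t).
        have gt : gamma' t = g t by rewrite /gamma' ifT.
        exists (Num.min (c * k) (de / 2)); first by rewrite lt_min ck.
        move=> s I's; rewrite lt_min gt => /andP[sk sd].
        have [se|se] := ltP `|s - b| e1.
          by apply: (near1 s t se (ee1 _ Bt) k k0); rewrite -(gg s I's se).
        have Is : I s by case: I's => // /ee1; rewrite ltNge se.
        by move: se; rewrite leNgt (far s t Is Bt)// -(agree s Is).1.
      have [It _] := locI t I't nBt; have [dt dt0 Hdt] := gemb t It k k0.
      exists (Num.min dt (Num.min (c * k) (de / 2))); first by rewrite !lt_min dt0 ck.
      move=> s I's; rewrite !lt_min => /and3P[s1 s2 s3].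
      have [Is|nIs] := pselect (I s).
        by apply: Hdt => //; rewrite -(agree s Is).1 -(agree t It).1.
      have Bs : B s by case: I's.
      have gs : gamma' s = g s by rewrite /gamma' ifT.
      have te1 : `|t - b| < e1.
        by apply: (far t s It Bs); rewrite -gs -(agree t It).1 distrC.
      by apply: (near1 s t (ee1 _ Bs) te1 k k0); rewrite -gs -(gg t I't te1).
  - split=> [t I't|t I't].
      have [[Bt [_ [Dt _]]]|[_ It _ -> _]] := g'cases t I't; last exact: (cd_dist H).1.
      by apply/(dim_rowsp Dt); exact: (dev_gram dv (Br t Bt)).
    have [Bt|nBt] := pselect (B t).
      exists (fun i u => mx_rows (A u) i); split.
        move=> i im; apply: (smooth_smooth_on oB); first by move=> _ ->.
        rewrite /mx_rows insubT => n; apply: Ck_mx_of => // k j.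
        apply: (@Ck_ext _ _ _ _ _ oB (fun u => A u (Ordinal im) j)); first by move=> u _; rewrite mxE.
        apply: Ck_coord => //; apply: (Ck_sub _ (dv_A dv n)); exact: Br.
      by apply: (near_open oB Bt) => u Bu _; rewrite /D' ifT.
    have [It nI] := locI t I't nBt; have [f [sf Df]] := (cd_dist H).2 t It.
    exists f; split=> //; apply: filterS2 nI Df => u [_ -> I'u] Dfu I'u'.
    by apply: Dfu; exact: I'u.
  - move=> t I't; have [[Bt [-> [Dt _]]]|[_ It -> -> _]] := g'cases t I't; last exact: (cd_tan H).
    have : rowsp (A t) (derive1 g t) by rewrite (dv_g' dv (Br t Bt)); eexists; reflexivity.
    by rewrite -Dt.
  - move=> t I't; have [[Bt [_ [Dt ->]]]|[_ It _ -> ->]] := g'cases t I't; last exact: (cd_curv H).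
    exact: (dev_curved dv (Br t Bt) Dt).
exists I', gamma', D'; split=> //; last by apply: (ball_nbhsR e0) => u ub; right.
move=> t I't; have [Bt|nBt] := pselect (B t).
  apply: (dev_rank dv H' I't (Br t Bt)).
    by apply: filterS (locB t Bt) => u [].
  by apply: filterS (locB t Bt) => u [].
have [It nI] := locI t I't nBt; apply: (rank_transfer H H' It I't) (rk t It).
  by apply: filterS nI => u [].
by apply: filterS nI => u [_ -> h] I'u; split=> //; exact: h.
Qed.

(** At most two points of an interval are not interior to it, so two extensions suffice; the
    interior of the result is the open interval wanted. *)
Lemma open_extension I gamma (D : R -> {vspace E}) : cauchy_data m I gamma D ->
  (forall t, I t -> has_dim (im_rho I D t) 1%N) ->
  exists J gamma' D', [/\ open J, cauchy_data m J gamma' D',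
    forall t, J t -> has_dim (im_rho J D' t) 1%N, I `<=` J &
    forall t, I t -> gamma' t = gamma t /\ D' t = D t].
Proof.
move=> H rk; have [I1 [g1 [D1 [H1 rk1 II1 I1I ag]]]] : exists I' gamma' D',
  [/\ cauchy_data m I' gamma' D', forall t, I' t -> has_dim (im_rho I' D' t) 1%N,
   I `<=` I', I `<=` I'° & forall t, I t -> gamma' t = gamma t /\ D' t = D t].
  have [[b [Ib nb]]|nb] := pselect (exists b, I b /\ ~ I° b); last first.
    exists I, gamma, D; split=> // t It; apply/not_notP => nt; apply: nb; by exists t.
  have [I1 [g1 [D1 [H1 rk1 II1 I1b ag1]]]] := extend_at H rk Ib.
  have [[c [Ic nc]]|nc] := pselect (exists c, I c /\ ~ I1° c); last first.
    by exists I1, g1, D1; split=> // t It; apply/not_notP => nt; apply: nc; exists t.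
  have [I2 [g2 [D2 [H2 rk2 I12 I2c ag2]]]] := extend_at H1 rk1 (II1 _ Ic).
  exists I2, g2, D2; split=> //.
  - by move=> t /II1; exact: I12.
  (* Three distinct points of [I] that are not interior are impossible: one of them lies between the
     other two. *)
  - move=> e Ie; apply/not_notP => ne.
    have ic : ~ I° c by move/(interiorS II1).
    have ie1 : ~ I1° e by move/(interiorS I12).
    have ie : ~ I° e by move/(interiorS II1).
    have bc : b != c by apply/eqP => bc; rewrite -bc in nc.
    have ce : c != e by apply/eqP => ce; rewrite -ce in ne.
    have be : b != e by apply/eqP => be; rewrite -be in ie1.
    have btw s t u : I s -> I u -> ~ I° t -> ~ (s < t < u).
      by move=> Is Iu nt /(interior_between (cd_itv H) Is Iu).
    move: bc ce be; rewrite !neq_lt => /orP[h1|h1] /orP[h2|h2] /orP[h3|h3].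
    + by apply: (btw b c e) => //; rewrite h1.
    + by move: (lt_trans h1 h2) => /(lt_trans h3); rewrite ltxx.
    + by apply: (btw b e c) => //; rewrite h3.
    + by apply: (btw e b c) => //; rewrite h3.
    + by apply: (btw c b e) => //; rewrite h1.
    + by apply: (btw c e b) => //; rewrite h2.
    + by move: (lt_trans h2 h1) => /(lt_trans h3); rewrite ltxx.
    + by apply: (btw e c b) => //; rewrite h2.
  - move=> t It; have [<- <-] := ag1 t It; exact: ag2 (II1 _ It).
have oJ : open I1° := @open_interior _ I1.
have JI t : I1° t -> I1 t by exact: interior_subset.
have HJ : cauchy_data m I1° g1 D1.
  split.
  - move=> s t Is It u /andP[]; rewrite !le_eqVlt => /orP[/eqP <-//|su] /orP[/eqP ->//|ut].
    by apply: (interior_between (cd_itv H1) (JI _ Is) (JI _ It)); rewrite su.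
  - by have [s Is] := cd_nondeg H1; exists s; exact: nbhs_interior Is.
  - have [[ O [oO IO hO]] imm /embedding_inverse emb] := cd_emb H1; split.
    + by exists O; split=> // t /JI/IO.
    + by move=> t v /JI; exact: imm.
    + apply/embedding_inverse => t /JI It e e0; have [d d0 Hd] := emb t It e e0.
      by exists d => // s /JI; exact: Hd.
  - split=> [t /JI/(cd_dist H1).1//|t /JI/(cd_dist H1).2[f [sf Df]]].
    by exists f; split=> //; apply: filterS Df => u Dfu /JI.
  - by move=> t /JI/(cd_tan H1).
  - by move=> t /JI/(cd_curv H1).
exists I1°, g1, D1; split=> // t Jt.
apply: (rank_transfer H1 HJ (JI t Jt) Jt _ _ (rk1 t (JI t Jt))).
  by apply: (near_open openT Logic.I).
by apply: (near_open openT Logic.I) => u _ /JI.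
Qed.

End Extension.

(** * The ruled solution *)

Section DevelopableMap.
Variables (R : realType) (N m : nat).
Local Notation E := 'rV[R]_N.
Variables (O : set R) (L : 'M[R]_(N, m)) (A : R -> 'M[R]_(m, N)) (g : R -> E)
  (a : R -> 'M[R]_(m, 1)) (beta : R -> E).
Hypothesis dv : developable O L A g a beta.

Lemma derive_compR (V W : normedModType R) (h : R -> W) (f : V -> R) x b :
  differentiable f x -> differentiable h (f x) ->
  'D_b (fun x => h (f x)) x = 'D_b f x *: derive1 h (f x).
Proof. by move=> df dh; rewrite (derive_comp b df dh); exact: derive_scale1. Qed.

Lemma entry11_eq0 (c : 'M[R]_1) : c 0 0 = 0 -> c = 0.
Proof. by move=> c0; rewrite [c]mx11_scalar c0 raddf0. Qed.

Lemma diff_id (y : 'rV[R]_m) : differentiable (fun y : 'rV[R]_m => y) y.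
Proof. exact: ex_diff. Qed.

Lemma derive_form (C : 'M[R]_(m, 1)) (c k : R) y v :
  'D_v (fun y : 'rV[R]_m => c + (y *m C) 0 0 / k) y = (v *m C) 0 0 / k.
Proof.
have dl : differentiable (fun y : 'rV[R]_m => y *m (k^-1 *: C)) y.
  by apply: differentiable_mulmx; [exact: ex_diff|exact: differentiable_const].
have df : differentiable (fun y : 'rV[R]_m => const_mx c + y *m (k^-1 *: C)) y.
  by apply: differentiableD => //; exact: differentiable_const.
have -> : (fun y : 'rV[R]_m => c + (y *m C) 0 0 / k) =
    (fun y => (const_mx c + y *m (k^-1 *: C)) 0 0).
  apply/funext => z; rewrite [RHS]mxE; congr (_ + _); first by rewrite mxE.
  by rewrite -scalemxAr [RHS]mxE mulrC.
apply: (etrans (esym (derive_coord v 0 0 df))).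
rewrite deriveD; [|exact: diff_derivable (differentiable_const _ _)|exact: diff_derivable dl].
rewrite derive_cst add0r (derive_mulmxr _ v (diff_id y)) derive_id -scalemxAr.
by rewrite [LHS]mxE mulrC.
Qed.

(* The line [t = t0, z = y] of the ruling parameters is straightened by the projections [Q t]
   along [d] onto the kernel of [a t]. *)
Lemma ruling_coordinates t0 : O t0 -> exists W (tau : 'rV[R]_m -> R) (del : R),
  [/\ open W, smooth W tau, 0 < del,
   (forall x, W x -> O (tau x) /\ (x - g (tau x) *m L) *m a (tau x) = 0) &
   forall t z, `|t - t0| < del -> `|z| < del -> z *m a t = 0 ->
     [/\ O t, W (g t *m L + z) & tau (g t *m L + z) = t]].
Proof.
move=> Ot0; pose d := derive1 g t0 *m L; pose k0 := (d *m a t0) 0 0.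
have k00 : k0 != 0 := entry_neq0 (dv_trans dv Ot0).
have oO := dv_open dv.
pose k t := (d *m a t) 0 0.
have sk : smooth O k.
  move=> n; apply: (Ck_coord 0 0 oO); apply: (Ck_mulmx oO); first exact: Ck_cst.
  exact: (dv_a dv).
have k0n : 0 < `|k t0| by rewrite normr_gt0.
have [r1 r10 H1] := continuous_ball (smooth_cont sk Ot0) k0n.
have [r2 r20 H2] := open_ballR oO Ot0.
pose r := Num.min r1 r2; have r0 : 0 < r by rewrite lt_min r10.
have kn0 t : `|t - t0| < r -> k t != 0.
  rewrite lt_min => /andP[/H1 h _]; apply/eqP => E0.
  by rewrite E0 sub0r normrN ltxx in h.
have rO t : `|t - t0| < r -> O t by rewrite lt_min => /andP[_]; exact: H2.
clearbody r; clear r1 r10 H1 r2 r20 H2.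
pose Q t : 'M[R]_m := 1%:M - (k t)^-1 *: (a t *m d).
have dQ t : `|t - t0| < r -> d *m Q t = 0.
  move=> /kn0 kt; rewrite /Q mulmxBr mulmx1 -scalemxAr mulmxA [d *m a t]mx11_scalar.
  by rewrite mul_scalar_mx scalerA mulVf// scale1r subrr.
have Qa t : `|t - t0| < r -> Q t *m a t = 0.
  move=> /kn0 kt; rewrite /Q mulmxBl mul1mx -scalemxAl -mulmxA [d *m a t]mx11_scalar.
  by rewrite mul_mx_scalar scalerA mulVf// scale1r subrr.
have vQ t (v : 'rV[R]_m) : v *m a t = 0 -> v *m Q t = v.
  by move=> va; rewrite /Q mulmxBr mulmx1 -scalemxAr mulmxA va mul0mx scaler0 subr0.
have t0r : `|t0 - t0| < r by rewrite subrr normr0.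
pose s (y : 'rV[R]_m) : R := t0 + (y *m a t0) 0 0 / k0.
have ss n (S : set 'rV[R]_m) : open S -> Ck n S s.
  move=> oS; apply: CkD => //; first exact: Ck_cst.
  apply: CkM => //; last exact: Ck_cst.
  apply: (Ck_coord 0 0 oS); apply: (Ck_mulmx oS); first exact: Ck_id.
  exact: Ck_cst.
have cs y : {for y, continuous s} by apply: (ss 0%N setT openT).
pose S := [set y | `|s y - t0| < r].
have oS : open S.
  apply: ball_open_set => y Sy; have e0 : 0 < r - `|s y - t0| by rewrite subr_gt0.
  have [e e10 He] := continuous_ball (cs y) e0; exists e => // y' /He h.
  by rewrite /S /= (le_lt_trans (ler_distD (s y) _ _))// -ltrBrDr.
have s0 : s 0 = t0 by rewrite /s mul0mx mxE mul0r addr0.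
have S0 : S 0 by rewrite /S /= s0.
pose x t := g t *m L.
have sx : smooth O x by apply: smooth_mulmxr; [exact: oO|exact: (dv_g dv)].
have oB := open_ball_setR R t0 r.
have sQ : smooth [set t | `|t - t0| < r] Q.
  move=> n; apply: (CkB oB); first exact: Ck_cst.
  have subO : [set t | `|t - t0| < r] `<=` O by exact: rO.
  apply: (Ck_scalemx oB); first by apply: (CkV oB) => //; exact: Ck_sub subO _ (sk n).
  by apply: (Ck_mulmx oB); [exact: Ck_sub subO _ (dv_a dv n)|exact: Ck_cst].
pose Th y := x (s y) + (y *m Q t0) *m Q (s y).
have sQs : smooth S (fun y => Q (s y)).
  move=> n; apply: (Ck_comp_mxR (O' := [set t | `|t - t0| < r]) (f := Q) oS oB) => //.
  - exact: ss.
have sTh : smooth S Th.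
  move=> n; apply: CkD => //.
    apply: (Ck_comp_mxR (O' := O) (f := x) oS oO).
    - by move=> y /rO.
    - exact: ss.
    - exact: sx.
  apply: (Ck_mulmx oS); last exact: sQs.
  by apply: (Ck_mulmx oS); [exact: Ck_id|exact: Ck_cst].
have ds y : differentiable s y by apply: (ss 1%N setT openT).1.
have Ds v : 'D_v s 0 = (v *m a t0) 0 0 / k0 := derive_form _ _ _ _ _.
have inj v : 'D_v Th 0 = 0 -> v = 0.
  have dxs : differentiable x (s 0) by apply: smooth_diff sx _; rewrite s0.
  have dx1 : differentiable (fun y => x (s y)) 0 by exact: differentiable_comp' (ds 0) dxs.
  have dQ1 : differentiable (fun y : 'rV[R]_m => y *m Q t0) 0.
    by apply: differentiable_mulmx; [exact: ex_diff|exact: differentiable_const].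
  have dQ2 : differentiable (fun y => Q (s y)) 0 := smooth_diff sQs S0.
  have -> : 'D_v Th 0 = ((v *m a t0) 0 0 / k0) *: d + v *m Q t0 *m Q t0.
    rewrite deriveD; [|exact: diff_derivable dx1|exact: diff_derivable (differentiable_mulmx dQ1 dQ2)].
    rewrite (derive_compR v (ds 0) dxs) (derive_mulmx v dQ1 dQ2) Ds s0 mul0mx mul0mx addr0.
    rewrite (derive_mulmxr (Q t0) v (diff_id 0)) derive_id; congr (_ *: _ + _).
    by rewrite derive1_mulmxr//; exact: smooth_diff (dv_g dv) Ot0.
  move=> E0; have va : v *m a t0 = 0.
    apply: entry11_eq0; have := congr1 (fun w => (w *m a t0) 0 0) E0.
    rewrite /= mulmxDl -scalemxAl -[_ *m Q t0 *m a t0]mulmxA (Qa _ t0r) mulmx0 addr0 mul0mx.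
    by rewrite mxE -/k0 divfK// => ->; rewrite mxE.
  by move: E0; rewrite va mxE mul0r scale0r add0r !vQ.
have [V [W [Y [oV V0 VS oW [sY VW WV]]]]] := inverse_function oS sTh S0 inj.
have [e e0 He] := open_ball oV V0.
have sW y : W y -> S (Y y) /\ Th (Y y) = y by move=> /WV[/VS].
pose c1 := m%:R * `|Q t0| + `|d| + 1; have c10 : 0 < c1 by rewrite ltr_wpDl// addr_ge0// mulr_ge0.
exists W, (fun y => s (Y y)), (Num.min r (e / c1)); split.
- exact: oW.
- move=> n; apply: CkD => //; first exact: Ck_cst.
  apply: CkM => //; last exact: Ck_cst.
  apply: (Ck_coord 0 0 oW); apply: (Ck_mulmx oW); first exact: sY.
  exact: Ck_cst.
- by rewrite lt_min r0 divr_gt0.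
- move=> y /sW[Sy Ty]; split; first exact: rO.
  have E0 : Th (Y y) - x (s (Y y)) = Y y *m Q t0 *m Q (s (Y y)) by rewrite /Th addrC addKr.
  by rewrite Ty in E0; rewrite -/(x (s (Y y))) E0 -mulmxA Qa ?mulmx0.
move=> t z; rewrite !lt_min => /andP[tr te] /andP[zr ze] za.
(* The preimage of [x t + z] under [Th]: [Q t0] changes [z] by a multiple of [d] only, which [Q t]
   kills, so [z] is recovered. *)
pose y := z *m Q t0 + (t - t0) *: d.
have sy : s y = t.
  rewrite /s /y mulmxDl -[_ *m Q t0 *m a t0]mulmxA (Qa _ t0r) mulmx0 add0r -scalemxAl mxE -/k0.
  by rewrite mulfK// addrC subrK.
have ye : `|y| < e.
  rewrite (le_lt_trans (ler_normD _ _))// normrZ.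
  have h1 : `|z *m Q t0| <= m%:R * `|Q t0| * (e / c1).
    rewrite (le_trans (mulmx_norm _ _))// mulrAC ler_wpM2l// ?mulr_ge0//; exact: ltW.
  have h2 : `|t - t0| * `|d| <= `|d| * (e / c1) by rewrite mulrC ler_wpM2l// ltW.
  rewrite (le_lt_trans (lerD h1 h2))// -mulrDl mulrA ltr_pdivrMr// mulrC ltr_pM2l//.
  by rewrite /c1 ltrDl.
have Vy : V y by apply: He; rewrite subr0.
have Ty : Th y = x t + z.
  rewrite /Th sy; congr (_ + _); rewrite /y mulmxDl mulmxDl -scalemxAl (dQ _ t0r) scaler0 mul0mx addr0.
  have E1 : z *m Q t0 = z - (k0^-1 * (z *m a t0) 0 0) *: d.
    rewrite /Q mulmxBr mulmx1 -scalemxAr mulmxA [z *m a t0]mx11_scalar mul_scalar_mx scalerA.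
    by rewrite [_%:M 0 0]mxE eqxx mulr1n.
  by rewrite {1}E1 mulmxBl -scalemxAl (dQ _ t0r) scaler0 subr0 E1 mulmxBl -scalemxAl (dQ _ tr) scaler0 subr0 vQ.
by have [Wy Yy] := VW y Vy; rewrite -/(x t) -Ty; split; [exact: rO|exact: Wy|rewrite Yy].
Qed.

Section Map.
Variables (W : set 'rV[R]_m) (tau : 'rV[R]_m -> R).
Hypotheses (oW : open W) (stau : smooth W tau)
  (tauP : forall x, W x -> O (tau x) /\ (x - g (tau x) *m L) *m a (tau x) = 0).

Definition ruled_map x := g (tau x) + (x - g (tau x) *m L) *m A (tau x).

Let oO : open O := dv_open dv.
Let Otau x : W x -> O (tau x) := fun Wx => (tauP Wx).1.

Lemma smooth_gtauL : smooth W (fun x => g (tau x) *m L).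
Proof.
have sx : smooth O (fun t => g t *m L) by apply: smooth_mulmxr; [exact: oO|exact: (dv_g dv)].
by move=> n; apply: (Ck_comp_mxR (O' := O) (f := fun t => g t *m L) oW oO);
  [exact: Otau|exact: stau|exact: sx].
Qed.

Lemma smooth_gap : smooth W (fun x => x - g (tau x) *m L).
Proof. by move=> n; apply: (CkB oW); [exact: Ck_id|exact: smooth_gtauL]. Qed.

Lemma smooth_Atau : smooth W (fun x => A (tau x)).
Proof.
by move=> n; apply: (Ck_comp_mxR (O' := O) (f := A) oW oO); [exact: Otau|exact: stau|exact: (dv_A dv)].
Qed.

Lemma smooth_ruled_map : smooth W ruled_map.
Proof.
move=> n; apply: CkD => //.
  by apply: (Ck_comp_mxR (O' := O) (f := g) oW oO); [exact: Otau|exact: stau|exact: (dv_g dv)].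
by apply: (Ck_mulmx oW); [exact: smooth_gap|exact: smooth_Atau].
Qed.

Lemma ruled_mapL x : W x -> ruled_map x *m L = x.
Proof.
by move=> Wx; rewrite /ruled_map mulmxDl -mulmxA (dv_L dv (Otau Wx)) mulmx1 addrC subrK.
Qed.

Let dtau x : W x -> differentiable tau x. Proof. exact: smooth_diff. Qed.

Lemma derive_gap x b : W x ->
  'D_b (fun x => x - g (tau x) *m L) x = b - 'D_b tau x *: (derive1 g (tau x) *m L).
Proof.
move=> Wx; have dg : differentiable g (tau x) := smooth_diff (dv_g dv) (Otau Wx).
have dgL : differentiable (fun t => g t *m L) (tau x).
  by apply: differentiable_mulmx => //; exact: differentiable_const.
have dgt : differentiable (fun x => g (tau x) *m L) x := smooth_diff smooth_gtauL Wx.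
rewrite deriveB; [|exact: derivable_id|exact: diff_derivable].
by rewrite derive_id (derive_compR (h := fun t => g t *m L) b (dtau Wx) dgL) derive1_mulmxr.
Qed.

(** The derivative of [tau] drops out. It multiplies the part of the velocity of [g] not accounted
    for by [A], which is 0, and the gap [x - g (tau x) *m L] times the derivative of [A], which
    vanishes because [tau] places the gap in the kernel of [a]. *)
Lemma derive_ruled_map x b : W x -> 'D_b ruled_map x = b *m A (tau x).
Proof.
move=> Wx; have Ot := Otau Wx.
have dg : differentiable g (tau x) := smooth_diff (dv_g dv) Ot.
have dA : differentiable A (tau x) := smooth_diff (dv_A dv) Ot.
have d1 : differentiable (fun x => x - g (tau x) *m L) x := smooth_diff smooth_gap Wx.
have d2 : differentiable (fun x => A (tau x)) x := smooth_diff smooth_Atau Wx.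
have d3 : differentiable (fun x => g (tau x)) x := differentiable_comp' (dtau Wx) dg.
rewrite deriveD; [|exact: diff_derivable d3|exact: diff_derivable (differentiable_mulmx d1 d2)].
rewrite (derive_compR b (dtau Wx) dg) (derive_mulmx b d1 d2) (derive_gap b Wx).
rewrite (derive_compR b (dtau Wx) dA) (dv_A' dv Ot) -scalemxAr mulmxA (tauP Wx).2 mul0mx scaler0 addr0.
by rewrite {1}(dv_g' dv Ot) mulmxBl -scalemxAl addrC subrK.
Qed.

(** Differentiating the equation that defines [tau] shows that [c *m a (tau x)] is the derivative of
    [tau] along [c] times a fixed scalar. Transversality of the velocity makes the scalar nonzero,
    so the directions along which [tau] is stationary are the kernel of [a (tau x)]. *)
Lemma null_ruled_map x b : W x ->
  (forall c, 'D_b ('D_c ruled_map) x = 0) <-> b *m a (tau x) = 0.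
Proof.
move=> Wx; have Ot := Otau Wx.
have dA : differentiable A (tau x) := smooth_diff (dv_A dv) Ot.
have da : differentiable a (tau x) := smooth_diff (dv_a dv) Ot.
have d1 : differentiable (fun x => x - g (tau x) *m L) x := smooth_diff smooth_gap Wx.
have d2 : differentiable (fun x => A (tau x)) x := smooth_diff smooth_Atau Wx.
have d3 : differentiable (fun x => a (tau x)) x := differentiable_comp' (dtau Wx) da.
have key c : c *m a (tau x) = 'D_c tau x *:
    (derive1 g (tau x) *m L *m a (tau x) - (x - g (tau x) *m L) *m derive1 a (tau x)).
  have E0 : 'D_c (fun x => (x - g (tau x) *m L) *m a (tau x)) x = 0.
    rewrite -(derive_cst (0 : 'M[R]_1) x c); apply: near_eq_derive.
    by apply: (near_open oW Wx) => y /tauP[_].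
  rewrite (derive_mulmx c d1 d3) (derive_gap c Wx) (derive_compR c (dtau Wx) da) in E0.
  rewrite scalerBr; apply/eqP; rewrite -subr_eq0; apply/eqP; rewrite -[RHS]E0.
  by rewrite [in RHS]mulmxBl -[in RHS]scalemxAl -[in RHS]scalemxAr opprB addrCA addrC.
have second c : 'D_b ('D_c ruled_map) x = 'D_b tau x *: (c *m a (tau x) *m beta (tau x)).
  have -> : 'D_b ('D_c ruled_map) x = 'D_b (fun y => c *m A (tau y)) x.
    by apply: near_eq_derive; apply: (near_open oW Wx) => y; exact: derive_ruled_map.
  rewrite (derive_mulmxl c b d2) (derive_compR b (dtau Wx) dA) (dv_A' dv Ot).
  by rewrite -scalemxAr mulmxA.
have tb : 'D_b tau x = 0 <-> b *m a (tau x) = 0.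
  split=> [t0|b0]; first by rewrite key t0 scale0r.
  have := key b; rewrite b0 => /esym/eqP; rewrite scaler_eq0 => /orP[/eqP//|/eqP h].
  have := key (derive1 g (tau x) *m L); rewrite h scaler0 => /eqP.
  by rewrite (negbTE (dv_trans dv Ot)).
rewrite -tb; split=> [Hc|t0 c]; last by rewrite second t0 scale0r.
have := Hc (derive1 g (tau x) *m L); rewrite second mul_row11 scalerA => /eqP.
rewrite scaler_eq0 (negbTE (dv_beta dv Ot)) orbF mulf_eq0.
by rewrite (negbTE (entry_neq0 (dv_trans dv Ot))) orbF => /eqP.
Qed.

End Map.

End DevelopableMap.

Lemma lip_radius (R : realFieldType) (x y k : R) : `|x - y| <= k / 2 -> x <= y + k / 2 /\ y <= x + k / 2.
Proof. by rewrite ler_norml => /andP[? ?]; split; lra. Qed.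

(** * Gluing local ruled graphs into a solution *)

Section Existence.
Variables (R : realType) (N m : nat).
Local Notation E := 'rV[R]_N.

Lemma developable_sub (O O' : set R) L A g a beta : open O' -> O' `<=` O ->
  developable (m := m) (N := N) O L A g a beta -> developable O' L A g a beta.
Proof.
move=> oO' O'O [_ sA sg sa AL g' A' tr bn]; split=> //; try exact: smooth_sub O'O _.
- by move=> t /O'O/AL.
- by move=> t /O'O/g'.
- by move=> t /O'O/A'.
- by move=> t /O'O/tr.
- by move=> t /O'O/bn.
Qed.

(** The linear projection by [L] is a continuous left inverse of every graph map [F]. *)
Lemma graph_patch_embedded (M : set E) :
  (forall p, M p -> exists (L : 'M[R]_(N, m)) W F U, graph_patch M L W F U /\ U p) ->
  embedded_submanifold m M.
Proof.
move=> HM p /HM[L [W [F [U [G Up]]]]]; exists U, W, F; case: (G) => oW sF FL oU FW.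
split=> //; split.
- exact: smooth_smooth_on oW _ sF.
- by move=> x v Wx E0; rewrite -(patch_derL G v Wx) E0 mul0mx.
- exists (fun q => q *m L); split=> //; apply/within_continuousP => q _ e e0.
  have [K K0 HK] := mulmx_norm_bound L.
  exists (e / K); first by rewrite divr_gt0.
  by move=> y _ yq; rewrite -mulmxBl (le_lt_trans (HK _))// -ltr_pdivlMr.
Qed.

Variables (J : set R) (gamma : R -> E) (D : R -> {vspace E}).
Hypotheses (H : cauchy_data m J gamma D) (oJ : open J)
  (rk : forall t, J t -> has_dim (im_rho J D t) 1%N).

Lemma ruling_dim t : J t -> has_dim (ruling J D t) m.-1.
Proof.
move=> Jt; have RP v := rulingP H v Jt (rk Jt).
have [|a u v /RP[uD uw] /RP[vD vw]|U UE] := @subspace_vspace R N (ruling J D t).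
- exact: ruling0.
- by apply/RP; rewrite dotDl dotZl uw vw mulr0 addr0; split=> //; apply: memvD => //; exact: memvZ.
exists U; split=> //; have inU v : (v \in U) = [set` U] v :> Prop by [].
have [wD wg] := rho_curv_spec H Jt.
have UD : (U <= D t)%VS by apply/subvP => v; rewrite inU -UE => -[].
have gD := cd_tan H Jt.
have gU : derive1 gamma t \notin U.
  apply/negP => h; have : [set` U] (derive1 gamma t) by [].
  by rewrite -UE => /RP[_]; rewrite dotC => E0; rewrite E0 ltxx in wg.
have dD : \dim (D t) = m by exact: (cd_dist H).1.
have : (\dim U).+1 = \dim (D t).
  apply/(dim_hyperplane UD gD gU) => v vD.
  exists (dot v (rho_curv J gamma D t) / dot (rho_curv J gamma D t) (derive1 gamma t)).
  rewrite inU -UE; apply/RP; split; first by apply: memvB => //; exact: memvZ.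
  by rewrite dotBl dotZl (dotC (derive1 _ _)) divfK ?subrr// lt_eqF.
by rewrite dD => <-.
Qed.

(** A ruled graph containing every short ruling vector issued near [t0], with [tau] recovering the
    parameter it is issued from. The property is inherited by smaller [rho], as [lipschitz_minorant]
    demands. *)
Definition ruled_box (t0 rho : R) := exists (L : 'M[R]_(N, m)) W F (tau : 'rV[R]_m -> R),
  [/\ open W, smooth W F, forall x, W x -> F x *m L = x,
    forall x, W x -> [/\ J (tau x), {for x, continuous tau}, ruling J D (tau x) (F x - gamma (tau x)),
      [set` D (tau x)] = [set v | exists b, v = 'D_b F x] &
      ruling J D (tau x) = [set v | exists b, v = 'D_b F x /\ forall c, 'D_b ('D_c F) x = 0]] &
    forall s v, J s -> `|s - t0| < rho -> ruling J D s v -> `|v| < rho ->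
      [/\ W ((gamma s + v) *m L), tau ((gamma s + v) *m L) = s & F ((gamma s + v) *m L) = gamma s + v]].

(** The product of [z *m A t] with [rho_curv] is minus [z *m a t] times the product of [beta t] with
    the normal curvature vector, and the latter factor is nonzero. *)
Lemma ruling_developable O (L : 'M[R]_(N, m)) A g a beta t v : developable O L A g a beta -> O t -> O `<=` J ->
  (forall u, O u -> g u = gamma u /\ [set` D u] = rowsp (A u)) ->
  ruling J D t v <-> exists z, v = z *m A t /\ z *m a t = 0.
Proof.
move=> dv Ot OJ gD; have Jt := OJ _ Ot; rewrite (rulingP H v Jt (rk Jt)).
have [_ DA] := gD t Ot.
have kD : orth [set` D t] (perp_proj [set` D t] (derive1n 2 gamma t)) by exact: perp_orth'.
have [wD wg] := rho_curv_spec H Jt.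
have gg : \forall u \near t, g u = gamma u.
  by apply: (near_open (dv_open dv) Ot) => u /gD[].
set k := perp_proj _ _ in kD.
have kb : dot k (beta t) != 0.
  have : dot k (derive1n 2 gamma t) != 0.
    by rewrite -oppr_eq0 -(dot_rho_gamma H Jt kD) lt_eqF.
  rewrite -(near_derive1n2 gg) (dev_second dv Ot) dotDr mul_row11 dotZr kD ?add0r.
    by apply: contraNneq => ->; rewrite mulr0.
  by rewrite DA; eexists; reflexivity.
have rhoA z : dot (z *m A t) (rho_curv J gamma D t) = - ((z *m a t) 0 0 * dot k (beta t)).
  have [_ q] := rho_spec H Jt kD; have dA : differentiable A t := smooth_diff (dv_A dv) Ot.
  rewrite dotC /rho_curv (q (fun u => z *m A u)).
  - by rewrite (derive1_mulmxl z dA) (dv_A' dv Ot) mulmxA mul_row11 dotZr.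
  - by apply: differentiable_mulmx => //; exact: differentiable_const.
  apply: (near_open (dv_open dv) Ot) => u /gD[_ DAu] _.
  have -> : (z *m A u \in D u) = [set` D u] (z *m A u) :> Prop by [].
  by rewrite DAu; exists z.
split=> [[vD]|[z [-> za]]].
  have : [set` D t] v by []. rewrite DA => -[z ->]; rewrite rhoA => /eqP.
  rewrite oppr_eq0 mulf_eq0 (negbTE kb) orbF => /eqP za; exists z; split=> //.
  exact: entry11_eq0.
split; last by rewrite rhoA za mxE mul0r oppr0.
have -> : (z *m A t \in D t) = [set` D t] (z *m A t) :> Prop by [].
by rewrite DA; exists z.
Qed.

Lemma ruled_box_exists t0 : J t0 -> exists2 rho : R, 0 < rho & ruled_box t0 rho.
Proof.
move=> Jt0; have [L [r [A [g [a [beta [r0 dv0 gD0]]]]]]] := local_developable H Jt0 rk.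
have [r' r'0 Hr'] := open_ballR oJ Jt0.
pose O := [set t | `|t - t0| < Num.min r r'].
have OJ : O `<=` J by move=> t; rewrite /O /= lt_min => /andP[_]; exact: Hr'.
have dv : developable O L A g a beta.
  apply: developable_sub dv0; first exact: open_ball_setR.
  by move=> t; rewrite /O /= lt_min => /andP[].
have gD u : O u -> g u = gamma u /\ [set` D u] = rowsp (A u).
  by move=> Ou; apply: gD0; [exact: OJ|move: Ou; rewrite /O /= lt_min => /andP[]].
have Ot0 : O t0 by rewrite /O /= subrr normr0 lt_min r0.
have [W [tau [del [oW stau del0 tauP box]]]] := ruling_coordinates dv Ot0.
have [K K0 HK] := mulmx_norm_bound L.
have RD t v : O t -> ruling J D t v <-> exists z, v = z *m A t /\ z *m a t = 0.
  by move=> Ot; exact: (ruling_developable v dv Ot OJ gD).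
exists (Num.min (Num.min r r') (Num.min del (del / K))).
  by rewrite !lt_min r0 r'0 del0 divr_gt0.
exists L, W, (ruled_map L A g tau), tau; split.
- exact: oW.
- exact: (smooth_ruled_map dv oW stau tauP).
- by move=> x Wx; exact: (ruled_mapL dv tauP).
- move=> x Wx; have [Ot gap] := tauP x Wx; have [gt DA] := gD _ Ot; split.
  + exact: OJ.
  + exact: smooth_cont stau Wx.
  + apply/(RD _ _ Ot); exists (x - g (tau x) *m L); split; last exact: gap.
    by rewrite /ruled_map -gt addrAC subrr add0r.
  + rewrite DA; apply/seteqP; split=> v [b ->]; exists b; by rewrite (derive_ruled_map dv oW stau tauP).
  + apply/seteqP; split=> v.
      move=> /(RD _ _ Ot)[z [-> za]]; exists z; rewrite (derive_ruled_map dv oW stau tauP)//; split=> //.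
      exact/(null_ruled_map dv oW stau tauP _ Wx).
    move=> [b [-> /(null_ruled_map dv oW stau tauP _ Wx) ba]].
    by apply/(RD _ _ Ot); exists b; rewrite (derive_ruled_map dv oW stau tauP).
move=> s v Js; rewrite !lt_min => /andP[/andP[s1 s2] /andP[sd _]] rv /andP[_ /andP[_ vd]].
have Os : O s by rewrite /O /= lt_min s1.
have [gs _] := gD s Os.
have [z [vE za]] := (RD s v Os).1 rv.
have zE : v *m L = z by rewrite vE -mulmxA (dv_L dv Os) mulmx1.
have zd : `|z| < del by rewrite -zE (le_lt_trans (HK v))// -ltr_pdivlMr.
have [_ Wz tz] := box s z sd zd za.
have E0 : (gamma s + v) *m L = g s *m L + z by rewrite mulmxDl zE gs.
rewrite E0; split=> //; rewrite /ruled_map tz gs vE; congr (_ + _ *m _).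
by rewrite addrC addKr.
Qed.

(** M is the union of the ruling discs of radius [r t]. Locally it is a ruled graph provided that no
    disc with a remote parameter comes close, which is a separation requirement on [r] supplied by
    the embeddedness of [gamma]. *)
Lemma open_existence : (0 < m)%N -> exists M, is_solution m J gamma D M.
Proof.
move=> m0.
have [|t0 Jt0|R0 [R0L R00 R0q]] := @lipschitz_minorant R J ruled_box.
- move=> t c d dc [L [W [F [tau [oW sF FL HW box]]]]]; exists L, W, F, tau; split=> //.
  by move=> s v Js sd rv vd; apply: box => //; exact: lt_le_trans dc.
- have [rho rho0 [L [W [F [tau [oW sF FL HW box]]]]]] := ruled_box_exists Jt0.
  have r2 : rho / 2 < rho by rewrite ltr_pdivrMr// ltr_pMr// ltr1n.
  exists (rho / 2); first by rewrite divr_gt0.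
  move=> t Jt td; exists L, W, F, tau; split=> // s v Js sd rv vd; apply: box => //.
    by rewrite (le_lt_trans (ler_distD t _ _))// (splitr rho) ltrD.
  exact: lt_trans vd r2.
(* If a point of the disc at [s] is within [r t0] of a point of the disc at [t0], the base points
   are closer than [r s + 2 * r t0], at most three times the larger radius; 4 leaves a margin. *)
pose q2 t c := 2 * c <= R0 t /\ forall s, J s -> `|gamma s - gamma t| < 4 * c -> `|s - t| < R0 t / 2.
have [_ _ /embedding_inverse emb] := cd_emb H.
have [|t0 Jt0|r [rL r0 rq]] := @lipschitz_minorant R J q2.
- move=> t c d dc [c1 c2]; split; first by lra.
  by move=> s Js sd; apply: c2 => //; lra.
- have R1 := R00 _ Jt0; have R8 : 0 < R0 t0 / 8 by rewrite divr_gt0.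
  have [eta eta0 He] := emb t0 Jt0 _ R8; have eta2 : 0 < eta / 2 by rewrite divr_gt0.
  have [e e0 He2] := gamma_close H Jt0 eta2.
  exists (Num.min (Num.min (eta / 8) (R0 t0 / 4)) (Num.min e (R0 t0 / 8))).
    by rewrite !lt_min e0 R8 !divr_gt0.
  move=> t Jt; rewrite !lt_min => /andP[_ /andP[te t8]].
  have [h1 h2] := lip_radius (R0L t t0).
  set c := Num.min _ _.
  have [c1 c2] : c <= eta / 8 /\ c <= R0 t0 / 4.
    by split; rewrite /c !ge_min lexx ?orbT.
  clearbody c; split; first by move: c2 t8 h2 R1; set u := `|t - t0|; lra.
  move=> s Js st; have st0 : `|gamma s - gamma t0| < eta.
    have := He2 t te; have := ler_distD (gamma t) (gamma s) (gamma t0).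
    by move: st c1; set u := `|gamma s - gamma t|; set u' := `|_ - _|; set u'' := `|_ - _|; lra.
  have := He s Js st0; have := ler_distD t0 s t; rewrite (distrC t0 t).
  by move: t8 h2 R1; set u := `|t - t0|; set u' := `|s - t|; set u'' := `|s - t0|; lra.
pose M := [set p | exists t v, [/\ J t, ruling J D t v, `|v| < r t & p = gamma t + v]].
have cr t : {for t, continuous r}.
  apply: (@ball_continuous R R^o R^o t r) => e e0; exists e => // s st.
  rewrite (le_lt_trans (rL _ _))// (le_lt_trans _ st)// ler_pdivrMr// ler_peMr//.
  by rewrite ler1n.
have patch t0 v0 : J t0 -> ruling J D t0 v0 -> `|v0| < r t0 ->
  exists (L : 'M[R]_(N, m)) W F (tau : 'rV[R]_m -> R) U, [/\ graph_patch M L W F U, U (gamma t0 + v0),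
     tau ((gamma t0 + v0) *m L) = t0 &
     forall x, W x -> [set` D (tau x)] = [set v | exists b, v = 'D_b F x] /\
      ruling J D (tau x) = [set v | exists b, v = 'D_b F x /\ forall c, 'D_b ('D_c F) x = 0]].
  move=> Jt0 rv0 vr0; have [L [W [F [tau [oW sF FL HW box]]]]] := R0q t0 Jt0.
  have [rR sep] := rq t0 Jt0.
  set p := gamma t0 + v0; have rp := r0 t0 Jt0; have Rp := R00 _ Jt0.
  have boxr : `|v0| < R0 t0 by move: vr0 rR; set u := `|v0|; lra.
  have [_ tp _] := box t0 v0 Jt0 ltac:(by rewrite subrr normr0) rv0 boxr.
  pose V := [set x | [/\ W x, `|F x - gamma (tau x)| < r (tau x) & `|F x - p| < r t0]].
  exists L, V, F, tau, [set q | `|q - p| < r t0]; split.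
  - split.
    + apply: ball_open_set => x [Wx xr xp]; have [Jt ct _ _ _] := HW x Wx.
      have cF := smooth_cont sF Wx.
      have c1 : {for x, continuous (fun y => r (tau y) - `|F y - gamma (tau y)|)}.
        apply: continuousB; first by apply: (@continuous_comp _ _ _ tau r).
        apply: (@continuous_comp _ _ _ (fun y => F y - gamma (tau y)) Num.norm); last exact: norm_continuous.
        apply: continuousB => //; apply: (@continuous_comp _ _ _ tau gamma) => //.
        exact: gamma_cont H _ Jt.
      have h1 : 0 < r (tau x) - `|F x - gamma (tau x)| by rewrite subr_gt0.
      have [e1 e10 He1] := continuous_ball c1 h1.
      have h2 : 0 < r t0 - `|F x - p| by rewrite subr_gt0.
      have [e2 e20 He2] := continuous_ball cF h2.
      have [e3 e30 He3] := open_ball oW Wx.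
      exists (Num.min e1 (Num.min e2 e3)); first by rewrite !lt_min e10 e20.
      move=> y; rewrite !lt_min => /and3P[y1 y2 y3]; split; first exact: He3.
        by rewrite -subr_gt0; exact: dist_gt0 (He1 y y1).
      by rewrite (le_lt_trans (ler_distD (F x) _ _))// -ltrBrDr; exact: He2.
    + by apply: smooth_sub sF => x [].
    + by move=> x [Wx _ _]; exact: FL.
    + exact: open_ball_set.
    + apply/seteqP; split=> [_ [x [Wx xr xp] <-]|q [[s [v [Js rv vr qE]]] qp]].
        split=> //; have [Jt _ rx _ _] := HW x Wx.
        by exists (tau x), (F x - gamma (tau x)); split=> //; rewrite addrC subrK.
      have [rRs seps] := rq s Js; have [h1 h2] := lip_radius (R0L s t0).
      have gst : `|gamma s - gamma t0| < r s + 2 * r t0.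
        have -> : gamma s - gamma t0 = (q - p) - v + v0.
          by rewrite qE /p; apply/rowP => j; rewrite !mxE; ring.
        have := ler_normD (q - p - v) v0; have := ler_normB (q - p) v.
        move: vr vr0 qp => /=.
        by set u1 := `|v|; set u2 := `|v0|; set u3 := `|q - p|; set u4 := `|q - p - v|; lra.
      have st : `|s - t0| < R0 t0.
        (* The separation is invoked at whichever parameter has the larger radius; the Lipschitz
           bound on [R0] then transfers the conclusion to [t0]. *)
        have [rr|rr] := leP (r s) (r t0).
          have /(sep s Js) : `|gamma s - gamma t0| < 4 * r t0 by lra.
          by move: Rp; set u := `|s - t0|; lra.
        have : `|gamma t0 - gamma s| < 4 * r s by rewrite distrC; lra.
        move=> /(seps t0 Jt0); rewrite (distrC t0 s); move: h1 Rp; set u := `|s - t0|; lra.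
      have vR : `|v| < R0 t0.
        by move: vr rRs h1 st; set u := `|s - t0|; set u' := `|v|; lra.
      have [Wq tq Fq] := box s v Js st rv vR.
      rewrite -qE in Wq tq Fq; exists (q *m L) => //; split=> //; rewrite ?tq Fq//.
      by rewrite qE addrC addKr.
  - by rewrite /= subrr normr0.
  - exact: tp.
  - by move=> x [/HW[]].
exists M; split.
- apply: graph_patch_embedded => p [t [v [Jt rv vr ->]]].
  by have [L [W [F [tau [U [G Up _ _]]]]]] := patch t v Jt rv vr; exists L, W, F, U.
- move=> p [t [v [Jt rv vr pE]]]; have [L [W [F [tau [U [G Up tp HW]]]]]] := patch t v Jt rv vr.
  have Mp : M (gamma t + v) by exists t, v.
  have [Wp Fp] := patch_out G Mp Up; have [_ RW] := HW _ Wp; rewrite tp in RW.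
  have -> : nullity M p = ruling J D t.
    rewrite pE -Fp RW; apply/seteqP; split=> w /=; first by move/(nullity_patch G w Wp).
    by move=> h; apply/(nullity_patch G w Wp).
  exact: ruling_dim.
- move=> _ [t Jt <-]; exists t, 0; split=> //; last by rewrite addr0.
    exact: ruling0.
  by rewrite normr0; exact: r0.
- move=> t Jt; have r00 : `|0 : E| < r t by rewrite normr0; exact: r0.
  have [L [W [F [tau [U [G Up tp HW]]]]]] := patch t 0 Jt (ruling0 J D t) r00.
  have Mp : M (gamma t + 0) by exists t, 0; split=> //; exact: ruling0.
  have [Wp Fp] := patch_out G Mp Up; have [DW _] := HW _ Wp; rewrite tp in DW.
  rewrite -[gamma t]addr0 -Fp DW; apply/seteqP; split=> w /=; first by move/(tangent_patchP G w Wp).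
  by move=> h; apply/(tangent_patchP G w Wp).
Qed.

End Existence.

Lemma existence (R : realType) N m I (gamma : R -> 'rV[R]_N) D : cauchy_data m I gamma D -> (0 < m)%N ->
  (forall t, I t -> has_dim (im_rho I D t) 1%N) -> exists M, is_solution m I gamma D M.
Proof.
move=> H m0 rk; have [J [g [D' [oJ HJ rkJ IJ ag]]]] := open_extension H rk.
have [M [eM rM gM tM]] := open_existence HJ oJ rkJ m0; exists M; split=> //.
  by move=> _ [t It <-]; have [<- _] := ag t It; apply: gM; exists t => //; exact: IJ.
by move=> t It; have [<- <-] := ag t It; apply: tM; exact: IJ.
Qed.

(** * Global orthonormal frames *)

Section SmoothStep.
Variables (R : realType).

Lemma smooth_sqrt : smooth [set x : R | 0 < x] Num.sqrt.
Proof.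
have o0 : open [set x : R | 0 < x].
  by apply: ball_open_set => x x0; exists x => // y; rewrite ltr_norml => /andP[]; rewrite /=; lra.
have dS (x : R) : 0 < x -> differentiable (Num.sqrt : R -> R) x /\
    forall v, 'D_v (Num.sqrt : R -> R) x = v * (2 * Num.sqrt x)^-1.
  move=> x0; have [dx dE] := is_derive1_sqrt x0.
  have df : differentiable (Num.sqrt : R -> R) x by apply/derivable1_diffP.
  by split=> // v; rewrite (derive_scale1 v df) derive1E dE.
elim=> [x x0|n IH]; first exact: sqrt_continuous.
split=> [x /dS[]//|v].
apply: (@Ck_ext _ _ _ _ n o0 (fun x => v * (2 * Num.sqrt x)^-1)); first by move=> x /dS[].
apply: CkM => //; first exact: Ck_cst.
apply: CkV => //; first by move=> x x0; rewrite mulf_neq0// gt_eqF// sqrtr_gt0.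
by apply: CkM => //; exact: Ck_cst.
Qed.

(** The flat function exp(-1/x) together with its multiples by powers of 1/x: derivatives of members
    of this family are combinations of members, so smoothness of all of them is one induction. *)
Definition bump (k : nat) (x : R) : R :=
  if 0 < x then x^-1 ^+ k * expR (- x^-1) else 0.

Lemma bump_small k (x : R) : `|bump k x| <= k.+2`!%:R * `|x| ^+ 2.
Proof.
rewrite /bump; case: ifP => [x0|_]; last by rewrite normr0 mulr_ge0// exprn_ge0.
have y0 : 0 < x^-1 by rewrite invr_gt0.
have f0 : 0 < k.+2`!%:R :> R by rewrite ltr0n fact_gt0.
have h : x^-1 ^+ k.+2 / k.+2`!%:R <= expR x^-1.
  by rewrite (le_trans _ (expR_ge1Dxn k.+1 (ltW y0)))// lerDr.
rewrite ger0_norm ?(mulr_ge0 (exprn_ge0 _ (ltW y0)) (expR_ge0 _))// (gtr0_norm x0) expRN.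
rewrite ler_pdivrMr ?expR_gt0//.
have c0 : 0 <= k.+2`!%:R * x ^+ 2 by rewrite mulr_ge0 ?exprn_ge0// ltW.
apply: le_trans (ler_wpM2l c0 h).
have x0' : x != 0 by rewrite gt_eqF.
have f0' : k.+2`!%:R != 0 :> R by rewrite gt_eqF.
rewrite -[k.+2 in X in _ * (_ ^+ X / _)]addn2 exprD; set a := x^-1 ^+ k; set F := _%:R in f0' *.
have -> : F * x ^+ 2 * (a * x^-1 ^+ 2 / F) = a by field; rewrite x0' f0'.
exact: lexx.
Qed.

Lemma bump_derive_pos k (x : R) : x != 0 ->
  is_derive x (1 : R) (fun y : R => y^-1 ^+ k * expR (- y^-1))
    (x^-1 ^+ k.+2 * expR (- x^-1) - k%:R * (x^-1 ^+ k.+1 * expR (- x^-1))).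
Proof.
move=> x0; have dV : is_derive x (1 : R) (fun y : R => y^-1) (- x ^- 2 *: (1 : R)).
  exact: (@is_deriveV R id x 1 1 x0 (is_derive_id x 1)).
have dN : is_derive x (1 : R) (fun y : R => - y^-1) (- (- x ^- 2 *: (1 : R))) by exact: is_deriveN.
elim: k => [|k IH].
  have -> : (fun y : R => y^-1 ^+ 0 * expR (- y^-1)) = expR \o (fun y => - y^-1).
    by apply/funext => y; rewrite expr0 mul1r.
  have -> : x^-1 ^+ 2 * expR (- x^-1) - 0 * (x^-1 ^+ 1 * expR (- x^-1)) =
      expR (- x^-1) * (- (- x ^- 2 *: (1 : R))).
    by rewrite mul0r subr0 /GRing.scale /= mulr1 opprK mulrC exprVn.
  exact: (@is_derive1_comp R expR (fun y => - y^-1) x _ _ (is_derive_expR _) dN).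
have -> : (fun y : R => y^-1 ^+ k.+1 * expR (- y^-1)) =
    (fun y : R => y^-1) * (fun y => y^-1 ^+ k * expR (- y^-1)).
  by apply/funext => y; rewrite exprS -mulrA.
have D := @is_deriveM _ _ _ _ _ _ _ _ dV IH.
apply: (is_derive_eq D).
rewrite /GRing.scale /= -natr1 -exprVn !exprS expr0 mulr1.
set y := x^-1; set a := y ^+ k; set e := expR _; ring.
Qed.

Lemma bump_derive k (x : R) : differentiable (bump k) x /\
  derive1 (bump k) x = bump k.+2 x - k%:R * bump k.+1 x.
Proof.
case: (ltgtP x 0) => [x0|x0|->].
- have E0 : \forall y \near x, cst 0 y = bump k y.
    have e0 : 0 < - x by rewrite oppr_gt0.
    apply: (ball_nbhsR e0) => y yx; rewrite /bump ifF//; apply/negbTE; rewrite -leNgt.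
    by move: yx; rewrite ltr_norml => /andP[]; lra.
  split; first exact: near_eq_differentiable E0 (differentiable_const _ _).
  rewrite -(near_derive1 E0) derive1_cst /bump !ifF ?mulr0 ?subr0//; apply/negbTE; rewrite -leNgt ltW//.
- pose f (y : R) := y^-1 ^+ k * expR (- y^-1).
  have E0 : \forall y \near x, f y = bump k y.
    apply: (ball_nbhsR x0) => y yx; rewrite /bump ifT//.
    by move: yx; rewrite ltr_norml => /andP[]; lra.
  have Hf : is_derive x (1 : R) f (x^-1 ^+ k.+2 * expR (- x^-1) - k%:R * (x^-1 ^+ k.+1 * expR (- x^-1))).
    by apply: bump_derive_pos; rewrite gt_eqF.
  have [df f'] := Hf; split.
    by apply: near_eq_differentiable E0 _; apply/derivable1_diffP.
  by rewrite -(near_derive1 E0) derive1E f' /bump !ifT.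
have b0 j : bump j 0 = 0 by rewrite /bump ltxx.
have F0 : 0 < k.+2`!%:R :> R by rewrite ltr0n fact_gt0.
have [|e e0|df dE] := @linear_approx R R^o R^o (bump k) (\0)%R 0.
- by move=> y; exact: cst_continuous.
- apply: (@ball_nbhsR R 0 _ (e / k.+2`!%:R)); first by rewrite divr_gt0.
  move=> h; rewrite subr0 => he; rewrite b0 addr0 addr0 subr0.
  rewrite (le_trans (bump_small k h))// expr2 mulrA ler_wpM2r// mulrC.
  by rewrite -ler_pdivlMr// ltW.
split; first exact: df.
by rewrite !b0 mulr0 subr0 derive1E (deriveE _ df) dE.
Qed.

Lemma smooth_bump k : smooth setT (bump k).
Proof.
move=> n; elim: n k => [|n IH] k; first by move=> x _; exact/differentiable_continuous/(bump_derive k x).1.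
split=> [x _|v]; first exact: (bump_derive k x).1.
apply: (@Ck_ext _ _ _ _ n openT (fun x => v * (bump k.+2 x + (- k%:R) * bump k.+1 x))).
  by move=> x _; have [df fE] := bump_derive k x; rewrite (derive_scale1 v df) fE mulNr.
apply: CkM; [exact: openT|exact: Ck_cst|apply: CkD; [exact: openT|exact: IH|]].
by apply: CkM; [exact: openT|exact: Ck_cst|exact: IH].
Qed.

Lemma bump0_ge0 x : 0 <= bump 0 x.
Proof. by rewrite /bump; case: ifP => // _; rewrite mulr_ge0 ?expR_ge0// expr0. Qed.

Lemma bump0_gt0 x : 0 < x -> 0 < bump 0 x.
Proof. by move=> x0; rewrite /bump x0 expr0 mul1r expR_gt0. Qed.

Lemma bump0_eq0 x : x <= 0 -> bump 0 x = 0.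
Proof. by move=> x0; rewrite /bump ltNge x0. Qed.

(** The distance past [c] is multiplied by a smooth cutoff that is 1 up to [c] and 0 from [c + e]
    on. *)
Lemma smooth_clamp (c e : R) : 0 < e -> exists theta : R -> R, [/\ smooth setT theta,
  forall t, t <= c -> theta t = t & forall t, c <= t -> c <= theta t <= c + e].
Proof.
move=> e0; pose den x := bump 0 x + bump 0 (1 - x).
have den0 x : den x != 0.
  rewrite gt_eqF// /den; have [x0|x0] := ltP 0 x.
    by rewrite ltr_pwDl ?bump0_gt0 ?bump0_ge0.
  by rewrite ltr_wpDl ?bump0_ge0// bump0_gt0// subr_gt0 (le_lt_trans x0).
pose u t := (t - c) / e.
pose h t := bump 0 (1 - u t) / den (u t).
have su : smooth setT u.
  move=> n; apply: CkM; [exact: openT| |exact: Ck_cst].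
  by apply: CkD; [exact: openT|exact: Ck_id|exact: Ck_cst].
have sb f : smooth setT f -> smooth setT (fun t : R => bump 0 (f t)).
  by move=> sf n; apply: (Ck_comp_R (O' := setT) (g := f) openT _ (sf n) (smooth_bump 0 n)).
have s1u : smooth setT (fun t => 1 - u t).
  by move=> n; apply: CkBr; [exact: openT|exact: Ck_cst|exact: su].
have sh : smooth setT h.
  move=> n; apply: CkM; [exact: openT|exact: sb|].
  apply: CkV; [exact: openT|by move=> x _; exact: den0|].
  by apply: CkD; [exact: openT|exact: sb|exact: sb].
have h01 t : 0 <= h t <= 1.
  have d0 : 0 < den (u t) by rewrite lt_neqAle eq_sym den0 addr_ge0 ?bump0_ge0.
  apply/andP; split; first by rewrite divr_ge0 ?bump0_ge0// ltW.
  by rewrite ler_pdivrMr// mul1r /den lerDr bump0_ge0.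
exists (fun t => c + (t - c) * h t); split.
- move=> n; apply: CkD; [exact: openT|exact: Ck_cst|apply: CkM; [exact: openT| |exact: sh]].
  by apply: CkD; [exact: openT|exact: Ck_id|exact: Ck_cst].
- move=> t tc; have u0 : u t <= 0 by rewrite ler_pdivrMr// mul0r subr_le0.
  have -> : h t = 1.
    have := den0 (u t); rewrite /h /den (bump0_eq0 u0) add0r => ?.
    by rewrite divff.
  by rewrite mulr1 addrC subrK.
- move=> t ct; have /andP[h0 h1] := h01 t; have tc : 0 <= t - c by rewrite subr_ge0.
  rewrite lerDl mulr_ge0//= lerD2l.
  have [te|te] := leP (t - c) e; first by rewrite (le_trans _ te)// ler_piMr.
  have -> : h t = 0.
    rewrite /h bump0_eq0 ?mul0r// subr_le0 /u ler_pdivlMr// mul1r; exact: ltW.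
  by rewrite mulr0 ltW.
Qed.

End SmoothStep.

(** * Orthonormal bases of a smooth family of projectors *)

Section OrthonormalFrames.
Variables (R : realType) (N : nat).
Local Notation E := 'rV[R]_N.

(** The trace of an orthogonal projector is its rank; it drops by one when a line is split off. *)
Definition is_projector k (P : 'M[R]_N) := [/\ P^T = P, P *m P = P & \tr P = k%:R].

(** The rows of [B] form an orthonormal basis of the range of [P]. *)
Definition onb_of k (P : 'M[R]_N) (B : 'M[R]_(k, N)) := B *m B^T = 1%:M /\ B^T *m B = P.

Lemma dot_mx11 (u v : E) : u *m v^T = (dot u v)%:M.
Proof. by rewrite [LHS]mx11_scalar dotE. Qed.

Lemma projector_entry k (P : 'M[R]_N) i : is_projector k P -> P i i = dot (row i P) (row i P).
Proof.
move=> [PT PP _]; rewrite -{1}PP -{2}PT mxE /dot; apply: eq_bigr => j _.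
by rewrite !mxE.
Qed.

Lemma projector0 (P : 'M[R]_N) : is_projector 0 P -> P = 0.
Proof.
move=> pP; have [_ _ /eqP] := pP; rewrite /mxtrace.
under eq_bigr do rewrite (projector_entry _ pP).
rewrite psumr_eq0 => [/allP h|i _]; last exact: dot_ge0.
apply/row_matrixP => i; rewrite row0; apply: dot_eq0.
by apply/eqP; exact: (implyP (h i (mem_index_enum _))).
Qed.

Lemma projector_row k (P : 'M[R]_N) : is_projector k.+1 P -> exists i, row i P != 0.
Proof.
move=> [_ _ trP]; apply/existsP; apply: contraT => /existsPn h.
have P0 : P = 0 by apply/row_matrixP => i; rewrite row0; apply/eqP; rewrite -[_ == _]negbK; exact: h.
by move/eqP: trP; rewrite P0 mxtrace0 eq_sym pnatr_eq0.
Qed.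

Lemma projector_split k (P : 'M[R]_N) (e : E) : is_projector k.+1 P -> e *m P = e -> dot e e = 1 ->
  is_projector k (P - e^T *m e).
Proof.
move=> [PT PP trP] eP ee; have Pe : P *m e^T = e^T by rewrite -{1}PT -trmx_mul eP.
split.
- by rewrite linearB /= trmx_mul trmxK PT.
- rewrite mulmxBl !mulmxBr PP mulmxA Pe -[e^T *m e *m P]mulmxA eP.
  rewrite -[_ *m (e^T *m e)]mulmxA [e *m (_ *m _)]mulmxA dot_mx11 ee mul1mx.
  by rewrite subrr subr0.
- by rewrite linearB /= trP mxtrace_mulC dot_mx11 ee mxtrace1 -natr1 addrK.
Qed.

Lemma onb_cons k (P : 'M[R]_N) (e : E) (B : 'M[R]_(k, N)) : e *m P = e -> dot e e = 1 ->
  onb_of (P - e^T *m e) B -> onb_of P (col_mx e B).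
Proof.
move=> eP ee [BB BP]; have ee' : e *m e^T = 1%:M by rewrite dot_mx11 ee.
have eB : e *m B^T = 0.
  have : e *m (B^T *m B) = 0 by rewrite BP mulmxBr eP mulmxA ee' mul1mx subrr.
  by move=> /(congr1 (mulmx^~ B^T)); rewrite /= mul0mx -!mulmxA BB mulmx1.
split; rewrite tr_col_mx.
  rewrite mul_col_row ee' BB eB -[B *m e^T]trmxK trmx_mul trmxK eB trmx0.
  by rewrite -scalar_mx_block.
by rewrite mul_row_col BP addrC subrK.
Qed.

Lemma Ck_col_mx (V : normedModType R) n (O : set V) p q l (u : V -> 'M[R]_(p, l))
    (B : V -> 'M[R]_(q, l)) : open O ->
  Ck n O u -> Ck n O B -> Ck n O (fun t => col_mx (u t) (B t)).
Proof.
move=> oO cu cB; apply: (Ck_mx_of oO) => i j.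
have -> : (fun t => col_mx (u t) (B t) i j) =
    (fun t => match fintype.split i with inl a => u t a j | inr b => B t b j end).
  by apply/funext => t; rewrite mxE.
by case: (fintype.split i) => a; apply: (Ck_coord _ _ oO).
Qed.

(** Gram-Schmidt carried out on projectors: a row of [P] that is nonzero at [t0] is normalized
    nearby, and removing its line leaves a projector of smaller rank. *)
Lemma local_onb k : forall (P : R -> 'M[R]_N) O t0, open O -> O t0 -> smooth O P ->
  (forall t, O t -> is_projector k (P t)) ->
  exists (B : R -> 'M[R]_(k, N)) (r : R), [/\ 0 < r, smooth [set t | `|t - t0| < r] B &
    forall t, `|t - t0| < r -> O t /\ onb_of (P t) (B t)].
Proof.
elim: k => [|k IH] P O t0 oO Ot0 sP PP.
  have [r r0 Hr] := open_ballR oO Ot0.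
  exists (fun _ => 0), r; split=> [//||t /Hr Ot]; first by move=> n; exact: Ck_cst.
  split=> //; split; first by rewrite [LHS]flatmx0 [RHS]flatmx0.
  by rewrite (projector0 (PP t Ot)) mulmx0.
have [i ui] := projector_row (PP t0 Ot0).
pose u t : E := delta_mx 0 i *m P t.
have uP t : O t -> u t *m P t = u t.
  by move=> /PP[_ h _]; rewrite /u -mulmxA h.
have su : smooth O u by move=> n; apply: (Ck_mulmx oO); [exact: Ck_cst|exact: sP].
pose q t := dot (u t) (u t).
have sq : smooth O q by move=> n; apply: Ck_dot => //; exact: su.
have q0 : 0 < q t0.
  rewrite lt_neqAle dot_ge0 andbT eq_sym; apply: contraNneq ui => /dot_eq0.
  by rewrite /u -rowE => ->.
have [r1 r10 H1] := continuous_ball (smooth_cont sq Ot0) q0.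
have [r2 r20 H2] := open_ballR oO Ot0.
pose O' := [set t | `|t - t0| < Num.min r1 r2].
have oO' : open O' := open_ball_setR R t0 _.
have O'O : O' `<=` O by move=> t; rewrite /O' /= lt_min => /andP[_]; exact: H2.
have q0' t : O' t -> 0 < q t.
  by rewrite /O' /= lt_min => /andP[/H1 h _]; exact: dist_gt0 h.
pose e t := (Num.sqrt (q t))^-1 *: u t.
have se : smooth O' e.
  move=> n; apply: (Ck_scalemx oO'); last exact: Ck_sub O'O _ (su n).
  apply: (CkV oO'); first by move=> t /q0' qt; rewrite gt_eqF// sqrtr_gt0.
  apply: (Ck_comp_R (O' := [set x : R | 0 < x]) (g := q) oO' _ _ (smooth_sqrt R n)).
    exact: q0'.
  exact: Ck_sub O'O _ (sq n).
have eP t : O' t -> e t *m P t = e t by move=> /O'O/uP h; rewrite /e -scalemxAl h.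
have ee t : O' t -> dot (e t) (e t) = 1.
  move=> /q0' qt; rewrite /e dotZl dotZr mulrA -invfM -expr2 sqr_sqrtr ?(ltW qt)//.
  by rewrite mulVf// gt_eqF.
have O't0 : O' t0 by rewrite /O' /= subrr normr0 lt_min r10.
have [||B [r [r0 sB HB]]] := IH (fun t => P t - (e t)^T *m e t) O' t0 oO' O't0.
- move=> n; apply: (CkB oO'); first exact: Ck_sub O'O _ (sP n).
  by apply: (Ck_mulmx oO'); [apply: (Ck_trmx oO'); exact: se|exact: se].
- by move=> t O't; apply: projector_split; [exact: PP (O'O _ O't)|exact: eP|exact: ee].
have oB := open_ball_setR R t0 r.
have BO' : [set t | `|t - t0| < r] `<=` O' by move=> t /HB[].
exists (fun t => col_mx (e t) (B t)), r; split=> // [n|t tr].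
  by apply: (Ck_col_mx oB); [exact: Ck_sub BO' _ (se n)|exact: sB].
have [ O't Bt] := HB t tr; split; first exact: O'O.
by apply: onb_cons => //; [exact: eP|exact: ee].
Qed.

(** At the supremum of the points of [a, b] satisfying [Q], the local step carries [Q] from a point
    just below to one beyond, which is contradictory unless [b] is within reach. *)
Lemma interval_induction (Q : R -> Prop) (a b : R) : a <= b -> Q a ->
  (forall c, a <= c <= b -> exists2 d : R, 0 < d & forall s t, a <= s -> s <= t -> t <= b ->
     `|s - c| < d -> `|t - c| < d -> Q s -> Q t) -> Q b.
Proof.
move=> ab Qa step; pose S := [set c | a <= c <= b /\ Q c].
have Sa : S a by split=> //; rewrite lexx.
have hS : has_sup S by split; [exists a|exists b => c [/andP[]]].
have aS : a <= sup S by apply: (ub_le_sup hS.2).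
have Sb : sup S <= b by apply: ge_sup; [exists a|move=> c [/andP[]]].
have [d d0 Hd] := step (sup S) ltac:(by rewrite aS).
have [s [/andP[as_ sb] Qs] ds] := sup_adherent d0 hS.
have sS : s <= sup S by apply: (ub_le_sup hS.2); split=> //; rewrite as_.
have sd : `|s - sup S| < d by rewrite ltr_norml; apply/andP; split; lra.
have d2 : 0 < d / 2 by rewrite divr_gt0.
have [bS|bS] := leP b (sup S + d / 2).
  by apply: (Hd s b) => //; rewrite ltr_norml; apply/andP; split; lra.
have : S (sup S + d / 2).
  split; first by rewrite (ltW bS) andbT; lra.
  apply: (Hd s) => //; [lra|exact: ltW|].
  by rewrite ltr_norml; apply/andP; split; lra.
by move=> /(ub_le_sup hS.2); rewrite gerDl leNgt d2.
Qed.

(* Two frames of the same subspaces are glued by freezing the orthogonal transition matrix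
   [A *m B^T] past the gluing point along a smooth clamp of the parameter. *)
Lemma glue_onb k (P : R -> 'M[R]_N) (O1 O2 : set R) (A B : R -> 'M[R]_(k, N)) s : open O1 -> open O2 ->
  O1 s -> O2 s -> smooth O1 A -> smooth O2 B ->
  (forall t, O1 t -> onb_of (P t) (A t)) -> (forall t, O2 t -> onb_of (P t) (B t)) ->
  exists (O : set R) (C : R -> 'M[R]_(k, N)), [/\ open O, smooth O C, (forall t, O t -> onb_of (P t) (C t)) &
    forall t, (t <= s /\ O1 t) \/ (s <= t /\ O2 t) -> O t].
Proof.
move=> oO1 oO2 O1s O2s sA sB AP BP.
have [r1 r10 H1] := open_ballR oO1 O1s; have [r2 r20 H2] := open_ballR oO2 O2s.
pose r := Num.min r1 r2; have r0 : 0 < r by rewrite lt_min r10.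
have rO1 t : `|t - s| < r -> O1 t by rewrite lt_min => /andP[/H1].
have rO2 t : `|t - s| < r -> O2 t by rewrite lt_min => /andP[_ /H2].
have r2' : 0 < r / 2 by rewrite divr_gt0.
have [th [sth thl thr]] := smooth_clamp s r2'.
pose V := [set t | `|t - s| < r]; have oV : open V := open_ball_setR R s r.
pose T t : 'M[R]_k := A t *m (B t)^T.
have sT : smooth V T.
  move=> n; apply: (Ck_mulmx oV); first exact: Ck_sub rO1 _ (sA n).
  by apply: (Ck_trmx oV); exact: Ck_sub rO2 _ (sB n).
have TB t : V t -> T t *m B t = A t.
  move=> Vt; have [AA AP'] := AP t (rO1 t Vt); have [BB BP'] := BP t (rO2 t Vt).
  by rewrite /T -mulmxA BP' -AP' mulmxA AA mul1mx.
have TT t : V t -> T t *m (T t)^T = 1%:M /\ (T t)^T *m T t = 1%:M.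
  move=> Vt; have [AA AP'] := AP t (rO1 t Vt); have [BB BP'] := BP t (rO2 t Vt).
  rewrite /T trmx_mul trmxK; split.
    by rewrite mulmxA -[A t *m _ *m B t]mulmxA BP' -AP' mulmxA AA mul1mx AA.
  by rewrite mulmxA -[B t *m _ *m A t]mulmxA AP' -BP' mulmxA BB mul1mx BB.
have Vs : V s by rewrite /V /= subrr normr0.
pose X := [set t | O2 t /\ s - r < t].
have thV t : X t -> V (th t).
  move=> [_ tr]; have [ts|st] := leP t s.
    by rewrite (thl t ts) /V /= ltr_norml; apply/andP; split; lra.
  have /andP[h1 h2] := thr t (ltW st).
  by rewrite /V /= ltr_norml; apply/andP; split; lra.
have oX : open X.
  apply: ball_open_set => t [ O2t tr]; have [e e0 He] := open_ballR oO2 O2t.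
  have tr0 : 0 < t - (s - r) by rewrite subr_gt0.
  exists (Num.min e (t - (s - r))); first by rewrite lt_min e0.
  move=> y; rewrite lt_min => /andP[/He O2y]; rewrite ltr_norml => /andP[h1 h2].
  by split=> //; lra.
pose Y := [set t | O1 t /\ t < s].
have oY : open Y.
  apply: ball_open_set => t [ O1t ts]; have [e e0 He] := open_ballR oO1 O1t.
  have tr0 : 0 < s - t by rewrite subr_gt0.
  exists (Num.min e (s - t)); first by rewrite lt_min e0.
  move=> y; rewrite lt_min => /andP[/He O1y]; rewrite ltr_norml => /andP[h1 h2].
  by split=> //; lra.
(* The second formula already holds on [X], slightly to the left of [s], where the clamp is the
   identity and [T t *m B t = A t]; hence [C] is smooth across [s]. *)
pose C t := if t < s then A t else T (th t) *m B t.
have CX t : X t -> C t = T (th t) *m B t.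
  move=> [ O2t tr]; rewrite /C; case: ifP => // ts; rewrite (thl t (ltW ts)) TB//.
  by rewrite /V /= ltr_norml; apply/andP; split; lra.
have CY t : Y t -> C t = A t by move=> [_ ts]; rewrite /C ts.
have sC : exists O, [/\ open O, Y `|` X `<=` O & smooth O C].
  apply: smooth_local => t [Yt|Xt].
    exists Y; split=> //; apply: (smooth_ext (f := A) oY).
      by move=> u /CY.
    by apply: smooth_sub sA => u [].
  exists X; split=> //; apply: (smooth_ext (f := fun t => T (th t) *m B t) oX).
    by move=> u /CX.
  move=> n; apply: (Ck_mulmx oX).
    apply: (Ck_comp_mxR (O' := V) (f := T) oX oV) => //.
    exact: Ck_sub (subsetT _) _ (sth n).
  by apply: Ck_sub _ _ (sB n) => u [].
have [ O [oO YXO sO]] := sC.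
exists (Y `|` X), C; split.
- exact: openU.
- exact: smooth_sub YXO sO.
- move=> t [Yt|Xt]; first by rewrite (CY t Yt); apply: AP; case: Yt.
  rewrite (CX t Xt); have [BB BP'] := BP t Xt.1; have [T1 T2] := TT _ (thV t Xt).
  split; rewrite trmx_mul; first by rewrite mulmxA -[_ *m B t *m _]mulmxA BB mulmx1.
  by rewrite mulmxA -[(B t)^T *m _ *m _]mulmxA T2 mulmx1.
move=> t [[ts O1t]|[st O2t]]; last by right; split=> //; lra.
move: ts; rewrite le_eqVlt => /orP[/eqP ->|ts]; last by left.
by right; split=> //; lra.
Qed.

Lemma global_onb k (P : R -> 'M[R]_N) (J : set R) a b : open J -> is_interval J -> J a -> J b -> a <= b ->
  smooth J P -> (forall t, J t -> is_projector k (P t)) ->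
  exists (O : set R) (B : R -> 'M[R]_(k, N)), [/\ open O, smooth O B,
    (forall t, O t -> onb_of (P t) (B t)) & forall t, a <= t <= b -> O t].
Proof.
move=> oJ iJ Ja Jb ab sP PP.
pose Q c := exists (O : set R) (B : R -> 'M[R]_(k, N)), [/\ open O, smooth O B,
    (forall t, O t -> onb_of (P t) (B t)) & forall t, a <= t <= c -> O t].
apply: (interval_induction (Q := Q) ab).
  have [B [r [r0 sB HB]]] := local_onb oJ Ja sP PP.
  exists [set t | `|t - a| < r], B; split=> //; first exact: open_ball_setR.
    by move=> t /HB[].
  by move=> t; rewrite -eq_le => /eqP <-; rewrite /= subrr normr0.
move=> c /(iJ _ _ Ja Jb) Jc; have [B [r [r0 sB HB]]] := local_onb oJ Jc sP PP.
exists r => // s t as_ st tb sr tr [ O1 [A [oO1 sA AP O1s]]].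
have BP u : [set t | `|t - c| < r] u -> onb_of (P u) (B u) by move=> /HB[].
have O1s' : O1 s by apply: O1s; rewrite as_ lexx.
have [ O [C [oO sC CP HO]]] := glue_onb oO1 (open_ball_setR R c r) O1s' sr sA sB AP BP.
exists O, C; split=> // u /andP[au ut]; apply: HO.
have [us|su] := leP u s; [left|right]; first by split=> //; apply: O1s; rewrite au.
split; first exact: ltW.
by apply: (@ball_interval R c r s t sr tr); rewrite (ltW su).
Qed.

End OrthonormalFrames.

(** * Existence of an adapted frame and a transversal section *)

Section AdaptedFrame.
Variables (R : realType) (N m : nat).
Local Notation E := 'rV[R]_N.

Definition proj_mx (D : {vspace E}) : 'M[R]_N := \matrix_(i < N) proj [set` D] (delta_mx 0 i).

Lemma proj_mx_rowsp (D : {vspace E}) (A : 'M[R]_(m, N)) : [set` D] = rowsp A -> gram_unit A ->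
  proj_mx D = A^T *m invmx (A *m A^T) *m A.
Proof.
move=> DA u; apply/row_matrixP => i; rewrite rowK (proj_gram _ DA u) /gproj.
by rewrite rowE !mulmxA.
Qed.

Lemma projE (D : {vspace E}) v : proj [set` D] v = v *m proj_mx D.
Proof.
rewrite {1}(row_sum_delta v) mulmx_sum_row; elim: (index_enum _) => [|i s IH].
  by rewrite !big_nil; apply: proj_id; exact: mem0v.
by rewrite !big_cons proj_lin IH rowK.
Qed.

Lemma proj_mx_projector (D : {vspace E}) (A : 'M[R]_(m, N)) : [set` D] = rowsp A -> gram_unit A ->
  is_projector m (proj_mx D).
Proof.
move=> DA u; rewrite (proj_mx_rowsp DA u); set G := A *m A^T in u *.
have GT : G^T = G by rewrite /G trmx_mul trmxK.
split.
- by rewrite !trmx_mul trmxK trmx_inv GT mulmxA.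
- by rewrite !mulmxA -[_ *m A *m A^T]mulmxA -/G mulmxKV.
- by rewrite -mulmxA mxtrace_mulC -mulmxA mulVmx// mxtrace1.
Qed.

Variables (J : set R) (g : R -> E) (D : R -> {vspace E}).
Hypotheses (H : cauchy_data m J g D) (oJ : open J).

Lemma smooth_proj_mx : smooth J (fun t => proj_mx (D t)).
Proof.
have [|O [oO JO sO]] := @smooth_local R _ _ J (fun t => proj_mx (D t)).
  move=> t0 Jt0; have [A [r [r0 sA uA DA]]] := local_frame H Jt0.
  have [r' r'0 Hr'] := open_ballR oJ Jt0.
  pose B := [set t | `|t - t0| < Num.min r r']; have oB : open B := open_ball_setR R t0 _.
  have Br t : B t -> `|t - t0| < r by rewrite /B /= lt_min => /andP[].
  exists B; split=> //; first by rewrite /B /= subrr normr0 lt_min r0.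
  apply: (smooth_ext (f := fun t => (A t)^T *m invmx (A t *m (A t)^T) *m A t) oB).
    move=> t Bt; have Jt : J t by apply: Hr'; move: Bt; rewrite /B /= lt_min => /andP[].
    by rewrite (proj_mx_rowsp (DA t (Br t Bt) Jt) (uA t (Br t Bt))).
  have sAB : smooth B A by exact: smooth_sub Br sA.
  move=> n; apply: (Ck_mulmx oB); last exact: sAB.
  apply: (Ck_mulmx oB); first by apply: (Ck_trmx oB); exact: sAB.
  apply: (Ck_invmx oB); first by move=> t /Br/uA.
  by apply: (Ck_mulmx oB); [exact: sAB|apply: (Ck_trmx oB); exact: sAB].
exact: smooth_sub JO sO.
Qed.

Lemma data_projector t : J t -> is_projector m (proj_mx (D t)).
Proof.
move=> Jt; have [A [r [r0 sA uA DA]]] := local_frame H Jt.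
have tt : `|t - t| < r by rewrite subrr normr0.
exact: proj_mx_projector (DA t tt Jt) (uA t tt).
Qed.

Lemma data_gamma_smooth : smooth J g.
Proof. by have [ O [oO JO sO]] := gamma_smooth H; exact: smooth_sub JO sO. Qed.

Definition normal_curv t := perp_proj [set` D t] (derive1n 2 g t).

(** The normal curvature vector is orthogonal to the velocity; differentiating this relation gives
    minus its squared length as the product of its derivative with the velocity. It is therefore
    itself a transversal section. *)
Lemma normal_curv_section : [/\ smooth J normal_curv,
  (forall t, J t -> orth [set` D t] (normal_curv t)) &
  (forall t, J t -> dot (derive1 normal_curv t) (derive1 g t) != 0)].
Proof.
have sg' : smooth J (derive1 g) by apply: smooth_derive1; exact: data_gamma_smooth.
have D2 : derive1n 2 g = derive1 (derive1 g) by rewrite derive1nS derive1n1.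
have sn : smooth J normal_curv.
  have -> : normal_curv = fun t => derive1n 2 g t - derive1n 2 g t *m proj_mx (D t).
    by apply/funext => t; rewrite /normal_curv /perp_proj projE.
  have sg2 : smooth J (derive1n 2 g) by rewrite D2; exact: smooth_derive1.
  move=> n; apply: (CkB oJ); first exact: sg2.
  by apply: (Ck_mulmx oJ); [exact: sg2|exact: smooth_proj_mx].
have no t : J t -> orth [set` D t] (normal_curv t) by move=> _; exact: perp_orth'.
split=> // t Jt.
have dn : differentiable normal_curv t := smooth_diff sn Jt.
have dg : differentiable (derive1 g) t := smooth_diff sg' Jt.
have : derive1 (fun u => dot (normal_curv u) (derive1 g u)) t = derive1 (cst 0) t.
  by apply: near_derive1; apply: (near_open oJ Jt) => u Ju; apply: no => //; exact: (cd_tan H).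
rewrite derive1_cst derive1E (derive_dot (1 : R) dn dg) -!derive1E.
have -> : dot (normal_curv t) (derive1 (derive1 g) t) = dot (normal_curv t) (normal_curv t).
  rewrite -D2 {3}/normal_curv /perp_proj dotBr (no t Jt _ (proj_in _ _)) subr0.
  by [].
move=> /eqP; rewrite addr_eq0 => /eqP ->; rewrite oppr_eq0; apply/eqP => /dot_eq0 n0.
by move/eqP: (cd_curv H Jt); apply.
Qed.

End AdaptedFrame.

Lemma compact_bounds (R : realType) (I : set R) : I !=set0 -> compact I ->
  exists a b, [/\ I a, I b & forall t, I t -> a <= t <= b].
Proof.
move=> I0 cI.
have cid : {within I, continuous (fun t : R => t)} by apply: continuous_subspaceT => t; exact: cvg_id.
have [b bI Hb] := compact_EVT_max I0 cI cid.
have [a aI Ha] := compact_EVT_min I0 cI cid.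
rewrite !inE in aI bI; exists a, b; split=> // t It.
by rewrite Ha ?Hb ?inE.
Qed.

Lemma dot_row (R : realType) N k (u : 'rV[R]_N) (B : 'M[R]_(k, N)) j :
  dot u (row j B) = (u *m B^T) 0 j.
Proof. by rewrite mxE; apply: eq_bigr => i _; rewrite !mxE. Qed.

Lemma adapted_data_exist (R : realType) N m I (gamma : R -> 'rV[R]_N) D : cauchy_data m I gamma D ->
  (0 < m)%N -> (forall t, I t -> has_dim (im_rho I D t) 1%N) -> compact I ->
  (forall t, I t -> dot (derive1 gamma t) (derive1 gamma t) = 1) ->
  exists e nu, adapted_frame m I gamma D e /\ transversal_section I D nu.
Proof.
move=> H m0 rk cI unit; have [J [g [D' [oJ HJ rkJ IJ ag]]]] := open_extension H rk.
have I0 : I !=set0 by have [t It] := cd_nondeg H; exists t; exact: interior_subset.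
have [a [b [aI bI ab]]] := compact_bounds I0 cI.
have g'E t : I t -> derive1 g t = derive1 gamma t.
  move=> It; have [ O [oO IO sO]] := gamma_smooth H.
  apply: (derive1_eq_on (cd_itv H) (cd_nondeg H) It).
  - exact: smooth_diff (data_gamma_smooth HJ) (IJ t It).
  - exact: smooth_diff sO (IO t It).
  - by apply: (near_open openT Logic.I) => s _ /ag[].
pose P t := proj_mx (D' t); have sP : smooth J P := smooth_proj_mx HJ oJ.
have PP t : J t -> is_projector m (P t) by move=> Jt; exact: (data_projector HJ).
have inD t v : v \in D' t -> v *m P t = v by move=> vD; rewrite /P -projE proj_id.
pose c t := derive1 g t; have sc : smooth J c by apply: smooth_derive1; exact: data_gamma_smooth HJ.
have cP t : J t -> c t *m P t = c t by move=> Jt; apply: inD; exact: (cd_tan HJ).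
have c0 t : J t -> 0 < dot (c t) (c t).
  move=> Jt; rewrite lt_neqAle dot_ge0 andbT eq_sym; apply/eqP => /dot_eq0 E0.
  have [_ imm _] := cd_emb HJ; have := imm t (1 : R) Jt; rewrite -derive1E -/(c t) E0 => /(_ erefl)/eqP.
  by rewrite oner_eq0.
(* The extended curve is known to have unit speed on [I] only, so its tangent is normalized on
   [J]. *)
pose T t := (Num.sqrt (dot (c t) (c t)))^-1 *: c t.
have sT : smooth J T.
  move=> n; apply: (Ck_scalemx oJ); last exact: sc.
  apply: (CkV oJ); first by move=> t /c0 h; rewrite gt_eqF// sqrtr_gt0.
  apply: (Ck_comp_R (O' := [set x : R | 0 < x]) (g := fun t => dot (c t) (c t)) oJ _ _ (smooth_sqrt R n)).
    exact: c0.
  by apply: Ck_dot => //; exact: sc.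
have TP t : J t -> T t *m P t = T t by move=> /cP h; rewrite /T -scalemxAl h.
have TT t : J t -> dot (T t) (T t) = 1.
  move=> /c0 h; rewrite /T dotZl dotZr mulrA -invfM -expr2 sqr_sqrtr ?(ltW h)//.
  by rewrite mulVf// gt_eqF.
have TI t : I t -> T t = derive1 gamma t.
  by move=> It; rewrite /T /c (g'E t It) (unit t It) sqrtr1 invr1 scale1r.
pose Q t := P t - (T t)^T *m T t.
have sQ : smooth J Q.
  move=> n; apply: (CkB oJ); first exact: sP.
  by apply: (Ck_mulmx oJ); [apply: (Ck_trmx oJ); exact: sT|exact: sT].
have QP t : J t -> is_projector m.-1 (Q t).
  move=> Jt; apply: projector_split; [|exact: TP|exact: TT].
  by rewrite prednK//; exact: PP.
have [ O [B [oO sB BP HO]]] := global_onb oJ (cd_itv HJ) (IJ _ aI) (IJ _ bI) (andP (ab a aI)).2 sQ QP.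
have IO t : I t -> O t by move=> /ab/HO.
pose e i t := if i is j.+1 then mx_rows (B t) j else derive1 gamma t.
have TB t : I t -> T t *m (B t)^T = 0.
  move=> It; have [BB BQ] := BP t (IO t It).
  have : T t *m ((B t)^T *m B t) = 0.
    by rewrite BQ /Q mulmxBr (TP t (IJ t It)) mulmxA dot_mx11 (TT t (IJ t It)) mul1mx subrr.
  by move=> /(congr1 (mulmx^~ (B t)^T)); rewrite /= mul0mx -!mulmxA BB mulmx1.
have rowB t j (jm : (j < m.-1)%N) : mx_rows (B t) j = row (Ordinal jm) (B t).
  by rewrite /mx_rows insubT.
have BD t j : I t -> (j < m.-1)%N -> mx_rows (B t) j \in D t.
  move=> It jm; rewrite rowB; have [BB BQ] := BP t (IO t It).
  have BPB : B t *m P t = B t.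
    have -> : P t = Q t + (T t)^T *m T t by rewrite /Q subrK.
    rewrite mulmxDr -BQ mulmxA BB mul1mx mulmxA -[B t *m (T t)^T]trmxK trmx_mul trmxK (TB t It).
    by rewrite trmx0 mul0mx addr0.
  have -> : row (Ordinal jm) (B t) = row (Ordinal jm) (B t) *m P t by rewrite -row_mul BPB.
  by rewrite /P -projE; have [_ <-] := ag t It; exact: proj_in.
have nu := normal_curv_section HJ oJ; have [sn no n'] := nu.
exists e, (normal_curv g D'); split; split.
- move=> [|j] im.
    have [ O' [oO' IO' sO']] := gamma_smooth H.
    by apply: (smooth_smooth_on oO' IO'); exact: smooth_derive1.
  have jm : (j < m.-1)%N by rewrite -ltnS prednK.
  apply: (smooth_smooth_on oO IO) => n.
  apply: (Ck_ext oO (f := fun t => delta_mx 0 (Ordinal jm) *m B t)).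
    by move=> t _; rewrite /e rowB rowE.
  by apply: (Ck_mulmx oO); [exact: Ck_cst|exact: sB].
- move=> t It; have [_ DD] := ag t It.
  have inS i : (i < m)%N -> e i t \in <<mkseq (fun i => e i t) m>>%VS.
    by move=> im; apply: memv_span; apply/mapP; exists i => //; rewrite mem_iota.
  apply/eqP; rewrite eqEsubv; apply/andP; split; last first.
    apply/span_subvP => v /mapP[[|j]]; rewrite mem_iota add0n => /andP[_ im] ->; first exact: (cd_tan H).
    by apply: BD => //; rewrite -ltnS prednK.
  apply/subvP => v; rewrite -DD => vD; rewrite -(inD t v vD).
  have -> : P t = Q t + (T t)^T *m T t by rewrite /Q subrK.
  have [_ <-] := BP t (IO t It); rewrite mulmxDr !mulmxA; apply: memvD.
    rewrite mulmx_sum_row; apply: memv_suml => j _; apply: memvZ.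
    have jm : (j.+1 < m)%N by rewrite -ltn_predRL.
    have -> : row j (B t) = e j.+1 t.
      by rewrite /e (rowB t j (ltn_ord j)); congr (row _ _); exact: val_inj.
    exact: inS.
  by rewrite dot_mx11 mul_scalar_mx (TI t It); apply: memvZ; exact: (inS 0%N m0).
- have lt1 i : (i.+1 < m)%N -> (i < m.-1)%N by move=> h; rewrite -ltnS prednK.
  have e0j t j (jm : (j < m.-1)%N) : I t -> dot (derive1 gamma t) (mx_rows (B t) j) = 0.
    by move=> It; rewrite -(TI t It) rowB dot_row TB// mxE.
  move=> t [|i] [|j] It im jm; rewrite /e.
  + by rewrite unit.
  + by rewrite e0j// lt1.
  + by rewrite dotC e0j// lt1.
  + rewrite !rowB ?lt1// => im' jm'; rewrite dot_row -row_mul (BP t (IO t It)).1.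
    by rewrite !mxE -val_eqE /= eqSS.
- by move=> t It.
- by apply: (smooth_smooth_on oJ IJ).
- by move=> t It; have [_ <-] := ag t It; apply: no; exact: IJ.
- move=> t It; have Jt := IJ t It; apply/eqP => E0; move/eqP: (n' t Jt); apply.
  have gD : derive1 g t \in D t by rewrite (g'E t It); exact: (cd_tan H).
  by rewrite -(dot_proj _ gD) E0 dot0l.
Qed.

(** * The parametrization by rulings *)

Lemma half_norm_le (R : realFieldType) (a b : R) : `|a - b| <= `|b| / 2 -> `|b| / 2 <= `|a|.
Proof.
by move=> h; have := ler_distD a b 0; rewrite !subr0 distrC => h'; move: h h'; set x := `|b|; set y := `|a|; lra.
Qed.

(** Of a distance [eta] between two curve points, the displacement of the base point and the two
    ruling vectors consume less than a quarter each. *)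
Lemma far_bound (R : realFieldType) (eta g gt u'X uX z a1 a2 u' u : R) : eta <= g -> gt < eta / 4 ->
  u'X <= u' -> uX <= u -> u < eta / 4 -> u' < eta / 4 ->
  a1 <= z + gt -> a2 <= a1 + uX -> g <= a2 + u'X -> eta / 4 <= z.
Proof. lra. Qed.

Section Products.
Variables (R : realType) (V W : normedModType R).

Lemma linear_derive (U T : normedModType R) (d : {linear U -> T}) q v :
  continuous d -> 'D_v d q = d v.
Proof. by move=> cd; rewrite (deriveE v (linear_differentiable _ cd)) (diff_lin _ cd). Qed.

Lemma Ck_linear (U T : normedModType R) (d : {linear U -> T}) n (O : set U) :
  continuous d -> Ck n O d.
Proof.
move=> cd; apply: (@Ck_sub _ _ _ setT O n (@subsetT _ O)).
case: n => [q _|n]; first exact: cd.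
split=> [q _|v]; first exact: linear_differentiable.
apply: (Ck_ext openT (f := cst (d v))); last exact: Ck_cst.
by move=> q _; rewrite linear_derive.
Qed.

Definition fst_lin : {linear (V * W)%type -> V} :=
  HB.pack (fst : V * W -> V) (@GRing.isLinear.Build R (V * W)%type V _ fst (fun a u v => erefl)).

Definition snd_lin : {linear (V * W)%type -> W} :=
  HB.pack (snd : V * W -> W) (@GRing.isLinear.Build R (V * W)%type W _ snd (fun a u v => erefl)).

Lemma Ck_fst n (O : set (V * W)) : Ck n O (fun q : V * W => q.1).
Proof. by apply: (@Ck_linear _ _ fst_lin) => q; exact: cvg_fst. Qed.

Lemma Ck_snd n (O : set (V * W)) : Ck n O (fun q : V * W => q.2).
Proof. by apply: (@Ck_linear _ _ snd_lin) => q; exact: cvg_snd. Qed.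

Lemma derive_fst (q v : V * W) : 'D_v (fun q : V * W => q.1) q = v.1.
Proof. by apply: (@linear_derive _ _ fst_lin) => p; exact: cvg_fst. Qed.

Lemma derive_snd (q v : V * W) : 'D_v (fun q : V * W => q.2) q = v.2.
Proof. by apply: (@linear_derive _ _ snd_lin) => p; exact: cvg_snd. Qed.

End Products.

(** * Estimates for the map [sigma] *)

Section Sigma.
Variables (R : realType) (N m : nat).
Local Notation E := 'rV[R]_N.
Variables (I : set R) (gamma : R -> E) (D : R -> {vspace E}).
Hypotheses (H : cauchy_data m I gamma D) (m0 : (0 < m)%N).
Hypothesis rk : forall t, I t -> has_dim (im_rho I D t) 1%N.
Variables (e : nat -> R -> E) (nu : R -> E).
Hypotheses (He : adapted_frame m I gamma D e) (Hnu : transversal_section I D nu).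

Let Ieq (W : normedModType R) (f g : R -> W) t := @derive1_eq_on R I (cd_itv H) (cd_nondeg H) W f g t.

Lemma frame_smooth : exists O, [/\ open O, I `<=` O, smooth O gamma, smooth O nu &
  forall i, (i < m)%N -> smooth O (e i)].
Proof.
have [se _ _ _] := He; have [sn _ _] := Hnu.
have [ O1 [oO1 IO1 s1]] := gamma_smooth H; have [ O2 [oO2 IO2 s2]] := smooth_on_R sn.
have [ O3 [oO3 IO3 s3]] : exists O, [/\ open O, I `<=` O & forall i, (i < m)%N -> smooth O (e i)].
  elim: {1 3}m (leqnn m) => [|k IH] km; first by exists setT; split=> //; exact: openT.
  have [ O [oO IO sO]] := IH (ltnW km); have [ O' [oO' IO' sO']] := smooth_on_R (se k km).
  exists (O `&` O'); split; [exact: openI|by move=> t It; split; [exact: IO|exact: IO']|].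
  move=> i; rewrite ltnS leq_eqVlt => /orP[/eqP ->|ik]; first by apply: smooth_sub sO' => t [].
  by apply: smooth_sub (sO i ik) => t [].
exists (O1 `&` (O2 `&` O3)); split.
- by apply: openI => //; exact: openI.
- by move=> t It; split; [exact: IO1|split; [exact: IO2|exact: IO3]].
- by apply: smooth_sub s1 => t [].
- by apply: smooth_sub s2 => t [_ []].
- by move=> i im; apply: smooth_sub (s3 i im) => t [_ []].
Qed.

Lemma frame_in t i : I t -> (i < m)%N -> e i t \in D t.
Proof.
have [_ De _ _] := He; move=> It im; rewrite (De t It); apply: memv_span; apply/mapP.
by exists i => //; rewrite mem_iota.
Qed.

Lemma frame_expand t v : I t -> v \in D t -> v = \sum_(i < m) dot v (e i t) *: e i t.
Proof.
have [_ De ee _] := He; move=> It vD; apply/eqP; rewrite -subr_eq0; apply/eqP; apply: dot_eq0.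
set z := v - _; have zD : z \in D t.
  apply: memvB => //; apply: memv_suml => i _; apply: memvZ; exact: frame_in.
have ze i : (i < m)%N -> dot z (e i t) = 0.
  move=> im; rewrite /z dotBl dot_suml (bigD1 (Ordinal im))//= dotZl ee// eqxx mulr1.
  rewrite big1 ?addr0 ?subrr// => j /negbTE ji; rewrite dotZl ee//.
  by move: ji; rewrite -val_eqE /= => ->; rewrite mulr0.
move: (zD); rewrite {1}(De t It) => /(span_rows m (fun i => e i t))[y yE].
rewrite {2}yE mulmx_sum_row dot_sumr big1// => i _.
by rewrite rowK dotZr ze// mulr0.
Qed.

(** The value of [rho] at the chosen normal section. It spans the image of [rho], so the ruling is
    its orthogonal complement in [D t]. *)
Definition transv t := proj [set` D t] (derive1 nu t).

Lemma transv_section t (Y : R -> E) : I t -> differentiable Y t ->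
  (\forall u \near t, I u -> Y u \in D u) -> dot (transv t) (Y t) = - dot (nu t) (derive1 Y t).
Proof.
move=> It dY YD; have [sn no _] := Hnu; have [ O [oO IO sO]] := smooth_on_R sn.
have Yt : Y t \in D t by apply: (nbhs_singleton YD).
have dn : differentiable nu t by apply: smooth_diff sO _; exact: IO.
rewrite /transv dot_proj//.
have : derive1 (fun u => dot (nu u) (Y u)) t = derive1 (cst 0) t.
  apply: Ieq; [by []|exact: differentiable_dot|exact: differentiable_const|].
  by apply: filterS YD => u Yu Iu; apply: no => //; exact: Yu.
by rewrite derive1_cst derive1E derive_dot// -!derive1E => /eqP; rewrite addr_eq0 => /eqP.
Qed.

Lemma transv_in t : transv t \in D t. Proof. exact: proj_in. Qed.

Lemma transv_rho t : I t -> rho I D t (nu t) = transv t.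
Proof.
move=> It; have [sn no _] := Hnu; have [rD q] := rho_spec H It (no t It).
apply/eqP; rewrite -subr_eq0; apply/eqP; apply: dot_eq0; set z := _ - _.
have zD : z \in D t by apply: memvB => //; exact: transv_in.
have [Y [dY YD Yt]] := section_through H It zD.
by rewrite -{2}Yt /z dotBl q// transv_section// subrr.
Qed.

Lemma transv_curv t : I t -> exists2 c, c != 0 & transv t = c *: rho_curv I gamma D t.
Proof.
move=> It; have [_ no n'] := Hnu.
have [c cE] := (rank_rhoP H It).1 (rk It) (nu t) (no t It).
exists c; last by rewrite -transv_rho.
by have := n' t It; rewrite -/(transv t) -transv_rho// cE; apply: contraNneq => ->; rewrite scale0r.
Qed.

Lemma ruling_transv t v : I t -> ruling I D t v <-> v \in D t /\ dot v (transv t) = 0.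
Proof.
move=> It; rewrite (rulingP H v It (rk It)); have [c c0 ->] := transv_curv It.
by rewrite dotZr; split=> -[vD /eqP h]; split=> //; apply/eqP; move: h; rewrite mulf_eq0 (negbTE c0).
Qed.

(** The component of [transv t] along the unit velocity, and at the same time the coefficient of
    [e j.+1] in the field X_{j+1}. It does not vanish, since the velocity is transverse to the
    rulings. *)
Definition pivot t := - dot (derive1 (e 0%N) t) (nu t).

Lemma transv_frame t i : I t -> (i < m)%N ->
  dot (transv t) (e i t) = - dot (derive1 (e i) t) (nu t).
Proof.
move=> It im; have [ O [oO IO _ _ sO]] := frame_smooth.
rewrite (transv_section It) ?(dotC (nu t))//.
  by apply: smooth_diff (sO i im) _; exact: IO.
by apply: (near_open openT Logic.I) => u _ Iu; exact: frame_in.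
Qed.

Lemma pivotE t : I t -> dot (transv t) (e 0%N t) = pivot t.
Proof. by move=> It; rewrite transv_frame. Qed.

Lemma pivot_neq0 t : I t -> pivot t != 0.
Proof.
move=> It; have [_ _ _ e0] := He; rewrite -pivotE// e0//.
have [c c0 ->] := transv_curv It; have [_ wg] := rho_curv_spec H It.
by rewrite dotZl mulf_neq0// lt_eqF.
Qed.

Definition ruling_mx t : 'M[R]_(m.-1, N) := \matrix_j ruling_field e nu j t.

Definition frame_mx t : 'M[R]_(m.-1, N) := \matrix_(j < m.-1) e j.+1 t.

Lemma sigma_mx q : sigma (m := m) gamma e nu q = gamma q.1 + q.2 *m ruling_mx q.1.
Proof.
by rewrite /sigma mulmx_sum_row; congr (_ + _); apply: eq_bigr => j _; rewrite rowK.
Qed.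

Lemma frame_index_lt (j : 'I_m.-1) : (j.+1 < m)%N. Proof. by rewrite -ltn_predRL. Qed.

Lemma ruling_fieldE j t : ruling_field e nu j t =
  dot (derive1 (e j.+1) t) (nu t) *: e 0%N t + pivot t *: e j.+1 t.
Proof. by rewrite /ruling_field /pivot scaleNr. Qed.

Lemma ruling_mx_in t u : I t -> ruling I D t (u *m ruling_mx t).
Proof.
move=> It; apply/(ruling_transv _ It); rewrite mulmx_sum_row; split.
  apply: memv_suml => j _; apply: memvZ; rewrite rowK ruling_fieldE.
  by apply: memvD; apply: memvZ; apply: frame_in => //; exact: frame_index_lt.
rewrite dot_suml big1// => j _; rewrite rowK ruling_fieldE dotZl dotDl !dotZl.
rewrite !(dotC _ (transv t)) pivotE// transv_frame ?frame_index_lt//.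
by ring.
Qed.

Lemma ruling_frame_mx t : I t -> ruling_mx t *m (frame_mx t)^T = (pivot t)%:M.
Proof.
move=> It; have [_ _ ee _] := He; apply/matrixP => i j.
have -> : (ruling_mx t *m (frame_mx t)^T) i j = row i (ruling_mx t *m (frame_mx t)^T) 0 j.
  by rewrite [RHS]mxE.
rewrite row_mul -dot_row !rowK ruling_fieldE dotDl !dotZl !ee ?frame_index_lt//= mulr0 add0r.
by rewrite eqSS mxE mulr_natr val_eqE.
Qed.

(** Both sides have the same products with all frame vectors but the first. Their difference is a
    multiple of the velocity orthogonal to [transv t], hence 0. *)
Lemma ruling_mx_exists t v : I t -> ruling I D t v -> v = ((pivot t)^-1 *: (v *m (frame_mx t)^T)) *m ruling_mx t.
Proof.
move=> It /(ruling_transv _ It)[vD vw]; set v' := _ *m _; apply/eqP; rewrite -subr_eq0; apply/eqP.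
have p0 := pivot_neq0 It.
have [v'D v'w] : v' \in D t /\ dot v' (transv t) = 0 by apply/(ruling_transv _ It); exact: ruling_mx_in.
set z := v - v'; have zD : z \in D t by apply: memvB.
have zf : z *m (frame_mx t)^T = 0.
  rewrite /z mulmxBl /v' -mulmxA ruling_frame_mx// -scalemxAl mul_mx_scalar scalerA mulVf//.
  by rewrite scale1r subrr.
have zj (j : 'I_m.-1) : dot z (e j.+1 t) = 0.
  have -> : e j.+1 t = row j (frame_mx t) by rewrite rowK.
  by rewrite dot_row zf mxE.
have z0 : dot z (e 0%N t) = 0.
  have zw : dot (transv t) z = 0 by rewrite dotC /z dotBl vw v'w subrr.
  have : dot (transv t) z = dot z (e 0%N t) * pivot t.
    rewrite {1}(frame_expand It zD) dot_sumr (bigD1 (Ordinal m0))//= dotZr pivotE// big1 ?addr0//.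
    move=> i i0; have ip : (0 < i)%N by rewrite lt0n; apply: contraNneq i0 => i0; apply/eqP/val_inj.
    have ii : (i.-1 < m.-1)%N by rewrite -ltnS !prednK.
    by have := zj (Ordinal ii); rewrite /= prednK// => ->; rewrite scale0r dot0r.
  by rewrite zw => /esym/eqP; rewrite mulf_eq0 (negbTE p0) orbF => /eqP.
rewrite (frame_expand It zD) big1// => i _; case: (posnP i) => [i0|ip].
  by rewrite i0 z0 scale0r.
have ii : (i.-1 < m.-1)%N by rewrite -ltnS !prednK.
by have := zj (Ordinal ii); rewrite /= prednK// => ->; rewrite scale0r.
Qed.

Lemma sigma_smooth : exists O, [/\ open O, I `<=` O, smooth O gamma, smooth O ruling_mx &
  [/\ smooth O frame_mx, smooth O pivot, smooth O nu, forall i, (i < m)%N -> smooth O (e i) &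
  forall t, O t -> pivot t != 0]].
Proof.
have [ O [oO IO sg sn se]] := frame_smooth.
have sp : smooth O pivot.
  move=> n; apply: (Ck_ext oO (f := fun t => 0 - dot (derive1 (e 0%N) t) (nu t))).
    by move=> t _; rewrite sub0r.
  apply: CkBr => //; first exact: Ck_cst.
  by apply: Ck_dot => //; exact: smooth_derive1 (se 0%N m0) n.
pose O' := [set t | O t /\ pivot t != 0].
have oO' : open O'.
  apply: ball_open_set => t [Ot pt]; have p0 : 0 < `|pivot t| by rewrite normr_gt0.
  have [a a0 Ha] := continuous_ball (smooth_cont sp Ot) p0.
  have [b b0 Hb] := open_ballR oO Ot; exists (Num.min a b); first by rewrite lt_min a0.
  move=> s; rewrite lt_min => /andP[sa sb]; split; first exact: Hb.
  have := sgn_close (Ha s sa); apply: contraTneq => ->; rewrite mulr0 ltxx.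
  by [].
have sub : O' `<=` O by move=> t [].
have se' i : (i < m)%N -> smooth O' (e i) by move=> /se; exact: smooth_sub.
have sn' : smooth O' nu by exact: smooth_sub sub sn.
have sx : smooth O' ruling_mx.
  move=> n; apply: (Ck_mx_of oO') => i j.
  apply: (Ck_ext oO' (f := fun t => (dot (derive1 (e i.+1) t) (nu t) *: e 0%N t + pivot t *: e i.+1 t) 0 j)).
    by move=> t _; rewrite [RHS]mxE ruling_fieldE.
  apply: (Ck_coord 0 j oO'); apply: CkD => //; apply: (Ck_scalemx oO').
  - by apply: Ck_dot => //; exact: smooth_derive1 (se' _ (frame_index_lt i)) n.
  - exact: se'.
  - exact: Ck_sub sub _ (sp n).
  - exact: se' (frame_index_lt i) n.
exists O'; split=> //.
- by move=> t It; split; [exact: IO|exact: pivot_neq0].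
- exact: smooth_sub sub sg.
split=> //; [|exact: smooth_sub sub sp|by move=> t []].
move=> n; apply: (Ck_mx_of oO') => i j.
apply: (Ck_ext oO' (f := fun t => e i.+1 t 0 j)); first by move=> t _; rewrite mxE.
by apply: (Ck_coord 0 j oO'); exact: se' (frame_index_lt i) n.
Qed.

(** [transv] refers to [D], given on [I] only; its expansion in the frame makes sense, and is
    smooth, on a neighbourhood of [I]. *)
Definition transv_ext t := \sum_(i < m) (0 - dot (derive1 (e i) t) (nu t)) *: e i t.

Lemma transv_extE t : I t -> transv t = transv_ext t.
Proof.
move=> It; rewrite {1}(frame_expand It (transv_in t)); apply: eq_bigr => i _.
by rewrite transv_frame ?sub0r.
Qed.

(** The pairing is continuous in the triple formed by [t], [x] and [u], and its value at [t0], [t0],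
    0 is [pivot t0]. The parameters [t] and [x] are kept apart because the mean value theorem will
    test an intermediate derivative against a fixed [transv t]. *)
Lemma local_transversality t0 : I t0 -> exists rho c K : R, [/\ 0 < rho, 0 < c, 0 < K &
  forall t, I t -> `|t - t0| < rho -> `|transv t| <= K /\
    forall x u, `|x - t0| < rho -> `|u| < rho ->
      c <= `|dot (transv t) (derive1 gamma x + u *m derive1 ruling_mx x)|].
Proof.
move=> It0; have [ O [oO IO sg sx [_ _ sn se _]]] := sigma_smooth; have Ot0 := IO t0 It0.
have sw : smooth O transv_ext.
  move=> n; apply: Ck_sum => // i; apply: (Ck_scalemx oO); last exact: se.
  apply: CkBr => //; first exact: Ck_cst.
  by apply: Ck_dot => //; exact: smooth_derive1 (se i (ltn_ord i)) n.
pose V := (R * R * 'rV[R]_m.-1)%type.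
pose phi (q : V) := dot (transv_ext q.1.1) (derive1 gamma q.1.2 + q.2 *m derive1 ruling_mx q.1.2).
have c1 : {for (t0, t0, 0) : V, continuous (fun q : V => transv_ext q.1.1)}.
  apply: (@fst_cont _ (R * R)%type _ _ (fun p : R * R => transv_ext p.1)).
  apply: (@fst_cont _ R^o R^o _ transv_ext); exact: smooth_cont sw Ot0.
have c2 (T : normedModType R) (f : R -> T) : smooth O f ->
    {for (t0, t0, 0) : V, continuous (fun q : V => f q.1.2)}.
  move=> sf; apply: (@fst_cont _ (R * R)%type _ _ (fun p : R * R => f p.2)).
  by apply: (@snd_cont _ R^o R^o _ f); exact: smooth_cont sf Ot0.
have c3 : {for (t0, t0, 0) : V, continuous (fun q : V => q.2 *m derive1 ruling_mx q.1.2)}.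
  apply: continuous_mx_of => i j.
  have -> : (fun q : V => (q.2 *m derive1 ruling_mx q.1.2) i j) =
      (fun q : V => \sum_k q.2 i k * derive1 ruling_mx q.1.2 k j).
    by apply/funext => q; rewrite mxE.
  apply: (@cont_sum R V _ (fun k (q : V) => q.2 i k * derive1 ruling_mx q.1.2 k j)) => k.
  apply: continuousM.
    apply: (@snd_cont _ (R * R)%type _ _ (fun u : 'rV[R]_m.-1 => u i k)).
    exact: coord_continuous.
  apply: (c2 R^o (fun t => derive1 ruling_mx t k j)) => n.
  by apply: (Ck_coord k j oO); exact: smooth_derive1.
have cphi : {for (t0, t0, 0) : V, continuous phi}.
  apply: (@cont_sum R V N (fun i (q : V) => transv_ext q.1.1 0 i *
    (derive1 gamma q.1.2 + q.2 *m derive1 ruling_mx q.1.2) 0 i)) => i.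
  apply: continuousM; first exact: cont_coord.
  by apply: cont_coord; apply: continuousD => //; apply: c2; exact: smooth_derive1.
have phi0 : phi (t0, t0, 0) = pivot t0.
  have [_ _ _ e0] := He.
  by rewrite /phi /= mul0mx addr0 -transv_extE// -e0// pivotE.
have p0 : 0 < `|pivot t0| / 2 by rewrite divr_gt0// normr_gt0 pivot_neq0.
have [r1 r10 H1] := continuous_ball cphi p0.
have [r2 r20 H2] := continuous_ball (smooth_cont sw Ot0) ltr01.
exists (Num.min r1 r2), (`|pivot t0| / 2), (`|transv_ext t0| + 1); split=> //.
- by rewrite lt_min r10.
move=> t It; rewrite lt_min => /andP[t1 t2]; rewrite transv_extE//; split.
  have := H2 t t2; have := ler_distD (transv_ext t0) (transv_ext t) 0; rewrite !subr0.
  by move=> h1 h2; apply: (le_trans h1); rewrite addrC lerD2l ltW.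
move=> x u; rewrite !lt_min => /andP[x1 _] /andP[u1 _].
have : `|(t, x, u) - ((t0, t0, 0) : V)| < r1.
  by rewrite /Num.norm /= !gt_max /= t1 x1 subr0 u1.
move=> /H1; rewrite phi0 => /ltW h; apply: half_norm_le h.
Qed.

Lemma compact_ruling_bound : compact I -> exists2 K : R, 0 < K &
  forall t (u : 'rV_m.-1), I t -> `|u *m ruling_mx t| <= `|u| * K.
Proof.
move=> cI; have [ O [oO IO _ sx _]] := sigma_smooth.
have I0 : I !=set0 by have [t It] := cd_nondeg H; exists t; exact: interior_subset.
have cf : {within I, continuous (fun t : R => `|ruling_mx t|)}.
  apply: continuous_in_subspaceT => t; rewrite inE => It.
  apply: (@continuous_comp _ _ _ ruling_mx Num.norm); last exact: norm_continuous.
  by apply: smooth_cont sx _; exact: IO.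
have [c cI' Hc] := compact_EVT_max I0 cI cf.
exists (m.-1%:R * `|ruling_mx c| + 1); first by rewrite ltr_wpDl// mulr_ge0.
move=> t u It; rewrite (le_trans (mulmx_norm _ _))// mulrAC [leRHS]mulrC ler_wpM2r//.
by rewrite (@le_trans _ _ (m.-1%:R * `|ruling_mx c|)) ?lerDl// ler_wpM2l// Hc// inE.
Qed.

Lemma transv_ruling t u : I t -> dot (transv t) (u *m ruling_mx t) = 0.
Proof. by move=> It; have [_] := (ruling_transv _ It).1 (ruling_mx_in u It); rewrite dotC. Qed.

(** Pairing the difference with [transv t] removes every ruling vector at [t], whatever its
    coordinates. What remains is the increment between [t] and [s] of one scalar function whose
    derivative is bounded away from 0. *)
Lemma sigma_near t0 : I t0 -> exists2 rho : R, 0 < rho & forall t s u u', I t -> I s ->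
  `|t - t0| < rho -> `|s - t0| < rho -> `|u| < rho -> `|u'| < rho ->
  rho * `|s - t| <= `|(gamma s + u' *m ruling_mx s) - (gamma t + u *m ruling_mx t)|.
Proof.
move=> It0; have [rho [c [K [rho0 c0 K0 HT]]]] := local_transversality It0.
have [ O [oO IO sg sx _]] := sigma_smooth; have Ot0 := IO t0 It0.
have [r1 r10 H1] := open_ballR oO Ot0.
have NK : 0 < N%:R * K + 1 by rewrite ltr_wpDl// mulr_ge0// ltW.
exists (Num.min (Num.min rho r1) (c / (N%:R * K + 1))); first by rewrite !lt_min rho0 r10 divr_gt0.
move=> t s u u' It Is; rewrite !lt_min => /andP[/andP[t1 t2] _] /andP[/andP[s1 s2] _] _ /andP[/andP[u1 _] _].
have [wK wc] := HT t It t1; set w := transv t in wK wc.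
set z := _ - (_ + _).
pose f x : R := dot w (gamma x + u' *m ruling_mx x).
have wz : dot w z = f s - f t.
  by rewrite /z /f dotBr !dotDr !(transv_ruling _ It) -/w.
have iB : is_interval [set x : R | `|x - t0| < Num.min rho r1] := @ball_interval R t0 _.
have bt : `|t - t0| < Num.min rho r1 by rewrite lt_min t1.
have bs : `|s - t0| < Num.min rho r1 by rewrite lt_min s1.
have df x : `|x - t0| < Num.min rho r1 -> differentiable (f : R -> R) x /\
    derive1 f x = dot w (derive1 gamma x + u' *m derive1 ruling_mx x).
  rewrite lt_min => /andP[_ /H1 Ox].
  have dg : differentiable gamma x := smooth_diff sg Ox.
  have dm : differentiable ruling_mx x := smooth_diff sx Ox.
  have du : differentiable (fun x => u' *m ruling_mx x) x.
    by apply: differentiable_mulmx => //; exact: differentiable_const.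
  have dh : differentiable (fun x => gamma x + u' *m ruling_mx x) x by exact: differentiableD.
  split; first by apply: differentiable_dot; [exact: differentiable_const|exact: dh].
  rewrite derive1E (derive_dot (1 : R) (differentiable_const w x) dh) derive_cst dot0l add0r.
  by rewrite deriveD; [|exact: diff_derivable dg|exact: diff_derivable du]; rewrite -!derive1E derive1_mulmxl.
have [|x x01 E0] := @mvt_segment R R^o f t s.
  by move=> x x01; have [] := df _ (interval_segment iB bt bs x01).
have bx := interval_segment iB bt bs x01; have [dfx f'x] := df _ bx.
have E1 : f s - f t = (s - t) * derive1 f (t + x * (s - t)).
  by apply: (etrans E0); exact: (derive_scale1 (s - t) dfx).
have h1 : c * `|s - t| <= N%:R * K * `|z|.
  have : c * `|s - t| <= `|dot w z|.
    rewrite wz E1 normrM mulrC ler_wpM2l// f'x; apply: wc => //.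
    by move: bx; rewrite /= lt_min => /andP[].
  move=> h; apply: (le_trans h); apply: (le_trans (norm_dot _ _)).
  by rewrite ler_wpM2r// ler_wpM2l.
rewrite (@le_trans _ _ (c / (N%:R * K + 1) * `|s - t|))//.
  by rewrite ler_wpM2r// !ge_min lexx orbT.
rewrite mulrAC ler_pdivrMr// (le_trans h1)// mulrC ler_wpM2l// lerDl.
exact: ler01.
Qed.

(** For parameters both near [t0] the separation comes from transversality; otherwise it comes from
    the embeddedness of [gamma], as short ruling vectors cannot bridge the gap. Compactness turns
    the local radii into one [eps]. *)
Lemma sigma_radius (r : R -> R) : compact I -> (forall s t, `|r s - r t| <= `|s - t| / 2) ->
  (forall t, I t -> 0 < r t) -> exists2 eps : R, 0 < eps & forall t u, I t -> `|u| < eps ->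
    [/\ `|u *m ruling_mx t| < r t,
      dot (transv t) (derive1 gamma t + u *m derive1 ruling_mx t) != 0 &
      forall s u', I s -> `|u'| < eps ->
        eps * `|s - t| <= `|(gamma s + u' *m ruling_mx s) - (gamma t + u *m ruling_mx t)|].
Proof.
move=> cI rL r0; have I0 : I !=set0 by have [t It] := cd_nondeg H; exists t; exact: interior_subset.
have [a [b [Ia Ib ab]]] := compact_bounds I0 cI.
have [K K0 HK] := compact_ruling_bound cI; have [_ _ /embedding_inverse emb] := cd_emb H.
pose q t c := forall u, `|u| < c -> [/\ `|u *m ruling_mx t| < r t,
      dot (transv t) (derive1 gamma t + u *m derive1 ruling_mx t) != 0 &
      forall s u', I s -> `|u'| < c ->
        c * `|s - t| <= `|(gamma s + u' *m ruling_mx s) - (gamma t + u *m ruling_mx t)|].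
have [|t0 It0|r1 [r1L r10 r1q]] := @lipschitz_minorant R I q.
- move=> t c d dc qc u ud; have [q1 q2 q3] := qc u (lt_le_trans ud dc); split=> // s u' Is u'd.
  by apply: le_trans (q3 s u' Is (lt_le_trans u'd dc)); rewrite ler_wpM2r.
- have [p1 p10 Hp1] := sigma_near It0.
  have [p2 [c [K' [p20 c0 _ Hp2]]]] := local_transversality It0.
  have [eta eta0 Heta] := emb t0 It0 p1 p10.
  have eta4 : 0 < eta / 4 by rewrite divr_gt0.
  have [d1 d10 Hd1] := gamma_close H It0 eta4.
  have rt0 := r0 t0 It0; have ba : 0 < b - a + 1 by have := ab a Ia => /andP[_]; lra.
  (* The last entry converts the fixed gap [eta / 4] between far points into a bound linear in the
     parameter distance, which is at most [b - a + 1]. *)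
  pose rho := Num.min (Num.min (Num.min p1 p2) (Num.min d1 (r t0)))
     (Num.min (r t0 / 2 / K) (Num.min (eta / 4 / K) (eta / 4 / (b - a + 1)))).
  have rho0 : 0 < rho by rewrite !lt_min p10 p20 d10 rt0 !divr_gt0.
  exists rho => // t It td u ur.
  have rle x : x < rho -> [/\ x < p1, x < p2, x < d1, x < r t0 & [/\ x * K < r t0 / 2,
      x * K < eta / 4 & rho <= eta / 4 / (b - a + 1)]].
    rewrite !lt_min => /andP[/andP[/andP[h1 h2] /andP[h3 h4]] /andP[h5 /andP[h6 _]]].
    split=> //; split; [by rewrite -ltr_pdivlMr|by rewrite -ltr_pdivlMr|].
    by rewrite /rho !ge_min lexx !orbT.
  have [t1 t2 t3 t4 _] := rle _ td; have [u1 u2 _ _ [u5 u6 rb]] := rle _ ur.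
  have uX : `|u *m ruling_mx t| <= `|u| * K := HK t u It.
  split.
  + rewrite (le_lt_trans uX)// (lt_le_trans u5)//.
    by have [_ h] := lip_radius (rL t t0); move: h t4; set x := `|t - t0|; lra.
  + have [_ wc] := Hp2 t It t2; have := wc t u t2 u2; rewrite -normr_gt0.
    exact: lt_le_trans.
  move=> s u' Is u'r; have [v1 _ _ _ [_ v6 _]] := rle _ u'r.
  have [sp|sp] := ltP `|s - t0| p1.
    apply: le_trans (Hp1 t s u u' It Is t1 sp u1 v1); rewrite ler_wpM2r//.
    by rewrite /rho !ge_min lexx.
  have far : eta <= `|gamma s - gamma t0|.
    by rewrite leNgt; apply/negP => /(Heta s Is); rewrite ltNge sp.
  have st : `|s - t| <= b - a + 1.
    have /andP[s1 s2] := ab s Is; have /andP[t5 t6] := ab t It.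
    by rewrite ler_norml; apply/andP; split; lra.
  have big : eta / 4 <= `|(gamma s + u' *m ruling_mx s) - (gamma t + u *m ruling_mx t)|.
    have u'X : `|u' *m ruling_mx s| <= `|u'| * K := HK s u' Is.
    have gt := Hd1 t t3; set z := _ - (_ + _).
    have E0 : gamma s - gamma t0 = z + (gamma t - gamma t0) + u *m ruling_mx t - u' *m ruling_mx s.
      rewrite /z; move: (u *m ruling_mx t) (u' *m ruling_mx s) => A1 A2.
      by apply/rowP => j; rewrite !mxE; ring.
    have := ler_normB (z + (gamma t - gamma t0) + u *m ruling_mx t) (u' *m ruling_mx s).
    have := ler_normD (z + (gamma t - gamma t0)) (u *m ruling_mx t).
    have := ler_normD z (gamma t - gamma t0); rewrite -E0.
    move: far gt u'X uX u6 v6; exact: far_bound.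
  rewrite (le_trans _ big)//; have := ler_pM (ltW rho0) (normr_ge0 _) rb st.
  by rewrite divfK ?gt_eqF.
have c1 : {within I, continuous r1} by apply: continuous_subspaceT; exact: lipschitz_continuous.
have [c cI' Hc] := compact_EVT_min I0 cI c1; rewrite inE in cI'.
exists (r1 c); first exact: r10.
move=> t u It ur; have rct : r1 c <= r1 t by apply: Hc; rewrite inE.
have [q1 q2 q3] := r1q t It u (lt_le_trans ur rct); split=> // s u' Is u'r.
by apply: le_trans (q3 s u' Is (lt_le_trans u'r rct)); rewrite ler_wpM2r.
Qed.

(** Once the parameter [s] is known, the coordinates on the ruling are a continuous function of the
    point and [s], by the relation of [ruling_mx] to [frame_mx]. *)
Lemma ruling_coord_cont t u d : I t -> 0 < d -> exists2 del : R, 0 < del & forall s u',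
  I s -> `|s - t| < del ->
  `|(gamma s + u' *m ruling_mx s) - (gamma t + u *m ruling_mx t)| < del -> `|u' - u| < d.
Proof.
move=> It d0; have [ O [oO IO sg sx [sf sp _ _ pn]]] := sigma_smooth; have Ot := IO t It.
pose psi (q : E * R) := (pivot q.2)^-1 *: ((q.1 - gamma q.2) *m (frame_mx q.2)^T).
have psiE s v : I s -> psi (gamma s + v *m ruling_mx s, s) = v.
  move=> Is; rewrite /psi /= addrAC subrr add0r -mulmxA ruling_frame_mx// mul_mx_scalar.
  by rewrite scalerA mulVf ?scale1r// pn//; exact: IO.
pose y := gamma t + u *m ruling_mx t.
pose O2 := [set q : E * R | O q.2].
have oO2 : open O2 by apply: open_comp oO => q _; exact: cvg_snd.
have cS p k n (f : R -> 'M[R]_(p, k)) : smooth O f -> Ck n O2 (fun q : E * R => f q.2).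
  move=> sf'; apply: (@Ck_comp_mxR R (E * R)%type p k n O2 O (fun q => q.2) f oO2 oO) => //.
  exact: Ck_snd.
have cpsi : Ck 0 O2 psi.
  apply: (Ck_scalemx oO2).
    apply: (CkV oO2); first by move=> q; exact: pn.
    apply: (Ck_comp_R (O' := O) (g := fun q : E * R => q.2) oO2 _ _ (sp 0%N)); last exact: Ck_snd.
    by move=> q h; exact: h.
  apply: (Ck_mulmx oO2); last by apply: (Ck_trmx oO2); exact: cS.
  by apply: (CkB oO2); [exact: Ck_fst|exact: cS].
have Oy : O2 (y, t) := Ot.
have [del del0 Hdel] := continuous_ball (cpsi (y, t) Oy) d0.
exists del => // s u' Is st sy; rewrite -(psiE s u' Is) -(psiE t u It); apply: Hdel.
by rewrite /Num.norm /= gt_max /= sy st.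
Qed.

Lemma sigma_derive t u (v : R * 'rV[R]_m.-1) : I t ->
  'D_v (sigma (m := m) gamma e nu) (t, u) =
    v.1 *: (derive1 gamma t + u *m derive1 ruling_mx t) + v.2 *m ruling_mx t.
Proof.
move=> It; have [ O [oO IO sg sx _]] := sigma_smooth; have Ot := IO t It.
have -> : sigma (m := m) gamma e nu = fun q => gamma q.1 + q.2 *m ruling_mx q.1.
  by apply/funext => q; exact: sigma_mx.
have dg : differentiable gamma t := smooth_diff sg Ot.
have dx : differentiable ruling_mx t := smooth_diff sx Ot.
pose V := (R * 'rV[R]_m.-1)%type.
have df : differentiable (fun q : V => q.1) (t, u) by have [h _] := @Ck_fst R R^o 'rV[R]_m.-1 1 setT; exact: h.
have ds : differentiable (fun q : V => q.2) (t, u) by have [h _] := @Ck_snd R R^o 'rV[R]_m.-1 1 setT; exact: h.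
have d1 : differentiable (fun q : V => gamma q.1) (t, u).
  by apply: (differentiable_comp' (f := gamma) df).
have d2 : differentiable (fun q : V => ruling_mx q.1) (t, u).
  by apply: (differentiable_comp' (f := ruling_mx) df).
rewrite deriveD; [|exact: diff_derivable d1|exact: diff_derivable (differentiable_mulmx ds d2)].
rewrite (derive_mulmx v ds d2).
have -> : 'D_v (fun q : V => gamma q.1) (t, u) = v.1 *: derive1 gamma t.
  by rewrite (derive_compR (f := fun q : V => q.1) v df dg) derive_fst.
have -> : 'D_v (fun q : V => ruling_mx q.1) (t, u) = v.1 *: derive1 ruling_mx t.
  by rewrite (derive_compR (f := fun q : V => q.1) v df dx) derive_fst.
by rewrite derive_snd -scalemxAr scalerDr -addrA [_ *m _ + _]addrC addrA.
Qed.

Lemma cube_norm (eps : R) (u : 'rV[R]_m.-1) : 0 < eps -> cube eps u <-> `|u| < eps.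
Proof.
move=> e0; split=> [uc|ue j]; first exact: rV_norm_lt.
exact: le_lt_trans (rV_norm_coord u j) ue.
Qed.

Theorem sigma_solution M : compact I -> is_solution m I gamma D M ->
  exists2 eps0 : R, 0 < eps0 & forall eps, 0 < eps < eps0 ->
    [/\ smooth_embedding (I `*` cube eps) (sigma (m := m) gamma e nu),
        sigma (m := m) gamma e nu @` (I `*` cube eps) `<=` M &
        exists U, [/\ open U, gamma @` I° `<=` U &
          M `&` U = sigma (m := m) gamma e nu @` (I° `*` cube eps)]].
Proof.
move=> cI sol; have [r [rL r0 rq]] := strip_radius H m0 sol.
have [eps0 eps00 Heps] := sigma_radius cI rL r0; exists eps0 => // eps /andP[eps1 eps2].
have cubeP (u : 'rV[R]_m.-1) : cube eps u -> `|u| < eps0.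
  by move=> /(cube_norm _ eps1) h; exact: lt_trans eps2.
have SM : sigma (m := m) gamma e nu @` (I `*` cube eps) `<=` M.
  move=> _ [[t u] [/= It /cubeP uc] <-]; rewrite sigma_mx /=.
  have [ur _ _] := Heps t u It uc.
  by have [] := rq t _ It (ruling_mx_in u It) ur.
split; [split| |].
- have [ O [oO IO sg sx _]] := sigma_smooth.
  pose O2 := [set q : R * 'rV[R]_m.-1 | O q.1].
  have oO2 : open O2 by apply: open_comp oO => q _; exact: cvg_fst.
  apply: (@smooth_smooth_on _ _ _ _ O2 _ oO2); first by move=> q [/= /IO].
  have -> : sigma (m := m) gamma e nu = fun q => gamma q.1 + q.2 *m ruling_mx q.1.
    by apply/funext => q; exact: sigma_mx.
  have cS p k n (f : R -> 'M[R]_(p, k)) : smooth O f -> Ck n O2 (fun q : R * 'rV[R]_m.-1 => f q.1).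
    move=> sf'; apply: (@Ck_comp_mxR R (R * 'rV[R]_m.-1)%type p k n O2 O (fun q => q.1) f oO2 oO) => //.
    exact: Ck_fst.
  move=> n; apply: CkD => //; first exact: cS.
  by apply: (Ck_mulmx oO2); [exact: Ck_snd|exact: cS].
- move=> [t u] v [/= It /cubeP uc]; rewrite sigma_derive// => E0.
  have [_ tr _] := Heps t u It uc.
  (* Pairing with [transv t] kills the ruling directions and leaves [v.1] times a nonzero number;
     the frame then recovers [v.2]. *)
  have v1 : v.1 = 0.
    have := congr1 (dot (transv t)) E0; rewrite dotDr dotZr transv_ruling// addr0 dot0r => /eqP.
    by rewrite mulf_eq0 (negbTE tr) orbF => /eqP.
  have v2 : v.2 = 0.
    move: E0; rewrite v1 scale0r add0r => /(congr1 (mulmx^~ (frame_mx t)^T)) /=.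
    rewrite -mulmxA ruling_frame_mx// mul_mx_scalar mul0mx => /eqP.
    by rewrite scaler_eq0 (negbTE (pivot_neq0 It)) => /eqP.
  by case: v v1 v2 {E0} => /= ? ? -> ->.
- apply/embedding_inverse => -[t u] [/= It /cubeP uc] d d0.
  have [del del0 Hdel] := ruling_coord_cont u It d0.
  have dm : 0 < eps0 * Num.min del d by rewrite mulr_gt0// lt_min del0.
  exists (Num.min del (eps0 * Num.min del d)); first by rewrite lt_min del0.
  move=> [s u'] [/= Is /cubeP u'c]; rewrite lt_min !sigma_mx /= => /andP[h1 h2].
  have [_ _ /(_ s u' Is u'c) h3] := Heps t u It uc.
  have := le_lt_trans h3 h2; rewrite ltr_pM2l// lt_min => /andP[st sd].
  by rewrite /Num.norm /= gt_max /= sd (Hdel s u' Is st h1).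
- exact: SM.
apply: relatively_open.
- move=> _ [[t u] [/= It uc] <-]; apply: SM; exists (t, u) => //; split=> //=.
  exact: interior_subset.
- move=> t It; exists (t, 0); last by rewrite sigma_mx /= mul0mx addr0.
  by split=> //= j; rewrite mxE normr0.
move=> _ [[t u] [/= It' uc] <-]; have It := interior_subset It'; rewrite sigma_mx /=.
have [ur _ _] := Heps t u It (cubeP u uc).
have /(cube_norm u eps1) un := uc.
have g0 : 0 < eps - `|u| by rewrite subr_gt0.
have [del del0 Hdel] := ruling_coord_cont u It g0.
have [e3 e30 H3] := open_ballR (@open_interior _ I) It'.
have [_ /(_ It' (Num.min del e3))] := rq t _ It (ruling_mx_in u It) ur.
rewrite lt_min del0 => /(_ e30)[eta eta0 Hy].
exists (Num.min eta del); first by rewrite lt_min eta0.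
move=> y; rewrite lt_min => /andP[y1 y2] My; have [s [Is]] := Hy y My y1.
(* The coordinates of [y] on the ruling through [gamma s]; by continuity they are within [eps - |u|]
   of [u], hence still in the cube. *)
rewrite lt_min => /andP[s1 s2] rs; set u' := (pivot s)^-1 *: ((y - gamma s) *m (frame_mx s)^T).
have yE : gamma s + u' *m ruling_mx s = y.
  by rewrite /u' -ruling_mx_exists// addrC subrK.
exists (s, u'); last by rewrite sigma_mx.
split=> /=; first exact: H3.
apply/(cube_norm _ eps1).
have : `|u' - u| < eps - `|u| by apply: (Hdel s u' Is s1); rewrite yE.
by move=> h; rewrite -(subrK u u') (le_lt_trans (ler_normD _ _))// -ltrBrDr.
Qed.

End Sigma.

Theorem theorem1p3 (R : realType) (m n : nat) (hm : (2 <= m)%N) (hn : (1 <= n)%N)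
    (I : set R) (I_itv : is_interval I) (I_nondeg : I° !=set0)
    (gamma : R -> 'rV[R]_(m + n)) (gamma_emb : smooth_embedding I gamma)
    (D : R -> {vspace 'rV[R]_(m + n)}) (D_smooth : smooth_distribution m I D)
    (gamma_D : forall t, I t -> derive1 gamma t \in D t)
    (gamma_curved : forall t, I t ->
       perp_proj [set` D t] (derive1n 2 gamma t) != 0) :
  ((exists M, is_solution m I gamma D M) <->
     (forall t, I t -> has_dim (im_rho I D t) 1%N)) /\
  (* (i) *)
  (forall M1 M2, is_solution m I gamma D M1 -> is_solution m I gamma D M2 ->
     exists U, [/\ open U, gamma @` I° `<=` U & M1 `&` U = M2 `&` U]) /\
  (* (ii) *)
  (forall M, is_solution m I gamma D M ->
     exists r : R -> R,
       [/\ {within I, continuous r}, (forall t, I t -> 0 < r t),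
           ruled_strip I gamma D I r `<=` M &
           exists U, [/\ open U, gamma @` I° `<=` U &
             M `&` U = ruled_strip I gamma D I° r]]) /\
  (* (iii) *)
  (compact I -> (forall t, I t -> dot (derive1 gamma t) (derive1 gamma t) = 1) ->
   forall M, is_solution m I gamma D M ->
     (exists e nu, adapted_frame m I gamma D e /\ transversal_section I D nu) /\
     (forall e nu, adapted_frame m I gamma D e -> transversal_section I D nu ->
        exists2 eps0 : R, 0 < eps0 & forall eps, 0 < eps < eps0 ->
          [/\ smooth_embedding (I `*` cube eps) (sigma (m := m) gamma e nu),
              sigma (m := m) gamma e nu @` (I `*` cube eps) `<=` M &
              exists U, [/\ open U, gamma @` I° `<=` U &
                M `&` U = sigma (m := m) gamma e nu @` (I° `*` cube eps)]])).
Proof.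
have m0 : (0 < m)%N by exact: leq_trans hm.
have H : cauchy_data m I gamma D by split.
split.
  split=> [[M sol] t It|rk]; first exact: (rank_necessary H m0 sol It).
  exact: (existence H m0 rk).
split; first by move=> M1 M2; exact: (solution_unique H m0).
split; first by move=> M; exact: (solution_strip H m0).
move=> cI unit M sol; have rk t : I t -> has_dim (im_rho I D t) 1%N.
  by move=> It; exact: (rank_necessary H m0 sol It).
split; first exact: (adapted_data_exist H m0 rk cI unit).
by move=> e nu He Hnu; exact: (sigma_solution H m0 rk He Hnu cI sol).
Qed.
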